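(* Let $\Omega\subset\mathbb{R}^d$ be an open subset (possibly unbounded) and $T>0$. Let $\{f_m(t,x,v)\}_m$ be a sequence of nonnegative functions on $(0,T)\times\Omega\times\mathbb{R}^d$ such that: (P1) $f_m\rightharpoonup f$ weakly in $L^1((0,T)\times\Omega\times\mathbb{R}^d)$. (P2) For each $\psi\in C_c(\mathbb{R}^d)$, the sequence of averages $\left\{\int_{\mathbb{R}^d}f_m\psi(v)\,dv\right\}_m$ converges in $L^1((0,T)\times\Omega)$. (P3) There are Lebesgue measurable functions $a_m:(0,T)\times\Omega\to[0,\infty]$ and a constant $C$ such that $$\sup_m\int_{(0,T)\times\Omega\times\mathbb{R}^d}a_m(t,x)\left|\nabla_v\sqrt{f_m}\right|^2dt\,dx\,dv\le C.$$ (P4) There is a measurable function $a:(0,T)\times\Omega\to[0,\infty]$ such that $a_m\to a$ a.e. in $D_+:=\{(t,x)\in(0,T)\times\Omega:a(t,x)>0\}$, and $D_+=\{(t,x):\rho_f(t,x)>0\}$ up to a Lebesgue-negligible set. Then, modulo a subsequence, $f_m\to f$ a.e. and strongly in $L^1((0,T)\times\Omega\times\mathbb{R}^d)$.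
   Context: $\rho_f(t,x):=\int_{\mathbb{R}^d}f(t,x,v)\,dv$. $\nabla_v$ is the weak gradient in the variable $v$; in (P3) it is understood that, for a.e. $(t,x)$ with $a_m(t,x)>0$, the function $v\mapsto\sqrt{f_m(t,x,v)}$ is weakly differentiable, and the integrand is read as $0$ where $a_m=0$. *)

(* Defs.v *)
From HB Require Import structures.
From mathcomp Require Import all_boot all_order all_algebra.
From mathcomp Require Import all_classical all_reals all_analysis.
From mathcomp Require Import measurable_realfun.

Set Implicit Arguments.
Unset Strict Implicit.
Unset Printing Implicit Defensive.

Import Order.TTheory GRing.Theory Num.Theory.
Import numFieldNormedType.Exports.

Local Open Scope classical_set_scope.
Local Open Scope ring_scope.

(** R^d is ['rV[R]_d].  The sigma-algebra generated by the coordinates is the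
    Borel one, since R^d is second countable. *)

Definition measure_rV_display : measure_display.
Proof. exact: default_measure_display. Qed.

Section measurable_rV.
Context {R : realType} (d : nat).

Let coord (i : 'I_d) (v : 'rV[R]_d) : R := v ord0 i.

Let rV_set0 : g_sigma_preimage coord set0.
Proof. exact: sigma_algebra0. Qed.

Let rV_setC A : g_sigma_preimage coord A -> g_sigma_preimage coord (~` A).
Proof. exact: sigma_algebraC. Qed.

Let rV_bigcup (F : (set 'rV[R]_d)^nat) :
  (forall i, g_sigma_preimage coord (F i)) ->
  g_sigma_preimage coord (\bigcup_i F i).
Proof. exact: sigma_algebra_bigcup. Qed.

HB.instance Definition _ := @isMeasurable.Build measure_rV_display
  'rV[R]_d (g_sigma_preimage coord) rV_set0 rV_setC rV_bigcup.

Lemma measurable_coord_rV (i : 'I_d) :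
  measurable_fun [set: 'rV[R]_d] (fun v : 'rV[R]_d => v ord0 i).
Proof.
move=> _ Y mY; rewrite setTI; apply: sub_sigma_algebra => /=.
rewrite -bigcup_seq/=; exists i => /=; first by rewrite mem_index_enum.
by exists Y => //; rewrite setTI.
Qed.

Lemma measurable_fun_rV d0 (T : measurableType d0) (f : T -> 'rV[R]_d) :
  (forall i, measurable_fun [set: T] (fun x => f x ord0 i)) ->
  measurable_fun [set: T] f.
Proof.
move=> mf.
suff : g_sigma_preimage (fun i => coord i \o f) `<=` measurable.
  rewrite g_sigma_preimage_comp => prefS _ A mA.
  by apply: prefS; exists A.
apply: smallest_sub; first exact: sigma_algebra_measurable.
rewrite -bigcup_seq; apply: bigcup_sub => i _ A [B mB <-].
exact: mf.
Qed.

End measurable_rV.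

Lemma sigma_finite_prod d1 d2 (T1 : measurableType d1)
    (T2 : measurableType d2) (R : realType)
    (m1 : {sigma_finite_measure set T1 -> \bar R})
    (m2 : {sigma_finite_measure set T2 -> \bar R}) :
  sigma_finite setT (m1 \x m2)%E.
Proof.
have /sigma_finiteP[F [TF ndF Foo]] := sigma_finiteT m1.
have /sigma_finiteP[G [TG ndG Goo]] := sigma_finiteT m2.
exists (fun n => F n `*` G n).
  rewrite -setXTT TF TG predeqE => -[x y]; split.
    move=> [/= [n _ Fnx] [k _ Gky]]; exists (maxn n k) => //; split.
    - by move: x Fnx; exact/subsetPset/ndF/leq_maxl.
    - by move: y Gky; exact/subsetPset/ndG/leq_maxr.
  by move=> [n _ []/= ? ?]; split; exists n.
move=> k; have [? ?] := Foo k; have [? ?] := Goo k.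
split; first exact: measurableX.
by rewrite product_measure1E// lte_mul_pinfty// ge0_fin_numE.
Qed.

(** Lebesgue measure on R^d, as an iterated product:
    lambda_0 = Dirac mass on the one-point space R^0, and
    lambda_{d+1} = image of lambda_1 x lambda_d under (x, v) |-> (x :: v). *)

Section lebesgue_cons.
Context {R : realType} (d : nat).

Definition rV_cons (p : measurableTypeR R * 'rV[R]_d) : 'rV[R]_d.+1 :=
  \row_i (if unlift ord0 i is Some j then p.2 ord0 j else p.1).

Definition rV_uncons (v : 'rV[R]_d.+1) : measurableTypeR R * 'rV[R]_d :=
  (v ord0 ord0, \row_j v ord0 (lift ord0 j)).

Lemma rV_consK : cancel rV_cons rV_uncons.
Proof.
move=> [x v]; congr pair; first by rewrite mxE unlift_none.
by apply/rowP => j; rewrite !mxE liftK.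
Qed.

Lemma rV_unconsK : cancel rV_uncons rV_cons.
Proof.
move=> v; apply/rowP => i; rewrite mxE.
by case: unliftP => [j ->|->] //=; rewrite mxE.
Qed.

Lemma measurable_rV_cons : measurable_fun setT rV_cons.
Proof.
apply: measurable_fun_rV => i; under eq_fun do rewrite mxE.
case: unliftP => [j _|_]; last exact: measurable_fst.
apply: (measurableT_comp (measurable_coord_rV j)); exact: measurable_snd.
Qed.

Lemma measurable_rV_uncons : measurable_fun setT rV_uncons.
Proof.
apply: measurable_fun_pair; first exact: measurable_coord_rV.
apply: measurable_fun_rV => i; under eq_fun do rewrite mxE.
exact: measurable_coord_rV.
Qed.

Variable mu : {sigma_finite_measure set 'rV[R]_d -> \bar R}.

Definition lebesgue_cons : set 'rV[R]_d.+1 -> \bar R :=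
  pushforward (lebesgue_measure \x mu)%E rV_cons.

Let lebesgue_cons0 : lebesgue_cons set0 = 0%E.
Proof. by rewrite /lebesgue_cons /pushforward preimage_set0 measure0. Qed.

Let lebesgue_cons_ge0 A : (0 <= lebesgue_cons A)%E.
Proof. by rewrite /lebesgue_cons /pushforward measure_ge0. Qed.

Let lebesgue_cons_sigma_additive : semi_sigma_additive lebesgue_cons.
Proof.
move=> F mF tF mUF; rewrite /lebesgue_cons /pushforward preimage_bigcup.
apply: measure_semi_sigma_additive.
- by move=> n; rewrite -[X in measurable X]setTI; exact: measurable_rV_cons.
- apply/trivIsetP => /= i j _ _ ij; rewrite -preimage_setI.
  by move/trivIsetP : tF => /(_ _ _ _ _ ij) ->//; rewrite preimage_set0.
- rewrite -preimage_bigcup -[X in measurable X]setTI.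
  exact: measurable_rV_cons.
Qed.

HB.instance Definition _ := isMeasure.Build _ _ _ lebesgue_cons
  lebesgue_cons0 lebesgue_cons_ge0 lebesgue_cons_sigma_additive.

Let lebesgue_cons_sigma_finite : sigma_finite setT lebesgue_cons.
Proof.
have [F FT Foo] : sigma_finite setT (lebesgue_measure \x mu)%E.
  exact: sigma_finite_prod.
exists (fun n => rV_uncons @^-1` F n).
  by rewrite -preimage_bigcup -FT preimage_setT.
move=> n; have [mF Fn] := Foo n; split.
  by rewrite -[X in measurable X]setTI; exact: measurable_rV_uncons.
rewrite /lebesgue_cons /pushforward -comp_preimage.
by have /funext -> : rV_uncons \o rV_cons =1 id by exact: rV_consK.
Qed.

HB.instance Definition _ := Measure_isSigmaFinite.Build _ _ _ lebesgue_cons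
  lebesgue_cons_sigma_finite.

End lebesgue_cons.

Fixpoint lebesgue_rV {R : realType} (d : nat) :
    {sigma_finite_measure set 'rV[R]_d -> \bar R} :=
  if d is d'.+1 then lebesgue_cons (lebesgue_rV d')
  else dirac (0 : 'rV[R]_0).


(** Named copies of the product measures: canonical structure inference does
    not find the sigma-finite structure of a product [m1 \x m2]. *)

Definition lebesgue_tx {R : realType} (d : nat) :
    set (measurableTypeR R * 'rV[R]_d) -> \bar R :=
  (lebesgue_measure \x lebesgue_rV d)%E.

Arguments lebesgue_tx {R} d.

HB.instance Definition _ (R : realType) (d : nat) :=
  Measure.copy (@lebesgue_tx R d) (@lebesgue_measure R \x lebesgue_rV d)%E.

HB.instance Definition _ (R : realType) (d : nat) :=
  Measure_isSigmaFinite.Build _ _ _ (@lebesgue_tx R d)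
    (sigma_finite_prod lebesgue_measure (lebesgue_rV d)).

Definition lebesgue_txv {R : realType} (d : nat) :
    set ((measurableTypeR R * 'rV[R]_d) * 'rV[R]_d) -> \bar R :=
  (lebesgue_tx d \x lebesgue_rV d)%E.

Arguments lebesgue_txv {R} d.

HB.instance Definition _ (R : realType) (d : nat) :=
  Measure.copy (@lebesgue_txv R d) (@lebesgue_tx R d \x lebesgue_rV d)%E.

HB.instance Definition _ (R : realType) (d : nat) :=
  Measure_isSigmaFinite.Build _ _ _ (@lebesgue_txv R d)
    (sigma_finite_prod (lebesgue_tx d) (lebesgue_rV d)).

Definition domain_tx {R : realType} {d : nat} (T : R) (Omega : set 'rV[R]_d) :
    set (measurableTypeR R * 'rV[R]_d) :=
  `]0, T[ `*` Omega.

Definition domain_txv {R : realType} {d : nat} (T : R) (Omega : set 'rV[R]_d) :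
    set ((measurableTypeR R * 'rV[R]_d) * 'rV[R]_d) :=
  domain_tx T Omega `*` setT.

Section lebesgue_spaces.
Context d (T : measurableType d) (R : realType).
Variables (mu : {measure set T -> \bar R}) (D : set T).

(** Measurability for the mu-completion of the sigma-algebra of T.  For such
    functions the library integral, a supremum over simple functions
    measurable for the sigma-algebra of T itself, is the integral with respect
    to the completed measure. *)
Definition lebesgue_measurable_fun d' (U : measurableType d') (f : T -> U) :=
  exists2 g : T -> U, measurable_fun D g &
    {ae mu, forall x, D x -> f x = g x}.

Definition in_L1 (f : T -> R) :=
  lebesgue_measurable_fun f /\ (\int[mu]_(x in D) `|f x|%:E < +oo)%E.

Definition in_Loo (f : T -> R) :=
  lebesgue_measurable_fun f /\
  exists M : R, {ae mu, forall x, D x -> `|f x| <= M}.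

Definition cvg_L1 (f_ : nat -> T -> R) (f : T -> R) :=
  [/\ forall m, in_L1 (f_ m), in_L1 f &
    (fun m => \int[mu]_(x in D) `|f_ m x - f x|%:E)%E @ \oo --> 0%E].

Definition weak_cvg_L1 (f_ : nat -> T -> R) (f : T -> R) :=
  [/\ forall m, in_L1 (f_ m), in_L1 f &
    forall g, in_Loo g ->
      (fun m => \int[mu]_(x in D) (f_ m x * g x)) @ \oo -->
        \int[mu]_(x in D) (f x * g x)].

End lebesgue_spaces.

Section functions_on_rV.
Context {R : realType} (d : nat).
Implicit Types (u phi : 'rV[R]_d -> R) (g : 'rV[R]_d -> 'rV[R]_d).

Definition compactly_supported phi :=
  compact (closure [set v | phi v != 0]).

Definition in_Cc phi := continuous phi /\ compactly_supported phi.

Definition partial (i : 'I_d) phi : 'rV[R]_d -> R :=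
  fun v => 'D_(delta_mx ord0 i) phi v.

Definition smooth phi := forall s : seq 'I_d,
  continuous (foldr partial phi s) /\
  forall i v, derivable (foldr partial phi s) v (delta_mx ord0 i).

Definition in_L1loc u :=
  forall K, compact K -> in_L1 (lebesgue_rV d) K u.

(** Weak differentiability of [u] is part of the statement that [g] is its
    weak gradient; [g] is one representative of its a.e. class. *)
Definition is_weak_gradient u g :=
  [/\ in_L1loc u, forall i, in_L1loc (fun v => g v ord0 i) &
    forall phi, smooth phi -> compactly_supported phi -> forall i,
      \int[lebesgue_rV d]_v (u v * partial i phi v) =
      - \int[lebesgue_rV d]_v (g v ord0 i * phi v)].

Definition eucl_norm_sq (w : 'rV[R]_d) : R := \sum_i w ord0 i ^+ 2.

End functions_on_rV.

(* Main.v *)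
From HB Require Import structures.
Require Import Defs.
From mathcomp Require Import all_boot all_order all_algebra.
From mathcomp Require Import all_classical all_reals all_analysis.
From mathcomp Require Import measurable_realfun.
From mathcomp Require Import ring lra.

Import Order.TTheory GRing.Theory Num.Theory.
Import numFieldNormedType.Exports.

Local Open Scope classical_set_scope.
Local Open Scope ring_scope.

Set Implicit Arguments.
Unset Strict Implicit.
Unset Printing Implicit Defensive.

(** Write [g = sqrt f_m (t, x, .)], with weak gradient [G].  Testing against
    tensor products of bump functions shows that almost everywhere
    [g (v + s e_i) - g v] is the integral of [G_i (v + sigma e_i)] over
    [0 <= sigma <= s], so that
    [int |f_m (v + w) - f_m v| dv <= |w|_1 (int |G|^2 + 2 int f_m)].
    Let [A] be a set of [(t, x)] where [a_m >= delta] for all large [m].  On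
    [A] x R^d the integral of [|G|^2] is at most [C / delta], so [f_m] is close
    in L^1 to its mollification in [v], uniformly in [m].  The mollifications
    converge strongly by (P2) and Fubini, hence so does [f_m] on bounded parts
    of [A] x R^d; the weak limit inherits the bound by weak lower
    semicontinuity of the L^1 norm.  By (P4) such sets exhaust the mass of [f],
    and (Scheffe) for nonnegative functions with converging total mass,
    [(f - f_m)^+ -> 0] in L^1 suffices.  The full sequence thus converges in
    L^1, and a subsequence almost everywhere. *)

(** * Almost everywhere equality and integrals *)

(** The square root matters because [f = g ^ 2] makes a difference of [f] the product of
    [g (v + w) - g v] and [g (v + w) + g v]: an L^2 bound on the gradient of [g], with the mass of
    [f], becomes an L^1 modulus of continuity. Regularity is available in [v] alone. Compactness in
    (t, x) comes only from (P2), and extension by zero off the domain does no harm, since nothing is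
    ever translated in (t, x).

    The obstacle is that off the sets [A] there is no estimate on [f_m] at all. Nonnegativity gives
    a one-sided substitute: there [(f - f_m)^+] is at most [f], whose mass off [A] is small. The
    total masses converge because weak L^1 convergence may be tested with the constant 1, and this
    recovers the negative part.

    Tensor products are convenient test functions: averaging one factor over a window of length [s]
    yields a tensor product again, whose partial derivative is a finite difference. This converts
    the weak gradient into increments.

    The data are measurable only up to null sets, so they are replaced by measurable representatives
    that vanish off the domain. *)

Section ae_integral.
Local Open Scope ereal_scope.
Context d (T : measurableType d) (R : realType).
Variable mu : {measure set T -> \bar R}.
Import HBNNSimple.

(** A simple function below [f], multiplied by the indicator of the complement of the null set, lies
    below [g] and has the same integral. Functions known only up to null sets are compared in this
    way throughout. *)
Lemma ae_ge0_le_integral_any (D : set T) (f g : T -> \bar R) :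
  (forall x, D x -> 0 <= f x) -> (forall x, D x -> 0 <= g x) ->
  {ae mu, forall x, D x -> f x <= g x} ->
  \int[mu]_(x in D) f x <= \int[mu]_(x in D) g x.
Proof.
move=> f0 g0 [N [mN N0 subN]].
rewrite integral_mkcond [leRHS]integral_mkcond.
have fD0 x : 0 <= (f \_ D) x by apply: erestrict_ge0.
have gD0 x : 0 <= (g \_ D) x by apply: erestrict_ge0.
rewrite ge0_integralTE// [leRHS]ge0_integralTE//.
apply: ge_ereal_sup => _ [h /= hf <-].
have mCN : measurable (~` N) by exact: measurableC.
suff -> : sintegral mu h = sintegral mu (proj_nnsfun h mCN).
  apply: ereal_sup_ubound; exists (proj_nnsfun h mCN) => // x /=.
  rewrite /mindic/= indicE; case: (boolP (x \in ~` N)) => /= xN; last first.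
    by rewrite mulr0 gD0.
  rewrite mulr1; apply: (le_trans (hf x)); rewrite !patchE.
  case: ifPn => // xD; move: xN; rewrite inE => xN.
  apply: contrapT => fg; apply: xN; apply: subN => /= H; apply: fg; apply: H.
  by rewrite inE in xD.
rewrite -!integralT_nnsfun; apply: ge0_ae_eq_integral => //.
- exact/measurable_EFinP.
- exact/measurable_EFinP.
- by move=> x _; rewrite lee_fin.
- by move=> x _; rewrite lee_fin.
exists N; split => // x /= hx; apply: contrapT => xN; apply: hx => _.
by rewrite /mindic/= indicE mem_set ?mulr1.
Qed.

(** The library integral is a supremum over measurable simple functions, so
    it ignores null sets even when the integrands are not measurable. *)
Lemma ae_eq_integral_any (D : set T) (f g : T -> \bar R) :
  {ae mu, forall x, D x -> f x = g x} ->
  \int[mu]_(x in D) f x = \int[mu]_(x in D) g x.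
Proof.
move=> fg.
have ge0 (u v : T -> \bar R) : (forall x, 0 <= u x) -> (forall x, 0 <= v x) ->
    {ae mu, forall x, D x -> u x = v x} ->
    \int[mu]_(x in D) u x = \int[mu]_(x in D) v x.
  move=> u0 v0 uv; apply/eqP; rewrite eq_le !ae_ge0_le_integral_any//.
    by apply: filterS uv => x uv Dx; rewrite uv.
  by apply: filterS uv => x uv Dx; rewrite uv.
rewrite integralE [RHS]integralE; congr (_ - _); apply: ge0 => //.
- by apply: filterS fg => x fg Dx; rewrite !funeposE fg.
- by apply: filterS fg => x fg Dx; rewrite !funenegE fg.
Qed.

Lemma ae_eq_Rintegral_any (D : set T) (f g : T -> R) :
  {ae mu, forall x, D x -> f x = g x} ->
  (\int[mu]_(x in D) f x = \int[mu]_(x in D) g x)%R.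
Proof.
move=> fg; rewrite /Rintegral; congr fine; apply: ae_eq_integral_any.
by apply: filterS fg => x fg Dx; rewrite fg.
Qed.

End ae_integral.

Section ae_product.
Local Open Scope ereal_scope.
Context d1 d2 (T1 : measurableType d1) (T2 : measurableType d2) (R : realType).
Variable m1 : {measure set T1 -> \bar R}.
Variable m2 : {sigma_finite_measure set T2 -> \bar R}.

(** The measures of the sections of a null set have integral 0, so almost every section is null. *)
Lemma ae_prod_slice (P : T1 * T2 -> Prop) :
  {ae m1 \x m2, forall z, P z} ->
  {ae m1, forall x, {ae m2, forall y, P (x, y)}}.
Proof.
move=> [N [mN N0 subN]].
have mx : measurable_fun setT (m2 \o xsection N).
  exact: measurable_fun_xsection.
have /(ae_eq_integral_abs m1 measurableT mx) : \int[m1]_x `|(m2 \o xsection N) x| = 0.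
  by rewrite -[RHS]N0; apply: eq_integral => x _; rewrite gee0_abs.
apply: filterS => x /= /(_ Logic.I) xN0; exists (xsection N x); split => //.
  exact: measurable_xsection.
by move=> y /= Pxy; rewrite /xsection/= inE; apply: subN.
Qed.

Lemma ae_prod_fst (P : T1 -> Prop) :
  {ae m1, forall x, P x} -> {ae m1 \x m2, forall z, P z.1}.
Proof.
move=> [N [mN N0 subN]]; exists (N `*` setT); split.
- exact: measurableX.
- by rewrite -[LHS]/((m1 \x m2) _) product_measure1E// N0 mul0e.
- by move=> z /= Pz; split => //; apply: subN.
Qed.

End ae_product.

Section L1_subsequence.
Local Open Scope ereal_scope.
Context d (T : measurableType d) (R : realType).
Variable mu : {measure set T -> \bar R}.

(** The sum of the series has integral at most 1, so it is finite almost everywhere; there the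
    terms, bounded by the tails, tend to 0. *)
Lemma ae_cvg_summable_integral (u : nat -> T -> \bar R) :
  (forall n, measurable_fun setT (u n)) -> (forall n x, 0 <= u n x) ->
  (forall n, \int[mu]_x u n x <= (1 / (2 ^ n.+1)%:R)%:E) ->
  {ae mu, forall x, u ^~ x @ \oo --> 0}.
Proof.
move=> mu_ u0 ule.
have mS : measurable_fun setT (fun x => \sum_(0 <= n <oo) u n x).
  by apply: ge0_emeasurable_sum => // n x _ _; exact: u0.
have S0 x : 0 <= \sum_(0 <= n <oo) u n x by apply: nneseries_ge0.
have iS : mu.-integrable setT (fun x => \sum_(0 <= n <oo) u n x).
  apply/integrableP; split => //.
  under eq_integral do rewrite gee0_abs//.
  rewrite integral_nneseries//.
  apply: (@le_lt_trans _ _ 1%:E); last exact: ltry.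
  apply: (le_trans _ (epsilon_trick0 xpredT ler01)).
  by apply: lee_nneseries => [n _ _|n _]; [exact: integral_ge0|exact: ule].
apply: filterS (integrable_ae measurableT iS) => x /(_ Logic.I) xfin.
have xoo : \sum_(0 <= n <oo) u n x < +oo by rewrite ltey_eq xfin.
have tl := nneseries_tail_cvg xoo (fun n _ => u0 n x).
apply: (squeeze_cvge _ (cvg_cst 0) tl); apply: nearW => n /=; rewrite u0/=.
by rewrite (@nneseries_split _ (fun n => u n x) n 1)// addn1 big_nat1 leeDl// nneseries_ge0.
Qed.

End L1_subsequence.

(** * Lebesgue measure on R^d *)

Section open_measurable.
Context {R : realType} (d : nat).

Lemma measurable_rV_box (P : 'I_d -> set R) : (forall i, measurable (P i)) ->
  measurable [set v : 'rV[R]_d | forall i, P i (v ord0 i)].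
Proof.
move=> mP.
rewrite (_ : mkset _ = \big[setI/setT]_(i < d)
    ((fun v : 'rV[R]_d => v ord0 i) @^-1` P i)).
  apply: bigsetI_measurable => i _; rewrite -[X in measurable X]setTI.
  exact: measurable_coord_rV.
rewrite -bigcap_seq; apply/seteqP; split => v /= Pv.
  by move=> i _; exact: Pv.
by move=> i; apply: Pv; rewrite /= mem_index_enum.
Qed.

(** The sigma-algebra is generated by the coordinates, so [U] is exhibited as the countable union of
    the boxes with rational centre and radius [1 / (n + 1)] that it contains. *)
Lemma open_measurable_rV (U : set 'rV[R]_d) : open U -> measurable U.
Proof.
move=> oU.
pose B (p : 'rV[rat]_d * nat) : set 'rV[R]_d :=
  [set v | forall i, ball (ratr (p.1 ord0 i) : R) p.2.+1%:R^-1 (v ord0 i)].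
pose J := [set p | B p `<=` U].
have -> : U = \bigcup_(p in J) B p.
  apply/seteqP; split => [v Uv|v [p Jp]]; last exact: Jp.
  have /nbhs_ballP[e /= e0 eU] : nbhs v U by exact: open_nbhs_nbhs.
  (* This makes [1 / (n + 1)] less than [e / 2], so a box of that radius containing [v] stays within
     distance [e] of [v]. *)
  pose n := Num.truncn (2 / e).
  have ne : n.+1%:R^-1 < e / 2.
    rewrite -[X in _ < X]invrK ltf_pV2 ?posrE ?invr_gt0 ?divr_gt0// invf_div.
    by rewrite truncnS_gt// divr_ge0// ltW.
  have q i : exists q : rat, ball (ratr q : R) n.+1%:R^-1 (v ord0 i).
    have [q] := @rat_in_itvoo R (v ord0 i - n.+1%:R^-1) (v ord0 i + n.+1%:R^-1)
      ltac:(by rewrite ltrBlDr -addrA ltrDl addr_gt0).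
    rewrite in_itv/= => qv; exists q; rewrite /ball/= ltr_norml; move: qv.
    by move: n.+1%:R^-1 => n1; lra.
  have {q}[q Hq] := choice q.
  exists (\row_i q i, n); last by move=> i /=; rewrite mxE.
  move=> w /= Bw; apply: eU; split => // i j; rewrite (ord1 i).
  have := Bw j; rewrite /= mxE => wq; have := Hq j; move: wq.
  rewrite /ball/= !ltr_norml; move: n.+1%:R^-1 ne => n1; lra.
rewrite bigcup_mkcond.
apply: (@countable_bigcupT_measurable _ 'rV[R]_d _
  (fun p => if p \in J then B p else set0)).
  exact: countableP.
move=> p; case: ifP => // _; 
apply: (measurable_rV_box (P := fun i =>
  ball (ratr (p.1 ord0 i) : R) p.2.+1%:R^-1)) => i; exact: measurable_ball.
Qed.

Lemma continuous_measurable_rV (f : 'rV[R]_d -> R) :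
  continuous f -> measurable_fun setT f.
Proof.
move=> /continuousP cf; apply: (measurability _ (RGenOpens.measurableE R)).
move=> _ [_ [a [b ->] <-]]; rewrite setTI; apply: open_measurable_rV.
exact/cf/interval_open.
Qed.

End open_measurable.

Section lebesgue_translation.
Local Open Scope ereal_scope.
Context {R : realType}.
Local Notation mu := (@lebesgue_measure R).

Lemma lebesgue_measure_shift (a : R) (A : set (measurableTypeR R)) :
  measurable A ->
  pushforward mu (fun x : measurableTypeR R => (x + a)%R : measurableTypeR R) A
    = mu A.
Proof.
move=> mA; apply/esym.
have ms : measurable_fun [set: measurableTypeR R]
  (fun x : measurableTypeR R => (x + a)%R : measurableTypeR R).
  exact: measurable_funD.
pose ms_mixin := isMeasurableFun.Build _ _ _ _ _ ms.
pose phi : {mfun measurableTypeR R >-> measurableTypeR R} :=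
  HB.pack (fun x : measurableTypeR R => (x + a)%R : measurableTypeR R) ms_mixin.
apply: (@lebesgue_measure_unique R (pushforward mu phi)) => // _ [[b c]] _ <-.
rewrite [RHS](_ : _ = mu `](b - a)%R, (c - a)%R]%classic); last first.
  rewrite /= /pushforward; congr (mu _).
  by apply/seteqP; split => x /=; rewrite !in_itv/= ltrBlDr lerBrDr.
by rewrite !lebesgue_measure_itv/= !lte_fin ltrD2r -EFinB; case: ifP => // _;
  congr EFin; lra.
Qed.

Lemma ge0_integral_shift (a : R) (f : measurableTypeR R -> \bar R) :
  measurable_fun setT f -> (forall x, 0 <= f x) ->
  \int[mu]_x f (x + a)%R = \int[mu]_x f x.
Proof.
move=> mf f0.
have ms : measurable_fun [set: measurableTypeR R]
  (fun x : measurableTypeR R => (x + a)%R : measurableTypeR R).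
  exact: measurable_funD.
have := @ge0_integral_pushforward _ _ _ _ R _ ms mu setT f measurableT mf.
rewrite preimage_setT => <-; last by move=> x _.
apply: eq_measure_integral => //= A mA _; exact: lebesgue_measure_shift.
Qed.

Lemma ge0_integral_lebesgue_cons d (f : 'rV[R]_d.+1 -> \bar R) :
  measurable_fun setT f -> (forall x, 0 <= f x) ->
  \int[lebesgue_rV d.+1]_v f v =
  \int[mu]_x \int[lebesgue_rV d]_v f (rV_cons (x, v)).
Proof.
move=> mf f0.
have mc := @measurable_rV_cons R d.
have := @ge0_integral_pushforward _ _ _ _ R _ mc (mu \x lebesgue_rV d) setT f
  measurableT mf.
rewrite preimage_setT => H.
rewrite -[LHS]/(\int[pushforward (mu \x lebesgue_rV d) (@rV_cons R d)]_v f v).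
rewrite {}H; last by move=> x _.
rewrite fubini_tonelli1//; first exact: (measurableT_comp mf mc).
by move=> x; exact: f0.
Qed.

Lemma measurable_rV_shift d (w : 'rV[R]_d) :
  measurable_fun [set: 'rV[R]_d] (fun v : 'rV[R]_d => (v + w)%R).
Proof.
apply: measurable_fun_rV => i; under eq_fun do rewrite mxE.
by apply: measurable_funD => //; exact: measurable_coord_rV.
Qed.

(** Induction on the dimension: the induction hypothesis shifts the tail coordinates in the inner
    integral, and invariance on the line shifts the first one. *)
Lemma ge0_integral_rV_shift d (w : 'rV[R]_d) (f : 'rV[R]_d -> \bar R) :
  measurable_fun setT f -> (forall x, 0 <= f x) ->
  \int[lebesgue_rV d]_v f (v + w)%R = \int[lebesgue_rV d]_v f v.
Proof.
elim: d w f => [w f mf f0|d IH w f mf f0].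
  by apply: eq_integral => v _; rewrite [w]thinmx0 addr0.
rewrite [RHS](ge0_integral_lebesgue_cons mf f0).
rewrite (@ge0_integral_lebesgue_cons d (fun v => f (v + w)%R)); last 2 first.
  exact: (measurableT_comp mf (measurable_rV_shift w)).
  by move=> v; exact: f0.
set w' := (\row_j w ord0 (lift ord0 j))%R.
have consD x v : (rV_cons (x, v) + w = rV_cons ((x + w ord0 ord0)%R, (v + w')%R))%R.
  apply/rowP => i; rewrite !mxE; case: unliftP => [j ->|->] //=.
  by rewrite !mxE.
transitivity (\int[mu]_x \int[lebesgue_rV d]_v
    f (rV_cons ((x + w ord0 ord0)%R, v))).
  apply: eq_integral => x _; rewrite -[RHS](IH w').
  - by apply: eq_integral => v _; rewrite consD.
  - apply: measurableT_comp => //; apply: measurableT_comp.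
      exact: measurable_rV_cons.
    exact: measurable_pair1.
  - by move=> v; exact: f0.
apply: (ge0_integral_shift (w ord0 ord0)
  (f := fun x => \int[lebesgue_rV d]_v f (rV_cons (x, v)))).
- apply: (measurable_fun_fubini_tonelli_F (fun z => f (rV_cons z))) => //.
  by apply: measurableT_comp => //; exact: measurable_rV_cons.
- by move=> x; apply: integral_ge0.
Qed.

Lemma integral_rV_shift d (w : 'rV[R]_d) (f : 'rV[R]_d -> \bar R) :
  measurable_fun setT f ->
  \int[lebesgue_rV d]_v f (v + w)%R = \int[lebesgue_rV d]_v f v.
Proof.
move=> mf; rewrite integralE [RHS]integralE; congr (_ - _).
- rewrite -[RHS](ge0_integral_rV_shift w)//.
    by apply: eq_integral => v _; rewrite !funeposE.
  exact: measurable_funepos.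
- rewrite -[RHS](ge0_integral_rV_shift w)//.
    by apply: eq_integral => v _; rewrite !funenegE.
  exact: measurable_funeneg.
Qed.

Lemma lebesgue_rV_cube d (B : set R) : measurable B ->
  lebesgue_rV d [set v | forall i, B (v ord0 i)] =
  mu B ^+ d.
Proof.
move=> mB; elim: d => [|d IH].
  by rewrite expe0 /= diracE mem_set//= => -[].
rewrite expeS -IH -product_measure1E//; last exact: (measurable_rV_box (P := fun=> B)).
rewrite -[LHS]/((mu \x lebesgue_rV d) _); congr (_ _).
apply/seteqP; split => -[x v] /= H.
  split => [|i].
    by have := H ord0; rewrite mxE unlift_none.
  by have := H (lift ord0 i); rewrite mxE liftK.
move=> i; rewrite mxE; case: unliftP => [j _|_] /=; last by case: H.
by case: H => _; apply.
Qed.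

End lebesgue_translation.

(** * Smooth test functions *)

Section smooth1.
Context {R : realType}.
Implicit Types p q : R -> R.

Fixpoint Cn n p : Prop :=
  if n is n'.+1 then (forall x, derivable p x 1) /\ Cn n' (derive1 p)
  else continuous p.

Definition smooth1 p := forall n, Cn n p.

Lemma CnS n p : Cn n.+1 p -> Cn n p.
Proof.
elim: n p => [p [dp _]|n IH p [dp Hp]].
  by move=> x; apply: differentiable_continuous; exact/derivable1_diffP.
by split => //; exact: IH.
Qed.

Lemma CnD n p q : Cn n p -> Cn n q -> Cn n (p \+ q).
Proof.
elim: n p q => [p q cp cq x|n IH p q [dp Hp] [dq Hq]].
  by apply: continuousD; [exact: cp|exact: cq].
split => [x|]; first exact: derivableD.
rewrite (_ : derive1 (p \+ q) = (derive1 p) \+ (derive1 q)); first exact: IH.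
by apply/funext => x; rewrite /= !derive1E deriveD.
Qed.

Lemma CnM n p q : Cn n p -> Cn n q -> Cn n (p \* q).
Proof.
elim: n p q => [p q cp cq x|n IH p q Hp Hq].
  by apply: continuousM; [exact: cp|exact: cq].
have [[dp Hp'] [dq Hq']] := (Hp, Hq).
split => [x|]; first exact: derivableM.
rewrite (_ : derive1 (p \* q) = (p \* (derive1 q)) \+ ((derive1 p) \* q)).
  by apply: CnD; apply: IH => //; exact: CnS.
apply/funext => x; rewrite /= !derive1E deriveM//= /GRing.scale/=.
by rewrite [q x * _]mulrC.
Qed.

Lemma Cn_cst n (k : R) : Cn n (fun=> k).
Proof.
elim: n k => [k x|m IH k]; first exact: cvg_cst.
split => [x|]; first exact: derivable_cst.
rewrite (_ : derive1 _ = cst 0); first exact: IH.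
by apply/funext => x; rewrite derive1_cst.
Qed.

Lemma Cn_affine n p (c b : R) : Cn n p -> Cn n (fun x => p (c * x + b)).
Proof.
elim: n p => [p cp x|n IH p [dp Hp]].
  apply: (@continuous_comp _ _ _ (fun x : R => c * x + b) p); last exact: cp.
  by apply: continuousD; [apply: continuousM|]; try exact: cvg_cst.
have D (x : R) : is_derive x 1 (fun x => p (c * x + b)) (c * (derive1 p) (c * x + b)).
  have Da : is_derive x 1 (fun x : R => c * x + b) c.
    by apply: is_derive_eq; rewrite addr0 /GRing.scale/= mulr1.
  have Dp : is_derive (c * x + b) 1 p ((derive1 p) (c * x + b)).
    by rewrite derive1E; exact: derivableP.
  have := @is_derive1_comp _ p (fun x => c * x + b) x _ _ Dp Da.
  by rewrite mulrC.
split => [x|]; first by have [] := D x.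
rewrite (_ : derive1 _ = cst c \* (fun x => (derive1 p) (c * x + b))).
  by apply: CnM; [exact: Cn_cst|exact: IH].
by apply/funext => x; rewrite derive1E; have [_ ->] := D x.
Qed.

Lemma smooth1_derivable p (x : R) : smooth1 p -> derivable p x 1.
Proof. by move=> /(_ 1%N)[]. Qed.

Lemma smooth1_derive p : smooth1 p -> smooth1 (derive1 p).
Proof. by move=> sp n; have [] := sp n.+1. Qed.

Lemma smooth1_continuous p : smooth1 p -> continuous p.
Proof. by move=> /(_ 0%N). Qed.

(** The functions [P (1/x) exp (-1/x)], extended by [0] to [x <= 0], are closed
    under derivation. *)
Definition flat (P : {poly R}) (x : R) : R :=
  if 0 < x then P.[x^-1] * expR (- x^-1) else 0.

Lemma poly_expRN_bounded (P : {poly R}) :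
  exists K, forall y, 0 < y -> `|P.[y] * expR (- y)| <= K.
Proof.
exists (\sum_(i < size P) `|P`_i| * i.+1`!%:R) => y y0.
rewrite horner_coef mulr_suml; apply: (le_trans (ler_norm_sum _ _ _)).
apply: ler_sum => i _; rewrite -mulrA normrM ler_wpM2l//.
rewrite ger0_norm; last by rewrite mulr_ge0 ?expR_ge0// exprn_ge0// ltW.
rewrite expRN ler_pdivrMr ?expR_gt0//.
have [y1|y1] := leP y 1.
  apply: (@le_trans _ _ 1); first by rewrite exprn_ile1// ltW.
  rewrite -[leLHS]mulr1 ler_pM//.
    by rewrite ler1n fact_gt0.
  by rewrite -expR0 ler_expR ltW.
apply: (@le_trans _ _ (y ^+ i.+1)).
  by rewrite exprS ler_peMl// ?exprn_ge0// ltW.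
rewrite mulrC -ler_pdivrMr ?ltr0n ?fact_gt0//.
by apply: le_trans (expR_ge1Dxn i (ltW y0)); rewrite lerDr.
Qed.

Lemma is_derive_of_cvg (V : normedModType R) (f : V -> R) (a v : V) (l : R) :
  (fun h : R => h^-1 *: (f (h *: v + a) - f a)) @ 0^' --> l ->
  is_derive a v f l.
Proof.
move=> fl; apply: DeriveDef; first by apply/cvg_ex; exists l.
by apply: cvg_lim fl; exact: Rhausdorff.
Qed.

Lemma is_derive_flat (P : {poly R}) (x : R) :
  is_derive x 1 (flat P) (flat ('X^2 * (P - P^`())) x).
Proof.
have [x0|x0|->] := ltgtP x 0.
- apply: (@near_eq_is_derive _ _ _ (cst 0)); last first.
    rewrite /flat ltNge (ltW x0)/=; exact: is_derive_cst.
  near=> y; rewrite /flat ltNge (_ : y <= 0)//.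
  by rewrite ltW//; near: y; exact: lt_nbhsl.
- apply: (@near_eq_is_derive _ _ _
    ((fun y : R => P.[y^-1]) \* (fun y => expR (- y^-1)))); last first.
    have dV : is_derive x 1 (fun y : R => y^-1) (- x ^- 2).
      have := @is_deriveV _ id x 1 1 (lt0r_neq0 x0) _.
      by rewrite /GRing.scale/= mulr1; apply; exact: is_derive_id.
    have dP := @is_derive1_comp _ (horner P) (fun y : R => y^-1) x _ _
      (is_derive_poly P x^-1) dV.
    have dE := @is_derive1_comp _ expR (fun y : R => - y^-1) x _ _
      (is_derive_expR (- x^-1)) (is_deriveN dV).
    have := is_deriveM dP dE.
    rewrite /flat x0 !hornerE/= /GRing.scale/= => H.
    apply: is_derive_eq H _; rewrite exprVn; ring.
  near=> y; rewrite /flat/= (_ : 0 < y)//.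
  by near: y; exact: lt_nbhsr.
- have flat0 Q : flat Q 0 = 0 by rewrite /flat ltxx.
  rewrite flat0.
  apply: is_derive_of_cvg.
  (* At 0 the difference quotient has one factor [h^-1]; bounding the polynomial with two such
     factors leaves a factor [h], so the quotient is at most [K * |h|]. *)
  have [K HK] := poly_expRN_bounded ('X^2 * P).
  have K0 : 0 <= K by apply: le_trans (HK 1 ltr01).
  apply: (@cvg_trans _ ((fun h : R => h^-1 * flat P h) @ 0^')).
    apply: near_eq_cvg; apply: nearW => h.
    by rewrite /= addr0 flat0 subr0 [h%:A]mulr1.
  apply/norm_cvg0P.
  apply: (@squeeze_cvgr _ _ _ _ (fun=> 0) (fun h : R => K * `|h|)).
  + apply: nearW => h; rewrite normr_ge0/= /flat.
    case: ifPn => [h0|_]; last by rewrite mulr0 normr0 mulr_ge0.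
    rewrite (_ : h^-1 * _ = ('X^2 * P).[h^-1] * expR (- h^-1) * h).
      by rewrite normrM ler_wpM2r// HK// invr_gt0.
    rewrite hornerM hornerXn; move: (P.[h^-1]) (expR (- h^-1)) => p e.
    by field; rewrite gt_eqF.
  + exact: cvg_cst.
  + rewrite -[X in _ --> X](mulr0 K); apply: cvgM; first exact: cvg_cst.
    rewrite -[X in _ --> X](@normr0 _ R).
    by apply: cvg_norm; apply: cvg_within.
Unshelve. all: by end_near. Qed.

Lemma smooth1_flat P : smooth1 (flat P).
Proof.
move=> n; elim: n P => [P x|n IH P].
  apply: differentiable_continuous; apply/derivable1_diffP.
  by have [] := is_derive_flat P x.
split => [x|]; first by have [] := is_derive_flat P x.
rewrite (_ : derive1 (flat P) = flat ('X^2 * (P - P^`()))); first exact: IH.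
by apply/funext => x; rewrite derive1E; have [_ ->] := is_derive_flat P x.
Qed.

Lemma flat1_itv x : 0 <= flat 1 x <= 1.
Proof.
rewrite /flat; case: ifPn => [x0|_]; last by rewrite lexx ler01.
by rewrite hornerE mul1r expR_ge0/= -expR0 ler_expR oppr_le0 invr_ge0 ltW.
Qed.

Lemma flat1_gt0 x : 0 < x -> 0 < flat 1 x.
Proof. by move=> x0; rewrite /flat x0 hornerE mul1r expR_gt0. Qed.

Lemma flat1_cvg x : (fun n => flat 1 (n.+1%:R * x)) @ \oo -->
  (if 0 < x then 1 else 0 : R).
Proof.
case: ifPn => [x0|x0]; last first.
  rewrite (_ : (fun _ => _) = fun=> 0); first exact: cvg_cst.
  by apply/funext => n; rewrite /flat pmulr_rgt0// (negbTE x0).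
rewrite (_ : (fun _ => _) = fun n => expR (- (x^-1 * n.+1%:R^-1))); last first.
  apply/funext => n; rewrite /flat pmulr_rgt0// x0 hornerE mul1r.
  by rewrite invfM mulrC.
rewrite -[X in _ --> X]expR0; apply: continuous_cvg; first exact: continuous_expR.
rewrite -[X in _ --> X]oppr0; apply: cvgN; rewrite -[X in _ --> X](mulr0 x^-1).
by apply: cvgM; [exact: cvg_cst|exact: cvg_harmonic].
Qed.

(** Rescaling the argument of [flat 1] makes it converge to the indicator of the positive half-line,
    so these bumps converge pointwise to the indicator of the open interval while staying in
    [[0, 1]] and vanishing outside it. *)
Definition smooth_bump (a b : R) (n : nat) (x : R) : R :=
  flat 1 (n.+1%:R * (x - a)) * flat 1 (n.+1%:R * (b - x)).

Lemma smooth1_smooth_bump a b n : smooth1 (smooth_bump a b n).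
Proof.
move=> k; rewrite (_ : smooth_bump a b n =
    (fun x => flat 1 (n.+1%:R * x + - (n.+1%:R * a))) \*
    (fun x => flat 1 (- n.+1%:R * x + n.+1%:R * b))); last first.
  by apply/funext => x; rewrite /smooth_bump/= !mulrBr mulNr [X in _ * flat 1 X]addrC.
by apply: CnM; apply: Cn_affine; exact: smooth1_flat.
Qed.

Lemma smooth_bump_itv a b n x : 0 <= smooth_bump a b n x <= 1.
Proof.
have /andP[? ?] := flat1_itv (n.+1%:R * (x - a)).
have /andP[? ?] := flat1_itv (n.+1%:R * (b - x)).
by rewrite /smooth_bump mulr_ge0//= mulr_ile1.
Qed.

Lemma smooth_bump_out a b n x : ~~ (a < x < b) -> smooth_bump a b n x = 0.
Proof.
rewrite negb_and /smooth_bump /flat !pmulr_rgt0// !subr_gt0.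
by case/orP => /negbTE ->; rewrite ?mul0r ?mulr0.
Qed.

Lemma smooth_bump_cvg a b x : (fun n => smooth_bump a b n x) @ \oo -->
  (if a < x < b then 1 else 0 : R).
Proof.
have := cvgM (@flat1_cvg (x - a)) (@flat1_cvg (b - x)).
rewrite !subr_gt0; case: (a < x); case: (x < b) => /=;
  by rewrite ?mulr1 ?mul0r ?mulr0 => H; exact: H.
Qed.

End smooth1.

Section tensor.
Context {R : realType} (d : nat).
Implicit Type p : 'I_d -> R -> R.

Definition tensor p (v : 'rV[R]_d) : R := \prod_i p i (v ord0 i).

Definition tensor_derive (i : 'I_d) p : 'I_d -> R -> R :=
  fun j => if j == i then derive1 (p j) else p j.

Lemma is_derive_tensor p (i : 'I_d) (v : 'rV[R]_d) :
  derivable (p i) (v ord0 i) 1 ->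
  is_derive v (delta_mx ord0 i) (tensor p) (tensor (tensor_derive i p) v).
Proof.
move=> dp; apply: is_derive_of_cvg.
pose c := \prod_(j | j != i) p j (v ord0 j).
have -> : tensor (tensor_derive i p) v = derive1 (p i) (v ord0 i) * c.
  rewrite /tensor (bigD1 i)//= /tensor_derive eqxx; congr (_ * _).
  by apply: eq_bigr => j /negbTE ->.
rewrite (_ : (fun _ => _) = (fun h : R =>
    (h^-1 *: (p i (h *: (1 : R) + v ord0 i) - p i (v ord0 i))) * c)); last first.
  apply/funext => h; rewrite /tensor (bigD1 i)//= [X in _ - X](bigD1 i)//= -/c.
  rewrite (_ : \prod_(j < d | j != i) _ = c); last first.
    apply: eq_bigr => j ji; rewrite !mxE eqxx (negbTE ji)/= mulr0 add0r//.
  by rewrite !mxE !eqxx/= -mulrBl scalerAl.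
apply: cvgM; last exact: cvg_cst.
by rewrite derive1E; exact: dp.
Qed.

Lemma partial_tensor p (i : 'I_d) : (forall x, derivable (p i) x 1) ->
  partial i (tensor p) = tensor (tensor_derive i p).
Proof.
by move=> dp; apply/funext => v; have [_ H] := is_derive_tensor (dp (v ord0 i)).
Qed.

Lemma continuous_tensor p : (forall i, continuous (p i)) ->
  continuous (tensor p).
Proof.
move=> cp; apply: continuous_big => [|i _]; first exact: mul_continuous.
by move=> v; apply: continuous_comp; [exact: coord_continuous|exact: cp].
Qed.

(** A partial derivative only differentiates one factor, so every iterated partial derivative is
    again a tensor product of smooth functions of one variable. *)
Lemma smooth_tensor p : (forall i, smooth1 (p i)) -> smooth (tensor p).
Proof.
move=> sp s.
have [q sq ->] : exists2 q, forall i, smooth1 (q i) &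
    foldr (@partial R d) (tensor p) s = tensor q.
  elim: s => [|i s [q sq IH]]; first by exists p.
  exists (tensor_derive i q) => [j|].
    rewrite /tensor_derive; case: ifP => // _; exact: smooth1_derive.
  by rewrite /= IH partial_tensor// => x; exact: smooth1_derivable.
split; first by apply: continuous_tensor => i; exact: smooth1_continuous.
move=> i v; have [] := @is_derive_tensor q i v _ => //.
exact: smooth1_derivable.
Qed.

Lemma compactly_supported_box (phi : 'rV[R]_d -> R) (a b : 'I_d -> R) :
  (forall (v : 'rV[R]_d) i, ~~ (a i <= v ord0 i <= b i) -> phi v = 0) ->
  compactly_supported phi.
Proof.
move=> phi0.
have cK : compact [set v : 'rV[R]_d | forall i, `[a i, b i]%classic (v ord0 i)].
  by apply: (@rV_compact _ _ (fun i => `[a i, b i]%classic)) => i; exact: segment_compact.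
have clK := compact_closed (@norm_hausdorff _ _) cK.
apply: subclosed_compact cK _; first exact: closed_closure.
rewrite [X in _ `<=` X](closure_id _).1//; apply: closure_subset => v /= v0 i.
by rewrite in_itv/=; apply: contraT => vi; rewrite (phi0 v i vi) eqxx in v0.
Qed.

End tensor.

(** * The fundamental lemma of the calculus of variations *)

Section boxes.
Context {R : realType} (d : nat).

Definition obox (a b : 'I_d -> R) : set 'rV[R]_d :=
  [set v | forall i, a i < v ord0 i < b i].

Definition cube (r : R) : set 'rV[R]_d :=
  [set v | forall i, - r <= v ord0 i <= r].

Lemma measurable_obox a b : measurable (obox a b).
Proof.
apply: (measurable_rV_box (P := fun i => [set x | a i < x < b i])) => i.
rewrite (_ : mkset _ = `]a i, b i[%classic)//.
Qed.

Lemma measurable_cube r : measurable (cube r).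
Proof.
apply: (measurable_rV_box (P := fun i => [set x | - r <= x <= r])) => i.
rewrite (_ : mkset _ = `[- r, r]%classic)//.
Qed.

Lemma compact_cube r : compact (cube r).
Proof.
rewrite (_ : cube r = [set v | forall i, `[- r, r]%classic (v ord0 i)]).
  by apply: (@rV_compact _ _ (fun i => `[- r, r]%classic)) => i;
    exact: segment_compact.
by apply/seteqP; split => v /= Hv i; have := Hv i; rewrite in_itv.
Qed.

Lemma obox_sub_cube a b : exists2 r, 0 < r & obox a b `<=` cube r.
Proof.
exists (1 + \sum_i (`|a i| + `|b i|)) => [|v /= vab i].
  by rewrite ltr_wpDr// sumr_ge0// => i _; rewrite addr_ge0.
have /andP[ai bi] := vab i.
have : `|a i| + `|b i| <= \sum_i (`|a i| + `|b i|).
  rewrite (bigD1 i)//= lerDl sumr_ge0// => j _; rewrite addr_ge0//.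
have := ler_norm (- a i); have := ler_norm (b i); rewrite normrN.
have := normr_ge0 (a i); have := normr_ge0 (b i).
lra.
Qed.

(** Open boxes are closed under intersection, so with this they form a generating pi-system, ready
    for Dynkin's theorem. *)
Lemma measurable_rV_gen_obox :
  @measurable _ 'rV[R]_d = <<s [set B | exists a b, B = obox a b] >>.
Proof.
set G := [set B | _]; apply/seteqP; split; last first.
  apply: smallest_sub; first exact: sigma_algebra_measurable.
  by move=> _ [a [b ->]]; exact: measurable_obox.
apply: smallest_sub; first exact: smallest_sigma_algebra.
rewrite -bigcup_seq; apply: bigcup_sub => i _ A [B mB <-].
have mi : measurable_fun [set: g_sigma_algebraType G]
    (fun v : g_sigma_algebraType G => (v : 'rV[R]_d) ord0 i).
  apply: (measurability _ (RGenOpens.measurableE R)).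
  move=> _ [_ [x [y ->] <-]]; rewrite setTI.
  (* The slab [x < v_i < y] is the union over [k] of the boxes whose other sides are []-k, k[]. *)
  pose a (k : nat) j := if j == i then x else - k%:R.
  pose b (k : nat) j := if j == i then y else k%:R.
  rewrite (_ : _ @^-1` _ = \bigcup_k (obox (a k) (b k))).
    apply: bigcupT_measurable => k; apply: sub_sigma_algebra.
    by exists (a k), (b k).
  apply/seteqP; split => v /=.
    rewrite in_itv/= => xvy.
    exists (Num.truncn (\sum_j `|v ord0 j|)).+1 => //= j.
    rewrite /a /b; case: eqP => [->//|_]; rewrite -ltr_norml.
    apply: le_lt_trans (truncnS_gt _).
    by rewrite (bigD1 j)//= lerDl sumr_ge0.
  by move=> [k _ /(_ i)]; rewrite /a /b eqxx in_itv.
exact: (mi measurableT B mB).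
Qed.

Lemma obox_setI a b a' b' : obox a b `&` obox a' b' =
  obox (fun i => Num.max (a i) (a' i)) (fun i => Num.min (b i) (b' i)).
Proof.
apply/seteqP; split => v /=.
  move=> [H H'] i; have /andP[? ?] := H i; have /andP[? ?] := H' i.
  by rewrite gt_max lt_min; apply/andP; split; apply/andP.
move=> H; split => i; have := H i; rewrite gt_max lt_min;
  by move=> /andP[/andP[? ?] /andP[? ?]]; apply/andP.
Qed.

Lemma measurable_tensor (p : 'I_d -> R -> R) : (forall i, continuous (p i)) ->
  measurable_fun setT (tensor p).
Proof. by move=> cp; apply: continuous_measurable_rV; exact: continuous_tensor. Qed.

Definition bumps (a b : 'I_d -> R) (n : nat) := fun i => smooth_bump (a i) (b i) n.

Lemma tensor_bumps_itv a b n v : 0 <= tensor (bumps a b n) v <= 1.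
Proof.
rewrite /tensor prodr_ge0/=; last first.
  by move=> i _; have /andP[] := smooth_bump_itv (a i) (b i) n (v ord0 i).
by apply: prodr_ile1 => i _; exact: smooth_bump_itv.
Qed.

Lemma tensor_bumps_out a b n v : ~ obox a b v -> tensor (bumps a b n) v = 0.
Proof.
move=> /existsNP[i /negP vi]; rewrite /tensor (bigD1 i)//= /bumps smooth_bump_out//.
by rewrite mul0r.
Qed.

Lemma tensor_bumps_cvg a b v :
  (fun n => tensor (bumps a b n) v) @ \oo --> (\1_(obox a b) v : R).
Proof.
have -> : \1_(obox a b) v = \prod_i (if a i < v ord0 i < b i then 1 else 0) :> R.
  rewrite indicE; have [|] := boolP (v \in obox a b).
    by rewrite inE => vab; rewrite big1// => i _; rewrite vab.
  rewrite notin_setE => /existsNP[i /negP vi].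
  by rewrite (bigD1 i)//= (negbTE vi) mul0r.
by apply: cvg_big => [|i _]; [exact: mul_continuous|exact: smooth_bump_cvg].
Qed.

End boxes.

Section fundamental_lemma.
Local Open Scope ereal_scope.
Context {R : realType} (d : nat).
Local Notation lam := (@lebesgue_rV R d).
Variable u : 'rV[R]_d -> R.
Hypothesis mu : measurable_fun setT u.
Hypothesis iu : forall r, lam.-integrable (cube r) (EFin \o u).
Hypothesis u_bumps : forall a b n,
  (\int[lam]_v (u v * tensor (bumps a b n) v) = 0)%R.

(** Dominated convergence: the bumps tend to the indicator of the box, and all the integrands are
    bounded by [|u|] restricted to a cube containing it. *)
Let integral_obox a b : \int[lam]_(v in obox a b) (u v)%:E = 0.
Proof.
have [r _ abr] := obox_sub_cube a b.
pose f n v := (u v * tensor (bumps a b n) v)%:E.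
have mt n : measurable_fun setT (tensor (bumps a b n)).
  apply: measurable_tensor => i; apply: smooth1_continuous.
  exact: smooth1_smooth_bump.
have mf n : measurable_fun setT (f n).
  by apply/measurable_EFinP; apply: measurable_funM.
have mU : measurable_fun setT (EFin \o u) by apply/measurable_EFinP.
have ig : lam.-integrable setT ((EFin \o u) \_ (cube r)).
  exact: (integrable_mkcond _ (measurable_cube r)).1.
have fle n v : `|f n v| <= `| ((EFin \o u) \_ (cube r)) v|.
  rewrite /f patchE; case: ifPn => [_|].
    rewrite abse_EFin/= lee_fin normrM ler_piMr//.
    by have /andP[? ?] := tensor_bumps_itv a b n v; rewrite ger0_norm.
  rewrite notin_setE => /(contra_not (@abr v)) /tensor_bumps_out ->.
  by rewrite mulr0 !abse0.
have if_ n : lam.-integrable setT (f n).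
  by apply: le_integrable ig => // v _; exact: fle.
have fcvg v : f ^~ v @ \oo --> ((EFin \o u) \_ (obox a b)) v.
  rewrite (_ : _ v = (u v * \1_(obox a b) v)%:E); last first.
    by rewrite patchE indicE; case: ifP; rewrite (mulr1, mulr0).
  apply: cvg_EFin; first exact: nearW.
  by apply: cvgM; [exact: cvg_cst|exact: tensor_bumps_cvg].
have [_ _] := @dominated_convergence _ _ _ lam setT measurableT f
  ((EFin \o u) \_ (obox a b)) (abse \o ((EFin \o u) \_ (cube r))) mf
  ((measurable_restrictT _ (measurable_obox a b)).1 (measurable_funTS mU))
  (aeW _ (fun v _ => fcvg v)) (integrable_abse ig)
  (aeW _ (fun v n _ => fle n v)).
rewrite -integral_mkcond.
rewrite (_ : (fun n => _) = fun=> 0); last first.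
  apply/funext => n; have := u_bumps a b n; rewrite /Rintegral => H.
  by rewrite -[LHS]fineK ?H//; exact: integrable_fin_num.
move=> H; apply/esym; apply: cvg_unique H; first exact: ereal_hausdorff.
exact: cvg_cst.
Qed.

(** The sets [S] over which [u] has zero integral within [Q k] contain the boxes and form a Dynkin
    class, so all measurable [S] qualify and [u] vanishes almost everywhere on [Q k]. Cutting with
    the box [Q k] makes [u] integrable, as complements and countable unions require. *)
Lemma fundamental_lemma : {ae lam, forall v, u v = 0%R}.
Proof.
pose Q (k : nat) := obox (fun=> - k%:R)%R (fun=> k%:R)%R : set 'rV[R]_d.
have mQ k : measurable (Q k) by exact: measurable_obox.
have iQ k : lam.-integrable (Q k) (EFin \o u).
  apply: (integrableS (measurable_cube k%:R)) => // v Qv i.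
  by have /andP[/ltW -> /ltW ->] := Qv i.
have Q0 k (S : set 'rV[R]_d) : measurable S ->
    \int[lam]_(v in S `&` Q k) (u v)%:E = 0.
  move: S.
  suff : forall S, <<s [set B | exists a b, B = obox a b] >> S ->
      \int[lam]_(v in S `&` Q k) (u v)%:E = 0.
    by move=> H S mS; apply: H; rewrite -measurable_rV_gen_obox.
  apply: (@dynkin_induction _ 'rV[R]_d _
    [set S | \int[lam]_(v in S `&` Q k) (u v)%:E = 0]) => /=.
  - exact: measurable_rV_gen_obox.
  - by move=> _ _ [a [b ->]] [a' [b' ->]]; rewrite obox_setI; eexists; eexists.
  - by rewrite setTI integral_obox.
  - by move=> _ [a [b ->]] /=; rewrite obox_setI integral_obox.
  - move=> S mS S0.
    have := integral_obox (fun=> - k%:R)%R (fun=> k%:R)%R.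
    rewrite -/(Q k) -{1}(setTI (Q k)) -(setUv S) setIUl integral_setU//.
    + by rewrite S0 add0e.
    + exact: measurableI.
    + by apply: measurableI => //; exact: measurableC.
    + rewrite -setIUl setUv setTI; exact/measurable_funTS/measurable_EFinP.
    + by apply/disj_setPS => v [[/= Sv _] []].
  - move=> F mF tF F0; rewrite setI_bigcupl integral_bigcup.
    + by apply: eseries0 => n _ _; exact: F0.
    + exact: trivIset_setIr.
    + by move=> n; exact: measurableI.
    + rewrite -setI_bigcupl; apply: integrableS (iQ k) => //.
      by apply: measurableI => //; exact: bigcupT_measurable.
have aeQ k : {ae lam, forall v, Q k v -> (u v)%:E = 0}.
  apply: (@integral_ae_eq _ _ _ lam (Q k) (mQ k) (cst 0) _ (iQ k)).
    exact: measurable_cst.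
  move=> E EQ mE; rewrite integral0 -(Q0 k E mE); congr integral.
  by apply/esym/setIidPl.
apply: filterS (ae_foralln aeQ) => v uv.
(* A box index exceeding the sum of the absolute coordinates puts [v] into [Q k]. *)
apply/EFin_inj/(uv (Num.truncn (\sum_j `|v ord0 j|)).+1) => j.
rewrite -ltr_norml; apply: le_lt_trans (truncnS_gt _).
by rewrite (bigD1 j)//= lerDl sumr_ge0.
Qed.

End fundamental_lemma.

(** * Increments of weakly differentiable functions *)

Section smooth_window.
Context {R : realType}.
Local Notation mu := (@lebesgue_measure R).
Variables (p : R -> R) (a b : R).
Hypothesis sp : smooth1 p.
Hypothesis p_out : forall x, ~~ (a <= x <= b) -> p x = 0.

Let Pi (x : R) := \int[mu]_(t in `]-oo, x]) p t.

Let Pi_derive (x : R) : is_derive x 1 Pi (p x).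
Proof.
have cp := smooth1_continuous sp.
have mp : measurable_fun setT p by exact: continuous_measurable_fun.
have ip y : mu.-integrable `]-oo, y] (EFin \o p).
  apply: (@integrableS _ _ _ mu setT) => //.
  rewrite (_ : EFin \o p = (EFin \o p) \_ `[a, b]); last first.
    apply/funext => x0; rewrite patchE; case: ifPn => //.
    by rewrite notin_setE/= in_itv/= => /negP /p_out /= ->.
  have mab : measurable (`[a, b]%classic : set (measurableTypeR R)) by [].
  apply: (integrable_mkcond (mu := mu) (EFin \o p) mab).1.
  apply: continuous_compact_integrable; first exact: segment_compact.
  by apply: continuous_subspaceT => ?; exact: cp.
have xx1 : x < x + 1 by rewrite ltrDl.
have [dPi HPi] := @continuous_FTC1 R p -oo%O x (x + 1) xx1 (ip _) (ltNyr _) (cp x).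
by apply: (DeriveDef dPi); rewrite -derive1E; exact: HPi.
Qed.

Let smooth1_Pi : smooth1 Pi.
Proof.
case=> [x|n].
  apply: differentiable_continuous; apply/derivable1_diffP.
  by have [] := Pi_derive x.
split => [x|]; first by have [] := Pi_derive x.
rewrite (_ : derive1 Pi = p); first exact: sp.
by apply/funext => x; rewrite derive1E; have [_ ->] := Pi_derive x.
Qed.

Lemma smooth_window (s : R) : 0 < s -> exists P : R -> R,
  [/\ smooth1 P, forall x, derive1 P x = p x - p (x - s),
   forall x, \int[mu]_(t in `[0, s]) p (x - t) = P x &
   forall x, ~~ (a <= x <= b + s) -> P x = 0].
Proof.
move=> s0.
have cp := smooth1_continuous sp.
pose P x := Pi x - Pi (x - s).
have intP x : \int[mu]_(t in `[0, s]) p (x - t) = P x.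
  have dF (t : R) : is_derive t 1 (fun t : R => - Pi (x - t)) (p (x - t)).
    have dB : is_derive t 1 (fun t : R => x - t) (-1).
      have := is_deriveB (is_derive_cst x t 1) (is_derive_id t 1).
      by rewrite sub0r.
    have := is_deriveN (@is_derive1_comp _ Pi (fun t : R => x - t) t _ _
      (Pi_derive (x - t)) dB).
    by rewrite mulrN1 opprK.
  have := @continuous_FTC2 R (fun t => p (x - t)) (fun t => - Pi (x - t)) 0 s s0.
  rewrite /Rintegral => ->.
  - by rewrite /= subr0 opprK /P addrC.
  - apply: continuous_subspaceT => t.
    apply: (@continuous_comp _ _ _ (fun t : R => x - t) p); last exact: cp.
    by apply: continuousB; [exact: cvg_cst|].
  - have cF : continuous (fun t : R => - Pi (x - t)).
      move=> t; apply: differentiable_continuous; apply/derivable1_diffP.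
      by have [] := dF t.
    split => [t _| |]; first by have [] := dF t.
      exact: (cvg_at_right_filter (cF 0)).
    exact: (cvg_at_left_filter (cF s)).
  - by move=> t _; rewrite derive1E; have [_ ->] := dF t.
exists P; split => //.
- move=> n; rewrite (_ : P = Pi \+ (cst (-1) \* (fun x => Pi (1 * x + - s)))).
    apply: CnD; first exact: smooth1_Pi.
    apply: CnM; first exact: Cn_cst.
    apply: Cn_affine; exact: smooth1_Pi.
  by apply/funext => x; rewrite /P/= mul1r mulN1r.
- move=> x; rewrite derive1E.
  have dB : is_derive x 1 (fun t : R => t - s) 1.
    have := is_deriveB (is_derive_id x 1) (is_derive_cst s x 1).
    by rewrite subr0.
  have := is_deriveB (Pi_derive x) (@is_derive1_comp _ Pi (fun t : R => t - s) x _ _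
      (Pi_derive (x - s)) dB).
  by rewrite mulr1 => -[_ ->].
- move=> x xab; rewrite -intP /Rintegral integral0_eq// => t /=.
  rewrite in_itv/= => /andP[t0 ts]; rewrite p_out//.
  by apply: contra xab => /andP[? ?]; apply/andP; split; lra.
Qed.

End smooth_window.

Section weak_gradient.
Context {R : realType} (d : nat).

Lemma is_weak_gradient_tensor (u : 'rV[R]_d -> R) g p (i : 'I_d) (r : R) :
  is_weak_gradient u g -> (forall j, smooth1 (p j)) ->
  (forall j (x : R), ~~ (- r <= x <= r) -> p j x = 0) ->
  \int[lebesgue_rV d]_v (u v * tensor (tensor_derive i p) v) =
  - \int[lebesgue_rV d]_v (g v ord0 i * tensor p v).
Proof.
move=> [_ _ wug] sp p0; rewrite -wug.
- by rewrite partial_tensor// => x; exact: smooth1_derivable.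
- exact: smooth_tensor.
- apply: (@compactly_supported_box _ _ _ (fun=> - r) (fun=> r)) => v j vj.
  by rewrite /tensor (bigD1 j)//= p0// mul0r.
Qed.

End weak_gradient.

Section measurable_marginal.
Local Open Scope ereal_scope.
Context d1 d2 (T1 : measurableType d1) (T2 : measurableType d2) (R : realType).
Variable m2 : {sigma_finite_measure set T2 -> \bar R}.

Lemma measurable_fun_marginal (f : T1 * T2 -> \bar R) :
  measurable_fun setT f -> measurable_fun setT (fun x => \int[m2]_y f (x, y)).
Proof.
move=> mf.
rewrite (_ : (fun x => _) = (fun x => \int[m2]_y f^\+ (x, y)) \-
    (fun x => \int[m2]_y f^\- (x, y))).
  apply: emeasurable_funB.
  - by apply: (measurable_fun_fubini_tonelli_F f^\+) => //;
      exact: measurable_funepos.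
  - by apply: (measurable_fun_fubini_tonelli_F f^\-) => //;
      exact: measurable_funeneg.
apply/funext => x /=; rewrite integralE; congr (_ - _); apply: eq_integral => y _.
  by rewrite !funeposE.
by rewrite !funenegE.
Qed.

End measurable_marginal.

Lemma emeasurable_patch d (T : measurableType d) (R : realType) (D : set T)
    (F : T -> \bar R) : measurable D -> measurable_fun setT F ->
  measurable_fun setT (F \_ D).
Proof. by move=> mD mF; exact: ((measurable_restrictT _ mD).1 (measurable_funTS mF)). Qed.

Section local_integrability.
Local Open Scope ereal_scope.
Context {R : realType} (d : nat).
Local Notation lam := (@lebesgue_rV R d).
Implicit Types (u phi : 'rV[R]_d -> R) (w : 'rV[R]_d).

Definition locint u := forall r, lam.-integrable (cube r) (EFin \o u).

Lemma cube_shift r c w (v : 'rV[R]_d) : (forall j, `|w ord0 j| <= c)%R ->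
  cube r v -> cube (r + c)%R (v + w)%R.
Proof.
move=> wc vr j; rewrite mxE; have := vr j; have := wc j.
rewrite ler_norml => /andP[? ?] /andP[? ?]; apply/andP; split; lra.
Qed.

Lemma ge0_integral_cube_shift r c w (F : 'rV[R]_d -> \bar R) :
  measurable_fun setT F -> (forall v, 0 <= F v) ->
  (forall j, `|w ord0 j| <= c)%R ->
  \int[lam]_(v in cube r) F (v + w)%R <= \int[lam]_(v in cube (r + c)) F v.
Proof.
move=> mF F0 wc; rewrite [leLHS]integral_mkcond [leRHS]integral_mkcond.
have mFr : measurable_fun setT (F \_ (cube (r + c))).
  by apply: emeasurable_patch => //; exact: measurable_cube.
have Fr0 v : 0 <= (F \_ (cube (r + c))) v by apply: erestrict_ge0.
rewrite -[leRHS](ge0_integral_rV_shift w)//.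
apply: ge0_le_integral => //.
- by move=> v _; apply: erestrict_ge0.
- apply: emeasurable_patch; first exact: measurable_cube.
  by apply: measurableT_comp => //; exact: measurable_rV_shift.
- apply: measurableT_comp => //; exact: measurable_rV_shift.
- move=> v _; rewrite {1}patchE; case: ifPn => [vr|_]; last exact: Fr0.
  by rewrite patchE mem_set//; apply: cube_shift => //; rewrite inE in vr.
Qed.

Lemma locint_shift u w : measurable_fun setT u -> locint u ->
  locint (fun v => u (v + w)%R).
Proof.
move=> mu lu r; apply/integrableP; split.
  apply/measurable_EFinP/measurable_funTS.
  by apply: measurableT_comp => //; exact: measurable_rV_shift.
pose c := (\sum_j `|w ord0 j|)%R.
have wc j : (`|w ord0 j| <= c)%R by rewrite /c (bigD1 j)//= lerDl sumr_ge0.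
have /integrableP[_] := lu (r + c)%R; apply: le_lt_trans.
apply: (@ge0_integral_cube_shift r c w (fun v => `|(u v)%:E|)) => //.
by apply: measurableT_comp => //; exact/measurable_EFinP.
Qed.

Lemma locintB u u' : locint u -> locint u' -> locint (fun v => u v - u' v)%R.
Proof.
move=> lu lu' r.
exact: (integrableB (measurable_cube r) (lu r) (lu' r)).
Qed.

Lemma locint_mul_integrable u phi r : measurable_fun setT u -> locint u ->
  measurable_fun setT phi -> (forall v, `|phi v| <= 1)%R ->
  (forall v, ~ cube r v -> phi v = 0%R) ->
  lam.-integrable setT (fun v => (u v * phi v)%:E).
Proof.
move=> mu lu mp p1 p0.
have := (integrable_mkcond (mu := lam) _ (measurable_cube r)).1 (lu r).
apply: le_integrable => //.
  by apply/measurable_EFinP; exact: measurable_funM.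
move=> v _; rewrite patchE; case: ifPn => [_|].
  by rewrite /= lee_fin normrM ler_piMr.
by rewrite notin_setE => /p0 ->; rewrite mulr0 abse0.
Qed.

End local_integrability.

(** * Averages along segments and their adjoint *)

Section line_average.
Local Open Scope ereal_scope.
Context {R : realType} (d : nat).
Local Notation lam := (@lebesgue_rV R d).
Local Notation mu := (@lebesgue_measure R).
Variables (G : 'rV[R]_d -> R) (e : 'rV[R]_d) (s : R).
Hypothesis mG : measurable_fun setT G.
Hypothesis lG : locint G.

Lemma measurable_line :
  measurable_fun [set: 'rV[R]_d * measurableTypeR R]
    (fun z : 'rV[R]_d * measurableTypeR R => z.1 + z.2 *: e)%R.
Proof.
apply: measurable_fun_rV => i; under eq_fun do rewrite !mxE.
apply: measurable_funD; last by apply: measurable_funM.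
exact: (measurableT_comp (measurable_coord_rV i)).
Qed.

(** The indicator of [[0, s]] is part of the integrand, so that Fubini can be applied on the whole
    product space. *)
Let K (z : 'rV[R]_d * measurableTypeR R) : R :=
  (G (z.1 + z.2 *: e) * \1_(`[0%R, s]%classic) z.2)%R.

Let m1 : measurable_fun [set: 'rV[R]_d * measurableTypeR R]
  (fun z => \1_(`[0%R, s]%classic) z.2 : R).
Proof.
have mI : measurable (`[0%R, s]%classic : set (measurableTypeR R)) by [].
exact: (measurableT_comp (measurable_indic mI) measurable_snd).
Qed.

Let mK : measurable_fun setT K.
Proof.
apply: measurable_funM => //.
by apply: measurableT_comp => //; exact: measurable_line.
Qed.

Definition line_average (v : 'rV[R]_d) : R :=
  (\int[mu]_(t in `[0%R, s]) G (v + t *: e))%R.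

Let line_averageE v : line_average v = fine (\int[mu]_t (K (v, t))%:E).
Proof.
rewrite /line_average /Rintegral integral_mkcond; congr fine.
apply: eq_integral => t _; rewrite patchE /K indicE/=.
by case: ifP => _; rewrite (mulr1, mulr0).
Qed.

Lemma measurable_line_average : measurable_fun setT line_average.
Proof.
rewrite (_ : line_average = fine \o (fun v => \int[mu]_t (K (v, t))%:E)).
  apply: measurableT_comp => //.
  by apply: (@measurable_fun_marginal _ _ _ _ _ mu (EFin \o K));
    exact/measurable_EFinP.
by apply/funext => v; rewrite line_averageE.
Qed.

Let c := (s * \sum_j `|e ord0 j|)%R.

Let line_le t j : (0 <= t <= s)%R -> (`|(t *: e) ord0 j| <= c)%R.
Proof.
move=> /andP[t0 ts]; rewrite mxE normrM ger0_norm// /c ler_pM//.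
by rewrite (bigD1 j)//= lerDl sumr_ge0.
Qed.

Variables (phi : 'rV[R]_d -> R) (r : R).
Hypothesis mphi : measurable_fun setT phi.
Hypothesis phi1 : forall v, (`|phi v| <= 1)%R.
Hypothesis phi0 : forall v, ~ cube r v -> phi v = 0%R.

Let H (z : 'rV[R]_d * measurableTypeR R) : \bar R := (K z * phi z.1)%:E.

Let mH : measurable_fun setT H.
Proof.
apply/measurable_EFinP; apply: measurable_funM => //.
exact: (@measurableT_comp _ _ _ _ _ _ phi).
Qed.

(** For [t] in [[0, s]] the shift by [t *: e] moves each coordinate by at most [c], so the inner
    integral is bounded, uniformly in [t], by the integral of [|G|] over [cube (r + c)]. *)
Let iH : (lam \x mu).-integrable setT H.
Proof.
apply/(integrable21ltyP _ _ mH).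
pose B := \int[lam]_(v in cube (r + c)) `|(G v)%:E|.
have Boo : B < +oo by have /integrableP[] := lG (r + c)%R.
have B0 : 0 <= B by apply: integral_ge0.
apply: (@le_lt_trans _ _ (\int[mu]_(t in `[0%R, s]) B)); last first.
  rewrite integral_cst//= lebesgue_measure_itv/=.
  case: ifP => _; last by rewrite mule0.
  by rewrite -EFinB lte_mul_pinfty// ?ltry// ge0_fin_numE.
rewrite [leRHS]integral_mkcond; apply: ge0_le_integral => //.
- by move=> t _; apply: integral_ge0.
- apply: (measurable_fun_fubini_tonelli_G (abse \o H)) => [|z].
    exact: measurableT_comp.
  exact: abse_ge0.
- by apply: emeasurable_patch => //; exact: measurable_cst.
move=> t _; rewrite patchE; case: ifPn => ts; last first.
  rewrite integral0_eq// => v _.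
  by rewrite /H /K/= indicE (negbTE ts) mulr0 mul0r normr0.
have HE v : H (v, t) = (G (v + t *: e) * phi v)%:E.
  by rewrite /H /K/= indicE ts mulr1.
move: ts; rewrite inE/= in_itv/= => ts.
apply: (@le_trans _ _ (\int[lam]_(v in cube r) `|(G (v + t *: e))%:E|)); last first.
  apply: (@ge0_integral_cube_shift R d r c (t *: e) (fun v => `|(G v)%:E|)) => //.
  - by apply: measurableT_comp => //; exact/measurable_EFinP.
  - by move=> j; exact: line_le.
rewrite [leRHS]integral_mkcond; apply: ge0_le_integral => //.
- apply/measurable_EFinP; apply: measurableT_comp => //.
  apply: measurable_funM => //.
  exact: (measurableT_comp mK (measurable_pair2 t)).
- apply: emeasurable_patch; first exact: measurable_cube.
  apply: measurableT_comp => //; apply/measurable_EFinP.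
  by apply: measurableT_comp => //; exact: measurable_rV_shift.
move=> v _; rewrite patchE -[leLHS]/(`|H (v, t)|) HE; case: ifPn => [_|].
  by rewrite lee_fin normrM ler_piMr.
by rewrite notin_setE => /phi0 ->; rewrite mulr0 abse0.
Qed.

Let HE : {ae lam, forall v,
  \int[mu]_t H (v, t) = (line_average v * phi v)%:E}.
Proof.
apply: filterS (ae_integrable1 iH) => v iHv.
(* Where [phi v] is zero, both sides vanish, whatever the segment integral is; elsewhere division by
   [phi v] shows that [K (v, t)] is integrable in [t]. *)
rewrite line_averageE /H/=; have [->|pv] := eqVneq (phi v) 0%R.
  by under eq_integral do rewrite mulr0; rewrite integral0 mulr0.
have iK : mu.-integrable setT (fun t => (K (v, t))%:E).
  have := integrableZr measurableT (phi v)^-1 iHv; apply: eq_integrable => //.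
  by move=> t _ /=; rewrite -EFinM mulfK.
under eq_integral do rewrite EFinM.
by rewrite integralZr// EFinM fineK//; exact: integrable_fin_num.
Qed.

Lemma line_average_mul_integrable :
  lam.-integrable setT (fun v => (line_average v * phi v)%:E).
Proof.
have mL : measurable_fun setT (fun v => (line_average v * phi v)%:E).
  apply/measurable_EFinP; apply: measurable_funM => //.
  exact: measurable_line_average.
have iF := integrable_fubini_F iH.
apply/integrableP; split => //.
have /integrableP[mF Foo] := iF.
rewrite (_ : \int[lam]_v _ = \int[lam]_x `|fubini_F mu H x|)//.
apply: ae_eq_integral_any.
by apply: filterS HE => v Hv _; rewrite -Hv.
Qed.

(** After Fubini, translating [v] by [- t *: e] for each fixed [t] moves the average from [G] to
    [phi]. *)
Lemma integral_line_average :
  \int[lam]_v (line_average v * phi v)%:E =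
  \int[lam]_v (G v * \int[mu]_(t in `[0%R, s]) phi (v - t *: e))%:E.
Proof.
transitivity (\int[lam]_v \int[mu]_t H (v, t)).
  by apply/esym/ae_eq_integral_any; apply: filterS HE => v Hv _.
rewrite Fubini//.
pose L (z : 'rV[R]_d * measurableTypeR R) : \bar R :=
  (G z.1 * phi (z.1 - z.2 *: e) * \1_(`[0%R, s]%classic) z.2)%:E.
have mphiL : measurable_fun setT
    (fun z : 'rV[R]_d * measurableTypeR R => phi (z.1 - z.2 *: e)%R).
  apply: measurableT_comp => //.
  apply: measurable_fun_rV => i; under eq_fun do rewrite !mxE.
  apply: measurable_funB; last by apply: measurable_funM.
  exact: (measurableT_comp (measurable_coord_rV i)).
have mL : measurable_fun setT L.
  apply/measurable_EFinP; apply: measurable_funM => //.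
  by apply: measurable_funM => //; exact: measurableT_comp.
have HL v t : L ((v + t *: e)%R, t) = H (v, t).
  by rewrite /L /H /K/= addrK; congr EFin; ring.
have iL : (lam \x mu).-integrable setT L.
  apply/(integrable21ltyP _ _ mL).
  apply: le_lt_trans ((integrable21ltyP _ _ mH).1 iH).
  rewrite le_eqVlt; apply/orP; left; apply/eqP/eq_integral => t _.
  rewrite -(ge0_integral_rV_shift (t *: e) (f := fun v => `|L (v, t)|))//.
    by apply: eq_integral => v _; rewrite HL.
  apply: measurableT_comp => //; exact: (measurableT_comp mL (measurable_pair2 t)).
transitivity (\int[mu]_t \int[lam]_v L (v, t)).
  apply: eq_integral => t _.
  rewrite -(integral_rV_shift (t *: e) (f := fun v => L (v, t)))//.
    by apply: eq_integral => v _; rewrite HL.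
  exact: (measurableT_comp mL (measurable_pair2 t)).
rewrite -Fubini//; apply: eq_integral => v _.
have iphi : mu.-integrable `[0%R, s] (fun t => (phi (v - t *: e))%:E).
  apply: measurable_bounded_integrable => //.
  - by rewrite /= lebesgue_measure_itv/=; case: ifP => _; rewrite -?EFinB ltry.
  - apply: measurable_funTS.
    exact: (measurableT_comp mphiL (measurable_pair1 v)).
  - exists 1%R; split => // M M1 t _ /=.
    by apply: le_trans (ltW M1).
rewrite EFinM /Rintegral fineK; last exact: integrable_fin_num.
rewrite -integralZl//= [RHS]integral_mkcond; apply: eq_integral => t _.
rewrite patchE /L indicE/=; case: ifP => _; first by rewrite mulr1 EFinM.
by rewrite mulr0.
Qed.

End line_average.

Section tensor_shift.
Context {R : realType} (d : nat).
Implicit Types (p : 'I_d -> R -> R) (v : 'rV[R]_d).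

Lemma tensor_shift p i v (h : R) :
  tensor p (v + h *: delta_mx ord0 i) =
  p i (v ord0 i + h) * \prod_(j | j != i) p j (v ord0 j).
Proof.
rewrite /tensor (bigD1 i)//= !mxE !eqxx/= mulr1; congr (_ * _).
by apply: eq_bigr => j ji; rewrite !mxE eqxx (negbTE ji)/= mulr0 addr0.
Qed.

Lemma tensorD1 p i v :
  tensor p v = p i (v ord0 i) * \prod_(j | j != i) p j (v ord0 j).
Proof. by rewrite /tensor (bigD1 i). Qed.

End tensor_shift.

Lemma window_bound {R : realType} (a b A B S s x : R) : A + B <= S ->
  - a <= A -> b <= B -> 0 <= A -> 0 <= B -> 0 < s ->
  a <= x <= b + s -> - (s + S) <= x <= s + S.
Proof. by move=> *; apply/andP; split; lra. Qed.

Section weak_derivative.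
Local Open Scope ereal_scope.
Context {R : realType} (d : nat).
Local Notation lam := (@lebesgue_rV R d).
Local Notation mu := (@lebesgue_measure R).
Variables (g G : 'rV[R]_d -> R) (i : 'I_d) (s : R).
Hypothesis mg : measurable_fun setT g.
Hypothesis lg : locint g.
Hypothesis mG : measurable_fun setT G.
Hypothesis lG : locint G.
Hypothesis s0 : (0 < s)%R.
Hypothesis weakG : forall p r, (forall j, smooth1 (p j)) ->
  (forall j (x : R), ~~ (- r <= x <= r)%R -> p j x = 0%R) ->
  (\int[lam]_v (g v * tensor (tensor_derive i p) v) =
   - \int[lam]_v (G v * tensor p v))%R.

Let e : 'rV[R]_d := delta_mx ord0 i.
Let L := line_average G e s.

Let mL : measurable_fun setT L.
Proof. exact: measurable_line_average. Qed.

Let lL : locint L.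
Proof.
move=> r; apply/(integrable_mkcond (mu := lam) _ (measurable_cube r)).2.
have mc : measurable_fun setT (\1_(cube r) : 'rV[R]_d -> R).
  exact: measurable_indic (measurable_cube r).
have := @line_average_mul_integrable R d G e s mG lG (\1_(cube r)) r mc.
set A := (X in X -> _) => H.
have {}H : lam.-integrable setT (fun v => (L v * \1_(cube r) v)%:E).
  apply: H => v; first by rewrite indicE; case: (_ \in _); rewrite ?normr1 ?normr0.
  by move=> vr; rewrite indicE memNset.
apply: eq_integrable H => // v _; rewrite patchE indicE/=.
by case: ifP => _; rewrite (mulr1, mulr0).
Qed.

Let mgs : measurable_fun setT (fun v : 'rV[R]_d => g (v + s *: e))%R.
Proof. by apply: measurableT_comp => //; exact: measurable_rV_shift. Qed.

Let lgs : locint (fun v : 'rV[R]_d => g (v + s *: e))%R.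
Proof. exact: locint_shift. Qed.

(** Let [q] be the bump [phi] with its [i]-th factor replaced by its window average. Then the [i]-th
    partial derivative of [q] is [phi v - phi (v - s *: e)], and [q v] is the integral of
    [phi (v - t *: e)] over [[0, s]]. The weak formula for [q], a translation and
    [integral_line_average] show that the increment minus the line average is orthogonal to all
    bumps. *)
Lemma weak_increment : {ae lam, forall v,
  (g (v + s *: e) - g v = line_average G e s v)%R}.
Proof.
suff : {ae lam, forall v, ((g (v + s *: e) - g v) - L v = 0)%R}.
  by apply: filterS => v /eqP; rewrite subr_eq0 => /eqP.
apply: fundamental_lemma.
- by apply: measurable_funB => //; exact: measurable_funB.
- by apply: locintB => //; exact: locintB.
move=> a b n; set phi := tensor (bumps a b n).
have [r r0 abr] := obox_sub_cube a b.
have sb j : smooth1 (bumps a b n j) by exact: smooth1_smooth_bump.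
have mphi : measurable_fun setT phi.
  by apply: measurable_tensor => j; exact: smooth1_continuous.
have phi1 v : (`|phi v| <= 1)%R.
  by have /andP[? ?] := tensor_bumps_itv a b n v; rewrite ger0_norm.
have phi0 v : ~ cube r v -> phi v = 0%R.
  by move=> vr; apply: tensor_bumps_out; apply: contra_not vr; exact: abr.
have bump0 j (x : R) : ~~ (a j <= x <= b j)%R -> bumps a b n j x = 0%R.
  move=> xab; apply: smooth_bump_out; apply: contra xab.
  by move=> /andP[/ltW -> /ltW ->].
have [P [sP dP intP P0]] := smooth_window (sb i) (bump0 i) s0.
pose q j := if j == i then P else bumps a b n j.
have qiE : q i = P by rewrite /q eqxx.
have prodq (v : 'rV[R]_d) : (\prod_(j | j != i) q j (v ord0 j) =
    \prod_(j | j != i) bumps a b n j (v ord0 j))%R.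
  by apply: eq_bigr => j /negbTE ji; rewrite /q ji.
have sq j : smooth1 (q j) by rewrite /q; case: ifP.
(* [weakG] asks for one symmetric interval outside which all factors vanish; this one contains every
   [[a j, b j + s]], where the extra [s] is the window length. *)
pose r' := (s + \sum_j (`|a j| + `|b j|))%R.
have q0 j (x : R) : ~~ (- r' <= x <= r')%R -> q j x = 0%R.
  move=> xr; have jr : (`|a j| + `|b j| <= \sum_j (`|a j| + `|b j|))%R.
    by rewrite [leRHS](bigD1 j)//= lerDl sumr_ge0// => k _; rewrite addr_ge0.
  have xab : ~~ (a j <= x <= b j + s)%R.
    by apply: contra xr; rewrite /r'; apply: window_bound jr _ _ _ _ _ => //;
      [rewrite -normrN ler_norm|exact: ler_norm].
  rewrite /q; case: eqP => [ji|_]; [apply: P0; rewrite -ji//|apply: bump0].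
  by apply: contra xab => /andP[-> /le_trans]; apply; rewrite lerDl ltW.
have dq v : (tensor (tensor_derive i q) v = phi v - phi (v - s *: e))%R.
  rewrite (tensorD1 _ i) /phi -scaleNr tensor_shift (tensorD1 _ i).
  rewrite -mulrBl /tensor_derive eqxx qiE dP; congr (_ * _)%R.
  by rewrite -prodq; apply: eq_bigr => j /negbTE ->.
have intq v : (\int[mu]_(t in `[0%R, s]) phi (v - t *: e) = tensor q v)%R.
  rewrite (tensorD1 _ i) qiE -intP prodq -RintegralZr//.
    by apply: eq_Rintegral => t _; rewrite /phi -scaleNr tensor_shift.
  apply: continuous_compact_integrable; first exact: segment_compact.
  apply: continuous_subspaceT => t.
  apply: (@continuous_comp _ _ _ (fun t : R => v ord0 i - t)%R (bumps a b n i)).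
    by apply: continuousB; [exact: cvg_cst|].
  exact: smooth1_continuous.
have iint u : measurable_fun setT u -> locint u ->
    lam.-integrable setT (EFin \o (fun v => u v * phi v)%R).
  by move=> mu lu; exact: (locint_mul_integrable mu lu mphi phi1 phi0).
have eG := @integral_line_average R d G e s mG lG phi r mphi phi1 phi0.
have {}eG : (\int[lam]_v (L v * phi v) = \int[lam]_v (G v * tensor q v))%R.
  rewrite /Rintegral eG; congr fine; apply: eq_integral => v _.
  by rewrite intq.
have eshift : (\int[lam]_v (g (v + s *: e) * phi v) =
    \int[lam]_v (g v * phi (v - s *: e)))%R.
  rewrite /Rintegral; congr fine.
  rewrite -(integral_rV_shift (s *: e)
    (f := fun v : 'rV[R]_d => (g v * phi (v - s *: e))%:E)%R).
    by apply: eq_integral => v _; rewrite addrK.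
  apply/measurable_EFinP; apply: measurable_funM => //.
  by apply: (measurableT_comp mphi); exact: measurable_rV_shift.
have ishift : lam.-integrable setT
    (EFin \o (fun v : 'rV[R]_d => g v * phi (v - s *: e))%R).
  have mphi' : measurable_fun setT (fun v : 'rV[R]_d => phi (v - s *: e)%R).
    by apply: (measurableT_comp mphi); exact: measurable_rV_shift.
  apply: (locint_mul_integrable (r := (r + s)%R) mg lg mphi') => // v vr.
  apply: phi0; apply: contra_not vr => vr.
  rewrite -[v](subrK (s *: e)%R); apply: (cube_shift _ vr) => j.
  rewrite !mxE eqxx/= normrM gtr0_norm//.
  by case: (j == i); rewrite ?normr1 ?normr0 ?mulr1 ?mulr0//; exact: ltW.
have ig' := iint _ mg lg; have igs' := iint _ mgs lgs; have iL' := iint _ mL lL.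
have := weakG sq q0; rewrite -eG.
under eq_Rintegral do rewrite dq mulrBr.
rewrite (RintegralB measurableT ig' ishift) -eshift => H.
under eq_Rintegral do rewrite !mulrBl.
rewrite (RintegralB measurableT (integrableB measurableT igs' ig') iL').
rewrite (RintegralB measurableT igs' ig').
by rewrite -[X in (X - _)%R]opprB H opprK subrr.
Qed.

End weak_derivative.

Lemma normr_mulD_le_sqr {R : realType} (x y z : R) :
  `|x| * `|y + z| <= x ^+ 2 + (y ^+ 2 + z ^+ 2).
Proof.
rewrite -normrM ler_norml.
have := sqr_ge0 (x - y); have := sqr_ge0 (x - z); have := sqr_ge0 (x + y).
have := sqr_ge0 (x + z); have := sqr_ge0 y; have := sqr_ge0 z.
by move=> *; apply/andP; split; lra.
Qed.

(** * Translation estimates in L^1 *)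

Section increment_bound.
Local Open Scope ereal_scope.
Context {R : realType} (d : nat).
Local Notation lam := (@lebesgue_rV R d).
Local Notation mu := (@lebesgue_measure R).

(** [f = g ^ 2] satisfies [f (v + s e) - f v = (g (v + s e) - g v)
    (g (v + s e) + g v)], which is split by [|x (y + z)| <= x^2 + y^2 + z^2]. *)
Lemma increment_sq_bound (g G : 'rV[R]_d -> R) (e : 'rV[R]_d) (s : R) :
  measurable_fun setT g -> measurable_fun setT G -> (0 < s)%R ->
  {ae lam, forall v, (g (v + s *: e) - g v = line_average G e s v)%R} ->
  \int[lam]_v `|(g (v + s *: e) ^+ 2 - g v ^+ 2)%:E| <=
  s%:E * (\int[lam]_v (G v ^+ 2)%:E + 2%:E * \int[lam]_v (g v ^+ 2)%:E).
Proof.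
move=> mg mG s0 incr.
have mshift (u : 'rV[R]_d -> R) w : measurable_fun setT u ->
    measurable_fun setT (fun v : 'rV[R]_d => u (v + w)%R).
  by move=> mu_; apply: (measurableT_comp mu_); exact: measurable_rV_shift.
have mI : measurable (`[0%R, s]%classic : set (measurableTypeR R)) by [].
pose A v := (g (v + s *: e) ^+ 2 + g v ^+ 2)%R.
have mA : measurable_fun setT A.
  by apply: measurable_funD; apply: measurable_funX => //; exact: mshift.
have A0 v : (0 <= A v)%R by rewrite addr_ge0 ?sqr_ge0.
pose h v t := (G (v + t *: e) ^+ 2 + A v)%R.
have h0 v t : (0 <= h v t)%R by rewrite addr_ge0 ?sqr_ge0.
pose H (z : 'rV[R]_d * measurableTypeR R) : \bar R :=
  (h z.1 z.2 * \1_(`[0%R, s]%classic) z.2)%:E.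
have mH : measurable_fun setT H.
  apply/measurable_EFinP; apply: measurable_funM; last first.
    exact: (measurableT_comp (measurable_indic mI) measurable_snd).
  apply: measurable_funD.
    apply: measurable_funX; apply: (measurableT_comp mG).
    exact: measurable_line.
  exact: (measurableT_comp mA measurable_fst).
have H0 z : 0 <= H z.
  by rewrite lee_fin mulr_ge0// indicE.
have HE v t : H (v, t) = ((fun t => (h v t)%:E) \_ `[0%R, s]%classic) t.
  by rewrite /H/= indicE patchE; case: ifP => _; rewrite (mulr1, mulr0).
have mline v : measurable_fun [set: measurableTypeR R]
    (fun t : measurableTypeR R => G (v + t *: e)%R).
  exact: (measurableT_comp (measurableT_comp mG (@measurable_line R d e))
    (measurable_pair1 v)).
(* The quadratic inequality is applied under the integral over [t], to [G (v + t *: e)] and the sum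
   of the two values of [g]; the latter does not depend on [t], which is what produces the overall
   factor [s]. *)
apply: (@le_trans _ _ (\int[lam]_v \int[mu]_t H (v, t))).
  apply: ae_ge0_le_integral_any => [v _|v _|].
  - exact: abse_ge0.
  - by apply: integral_ge0.
  apply: filterS incr => v incr _.
  under eq_integral do rewrite HE.
  rewrite -integral_mkcond subr_sqr incr EFinM abseM.
  apply: (@le_trans _ _ (\int[mu]_(t in `[0%R, s])
      (`|(G (v + t *: e))%:E| * `|(g (v + s *: e) + g v)%:E|))).
    rewrite ge0_integralZr//; last first.
      apply: measurableT_comp => //; apply/measurable_EFinP.
      exact: measurable_funTS.
    rewrite lee_wpmul2r//; apply: le_trans (le_abse_integral _ _ _) => //.
      rewrite /line_average /Rintegral.
      by case: integral => [r| |]//=; rewrite leey.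
    by apply/measurable_EFinP; exact: measurable_funTS.
  apply: ge0_le_integral => //.
  - apply: emeasurable_funM => //; apply: measurableT_comp => //.
    by apply/measurable_EFinP; exact: measurable_funTS.
  - apply/measurable_EFinP/measurable_funTS; apply: measurable_funD => //.
    exact: measurable_funX.
  move=> t _; rewrite -EFinM lee_fin /h /A.
  exact: normr_mulD_le_sqr.
rewrite fubini_tonelli//.
(* By translation invariance this is independent of [t]; the coefficient 2 counts the squares of [g]
   at the two ends of the segment. *)
have int_h t : \int[lam]_v (h v t)%:E =
    \int[lam]_v (G v ^+ 2)%:E + 2%:E * \int[lam]_v (g v ^+ 2)%:E.
  under eq_integral do rewrite !EFinD.
  have sq0 (r : R) : 0 <= (r ^+ 2)%:E by rewrite lee_fin sqr_ge0.
  have msq (u : 'rV[R]_d -> R) : measurable_fun setT u ->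
      measurable_fun setT (fun v => (u v ^+ 2)%:E).
    by move=> mu_; apply/measurable_EFinP; exact: measurable_funX.
  rewrite ge0_integralD//; first last.
  - by apply: emeasurable_funD; apply: msq => //; exact: mshift.
  - by move=> v _; rewrite adde_ge0.
  - by apply: msq; exact: mshift.
  rewrite ge0_integralD//; [|by apply: msq; exact: mshift|exact: msq].
  rewrite (ge0_integral_rV_shift _ (f := fun v => (G v ^+ 2)%:E))//; last exact: msq.
  rewrite (ge0_integral_rV_shift _ (f := fun v => (g v ^+ 2)%:E))//; last exact: msq.
  by rewrite -[2%:E]/((1 + 1)%:E) EFinD ge0_muleDl// mul1e.
rewrite (_ : \int[mu]_t _ = \int[mu]_(t in `[0%R, s])
    (\int[lam]_v (G v ^+ 2)%:E + 2%:E * \int[lam]_v (g v ^+ 2)%:E)).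
  rewrite integral_cst//= lebesgue_measure_itv/= lte_fin s0 sube0.
  by rewrite muleC.
rewrite [RHS]integral_mkcond; apply: eq_integral => t _; rewrite patchE.
under eq_integral do rewrite HE patchE.
by case: ifP => _; [exact: int_h|rewrite integral0].
Qed.

End increment_bound.

Section translation_bound.
Local Open Scope ereal_scope.
Context {R : realType} (d : nat).
Local Notation lam := (@lebesgue_rV R d).

Lemma in_L1loc_locint (u u' : 'rV[R]_d -> R) : measurable_fun setT u ->
  {ae lam, forall v, u v = u' v} -> in_L1loc u' -> locint u.
Proof.
move=> mu_ uu' lu' r; have [_ H] := lu' _ (@compact_cube R d r).
apply/integrableP; split; first exact/measurable_EFinP/measurable_funTS.
apply: le_lt_trans H; rewrite le_eqVlt; apply/orP; left; apply/eqP.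
by apply: ae_eq_integral_any; apply: filterS uu' => v uv _ /=; rewrite uv.
Qed.

Variables (F F' : 'rV[R]_d -> R) (D : 'I_d -> 'rV[R]_d -> R).
Variable (D' : 'rV[R]_d -> 'rV[R]_d).
Hypothesis mF : measurable_fun setT F.
Hypothesis F0 : forall v, (0 <= F v)%R.
Hypothesis FF' : {ae lam, forall v, F v = F' v}.
Hypothesis mD : forall i, measurable_fun setT (D i).
Hypothesis DD' : forall i, {ae lam, forall v, D i v = D' v ord0 i}.
Hypothesis wD' : is_weak_gradient (fun v => Num.sqrt (F' v)) D'.

Let msF : measurable_fun setT (fun v => Num.sqrt (F v)).
Proof. exact: (measurableT_comp (continuous_measurable_fun (@sqrt_continuous R)) mF). Qed.

Let mdiff w : measurable_fun setT (fun v : 'rV[R]_d => `|(F (v + w) - F v)%:E|).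
Proof.
apply: measurableT_comp => //; apply/measurable_EFinP.
apply: measurable_funB => //; apply: (measurableT_comp mF).
exact: measurable_rV_shift.
Qed.

(** The step along [e_i] only needs the [i]-th derivative; summing over all [i] gives one constant
    that serves every direction. *)
Let N := \sum_i \int[lam]_v (D i v ^+ 2)%:E + 2%:E * \int[lam]_v (F v)%:E.

Let N0 : 0 <= N.
Proof.
have D0 i : 0 <= \int[lam]_v (D i v ^+ 2)%:E.
  by apply: integral_ge0 => v _; rewrite lee_fin sqr_ge0.
rewrite adde_ge0 ?sume_ge0// mule_ge0// integral_ge0// => v _.
by rewrite lee_fin.
Qed.

Let direction_pos i (s : R) : (0 < s)%R ->
  \int[lam]_v `|(F (v + s *: delta_mx ord0 i) - F v)%:E| <= s%:E * N.
Proof.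
move=> s0.
have [lsF' lD' _] := wD'.
have FF'sqrt : {ae lam, forall v, Num.sqrt (F v) = Num.sqrt (F' v)}.
  by apply: filterS FF' => v ->.
have lsF := in_L1loc_locint msF FF'sqrt lsF'.
have lD := in_L1loc_locint (mD i) (DD' i) (lD' i).
have weakD p r : (forall j, smooth1 (p j)) ->
    (forall j (x : R), ~~ (- r <= x <= r)%R -> p j x = 0%R) ->
    (\int[lam]_v (Num.sqrt (F v) * tensor (tensor_derive i p) v) =
     - \int[lam]_v (D i v * tensor p v))%R.
  move=> sp p0; have := is_weak_gradient_tensor i wD' sp p0.
  rewrite (_ : \int[lam]_v (_ * tensor p v) = \int[lam]_v (D i v * tensor p v))%R.
    move=> <-; apply: ae_eq_Rintegral_any.
    by apply: filterS FF'sqrt => v -> _.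
  by apply/esym/ae_eq_Rintegral_any; apply: filterS (DD' i) => v -> _.
have incr := weak_increment msF lsF (mD i) lD s0 weakD.
have := increment_sq_bound msF (mD i) s0 incr.
under eq_integral do rewrite !sqr_sqrtr//.
under [X in _ <= _ * (_ + _ * X) -> _]eq_integral do rewrite sqr_sqrtr//.
move=> /le_trans; apply; apply: lee_wpmul2l; first by rewrite lee_fin ltW.
rewrite leeD2r// (bigD1 i)//= leeDl// sume_ge0// => j _.
by apply: integral_ge0 => v _; rewrite lee_fin sqr_ge0.
Qed.

Let direction i (s : R) :
  \int[lam]_v `|(F (v + s *: delta_mx ord0 i) - F v)%:E| <= `|s|%:E * N.
Proof.
have [s0|s0|->] := ltgtP s 0%R.
- rewrite ltr0_norm//.
  set e := delta_mx ord0 i.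
  have := @direction_pos i (- s); rewrite oppr_gt0 => /(_ s0).
  (* A shift by [s *: e] exchanges the two points of the difference, reducing a negative step to a
     positive one. *)
  rewrite -(ge0_integral_rV_shift (s *: e)
    (f := fun v => `|(F (v + - s *: e) - F v)%:E|))//.
  apply: le_trans; rewrite le_eqVlt; apply/orP; left; apply/eqP.
  apply: eq_integral => v _.
  by rewrite scaleNr addrK/= distrC.
- by rewrite gtr0_norm//; exact: direction_pos.
- rewrite normr0 mul0e (_ : \int[lam]_v _ = 0)//.
  by apply: integral0_eq => v _; rewrite scale0r addr0 subrr abse0.
Qed.

(** The path from [v] to [v + w] goes along the coordinate axes, one step for each coordinate of
    [w]; each step contributes its length times [N], its starting point being absorbed by
    translation invariance. [F] and [D] are measurable representatives, while the weak gradient is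
    given for [F'] and [D']. *)
Lemma translation_bound (w : 'rV[R]_d) :
  \int[lam]_v `|(F (v + w) - F v)%:E| <= (\sum_i `|w ord0 i|)%:E *
  (\sum_i \int[lam]_v (D i v ^+ 2)%:E + 2%:E * \int[lam]_v (F v)%:E).
Proof.
rewrite -/N {1}(row_sum_delta w).
elim: (index_enum _) => [|i l IH].
  rewrite !big_nil mul0e (_ : \int[lam]_v _ = 0)//.
  by apply: integral0_eq => v _; rewrite addr0 subrr abse0.
rewrite !big_cons EFinD ge0_muleDl ?lee_fin ?sumr_ge0//.
set x := (w ord0 i *: _)%R; set y := (\sum_(j <- l) _ *: _)%R.
apply: (@le_trans _ _ (\int[lam]_v (`|(F (v + y + x) - F (v + y))%:E| +
    `|(F (v + y) - F v)%:E|))).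
  apply: ge0_le_integral => //.
  - by apply: emeasurable_funD => //; apply: (measurableT_comp (mdiff x));
      exact: measurable_rV_shift.
  move=> v _; rewrite -EFinD lee_fin addrA addrAC; exact: ler_distD.
rewrite ge0_integralD//; last first.
  by apply: (measurableT_comp (mdiff x)); exact: measurable_rV_shift.
apply: leeD => //.
rewrite (ge0_integral_rV_shift y (f := fun v => `|(F (v + x) - F v)%:E|))//.
exact: direction.
Qed.

End translation_bound.

(** * Weak and strong convergence in L^1 *)

Section L1_tools.
Local Open Scope ereal_scope.
Context {R : realType}.

Lemma cvge0P (u : nat -> \bar R) : (forall n, 0 <= u n) ->
  (u @ \oo --> 0) <-> (forall e : R, (0 < e)%R -> \forall n \near \oo, u n <= e%:E).
Proof.
move=> u0; split.
  move=> /fine_cvgP[ufin] /cvgr0Pnorm_le H e e0.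
  near=> n; rewrite -[u n]fineK; last by near: n.
  by rewrite lee_fin; apply: (le_trans (ler_norm _)); near: n; exact: H.
move=> H.
have ufin : \forall n \near \oo, u n \is a fin_num.
  apply: filterS (H 1%R ltr01) => n un.
  by rewrite ge0_fin_numE//; apply: (le_lt_trans un); exact: ltry.
apply/fine_cvgP; split => //; apply/cvgr0Pnorm_le => e e0.
near=> n; rewrite /= ger0_norm ?fine_ge0// -lee_fin fineK; last by near: n.
by near: n; exact: H.
Unshelve. all: by end_near. Qed.

Context d (T : measurableType d) (mu : {measure set T -> \bar R}).

Lemma L1_normD (u v : T -> R) : measurable_fun setT u -> measurable_fun setT v ->
  \int[mu]_x `|(u x + v x)%:E| <=
  \int[mu]_x `|(u x)%:E| + \int[mu]_x `|(v x)%:E|.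
Proof.
move=> mu_ mv.
have mabs (w : T -> R) : measurable_fun setT w ->
    measurable_fun setT (fun x => `|(w x)%:E|).
  by move=> mw; apply: measurableT_comp => //; exact/measurable_EFinP.
rewrite -ge0_integralD//; try exact: mabs.
apply: ge0_le_integral => //.
- by apply: mabs; exact: measurable_funD.
- by apply: emeasurable_funD; exact: mabs.
- by move=> x _; rewrite lee_fin ler_normD.
Qed.

Lemma L1_dist_triangle (u v w : T -> R) : measurable_fun setT u ->
  measurable_fun setT v -> measurable_fun setT w ->
  \int[mu]_x `|(u x - w x)%:E| <=
  \int[mu]_x `|(u x - v x)%:E| + \int[mu]_x `|(v x - w x)%:E|.
Proof.
move=> mu_ mv mw.
apply: le_trans (L1_normD _ _); try exact: measurable_funB.
rewrite le_eqVlt; apply/orP; left; apply/eqP/eq_integral => x _.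
by rewrite addrA subrK.
Qed.

Lemma integrableM_bounded (u s : T -> R) :
  mu.-integrable setT (EFin \o u) -> measurable_fun setT s ->
  (forall x, `|s x| <= 1)%R -> mu.-integrable setT (EFin \o (fun x => u x * s x)%R).
Proof.
move=> iu ms s1; have mu_ := measurable_int _ iu.
apply: le_integrable iu => //.
  by apply/measurable_EFinP; apply: measurable_funM => //; exact/measurable_EFinP.
by move=> x _; rewrite /= lee_fin normrM ler_piMr.
Qed.

Lemma le_normr_Rintegral_bounded (u s : T -> R) :
  mu.-integrable setT (EFin \o u) -> measurable_fun setT s ->
  (forall x, `|s x| <= 1)%R ->
  `|(\int[mu]_x (u x * s x))%R%:E| <= \int[mu]_x `|(u x)%:E|.
Proof.
move=> iu ms s1; have ius := integrableM_bounded iu ms s1.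
rewrite /Rintegral fineK; last exact: integrable_fin_num.
apply: le_trans (le_abse_integral _ _ _) _ => //; first exact: (measurable_int _ ius).
apply: ge0_le_integral => //.
- by apply: measurableT_comp => //; exact: (measurable_int _ ius).
- by apply: measurableT_comp => //; exact: (measurable_int _ iu).
- by move=> x _; rewrite lee_fin normrM ler_piMr.
Qed.

(** Duality: tested against the sign of [v], the limit integral is the L^1 norm of [v], while the
    approximating integrals are at most the norms of [u n]. *)
Lemma L1_norm_lsc (u : nat -> T -> R) (v : T -> R) (B : R) :
  (forall n, mu.-integrable setT (EFin \o u n)) ->
  mu.-integrable setT (EFin \o v) ->
  (forall s : T -> R, measurable_fun setT s -> (forall x, `|s x| <= 1)%R ->
    (fun n => \int[mu]_x (u n x * s x))%R @ \oo --> (\int[mu]_x (v x * s x))%R) ->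
  (\forall n \near \oo, \int[mu]_x `|(u n x)%:E| <= B%:E) ->
  \int[mu]_x `|(v x)%:E| <= B%:E.
Proof.
move=> iu iv uv uB.
pose s x : R := (if 0 <= v x then 1 else -1)%R.
have mv : measurable_fun setT v by apply/measurable_EFinP; exact: (measurable_int _ iv).
have ms : measurable_fun setT s.
  apply: measurable_fun_ifT; [|exact: measurable_cst|exact: measurable_cst].
  by apply: measurable_fun_ler => //; exact: measurable_cst.
have s1 x : (`|s x| <= 1)%R by rewrite /s; case: ifP; rewrite ?normrN normr1.
have vs x : (v x * s x = `|v x|)%R.
  rewrite /s; case: ifPn => v0; first by rewrite mulr1 ger0_norm.
  by rewrite mulrN1 ltr0_norm// ltNge.
have ivs := integrableM_bounded iv ms s1.
rewrite (_ : \int[mu]_x _ = (\int[mu]_x (v x * s x))%R%:E); last first.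
  rewrite /Rintegral fineK; last exact: integrable_fin_num.
  by apply: eq_integral => x _; rewrite vs.
rewrite lee_fin; apply: (cvgr_to_le (uv s ms s1)).
apply: filterS uB => n unB; rewrite -lee_fin; apply: le_trans unB.
apply: le_trans (le_normr_Rintegral_bounded (iu n) ms s1).
by rewrite lee_fin ler_norm.
Qed.

(** Pointwise, [|u - v| = (u - v) + 2 * max (v - u) 0]; the first term integrates to the difference
    of the masses. *)
Lemma Scheffe (u : nat -> T -> R) (v : T -> R) :
  (forall n, mu.-integrable setT (EFin \o u n)) ->
  mu.-integrable setT (EFin \o v) ->
  (fun n => \int[mu]_x u n x)%R @ \oo --> (\int[mu]_x v x)%R ->
  (fun n => \int[mu]_x (Num.max (v x - u n x) 0)%R%:E) @ \oo --> 0 ->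
  (fun n => \int[mu]_x `|(u n x - v x)%:E|) @ \oo --> 0.
Proof.
move=> iu iv uv pos0.
have idist n : mu.-integrable setT (EFin \o (fun x => u n x - v x)%R).
  exact: (integrableB measurableT (iu n) iv).
have idist' n : mu.-integrable setT (EFin \o (fun x => v x - u n x)%R).
  exact: (integrableB measurableT iv (iu n)).
have mdist' n : measurable_fun setT (fun x => v x - u n x)%R.
  by apply/measurable_EFinP; exact: (measurable_int _ (idist' n)).
have ipos n : mu.-integrable setT
    (EFin \o (fun x => Num.max (v x - u n x) 0)%R).
  apply: le_integrable (idist' n) => //.
    by apply/measurable_EFinP; apply: measurable_maxr => //; exact: measurable_cst.
  move=> x _; rewrite lee_fin ger0_norm ?le_max ?lexx ?orbT//.
  by rewrite ge_max ler_norm normr_ge0.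
have -> : (fun n => \int[mu]_x `|(u n x - v x)%:E|) = (fun n =>
    (\int[mu]_x u n x - \int[mu]_x v x +
     2 * \int[mu]_x (Num.max (v x - u n x) 0))%R%:E).
  apply/funext => n; rewrite -RintegralB// -RintegralZl//.
  have i2 : mu.-integrable setT
      (EFin \o (fun x => 2 * Num.max (v x - u n x) 0)%R).
    exact: (integrableZl measurableT 2 (ipos n)).
  rewrite -RintegralD// /Rintegral fineK.
    apply: eq_integral => x _; congr EFin; have [h|h] := leP (v x - u n x)%R 0%R.
      by rewrite mulr0 addr0 ger0_norm// -oppr_le0 opprB.
    by rewrite ltr0_norm; [ring|rewrite -oppr_gt0 opprB].
  apply: integrable_fin_num => //.
  exact: (integrableD measurableT (idist n) i2).
have pos0' : (fun n => \int[mu]_x (Num.max (v x - u n x) 0))%R @ \oo --> (0 : R)%R.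
  exact: (fine_cvg pos0).
apply: cvg_EFin; first exact: nearW.
rewrite -[X in _ --> X](_ : (\int[mu]_x v x - \int[mu]_x v x + 2 * 0)%R = 0%R); last first.
  by rewrite subrr mulr0 addr0.
apply: cvgD; first by apply: cvgB => //; exact: cvg_cst.
by apply: cvgM => //; exact: cvg_cst.
Qed.

End L1_tools.

(** * Mollification in velocity *)

Section bump_kernel.
Local Open Scope ereal_scope.
Context {R : realType} (d : nat).
Local Notation lam := (@lebesgue_rV R d).

Lemma in_Cc_bumps (a b : 'I_d -> R) n : in_Cc (tensor (bumps a b n)).
Proof.
split.
  by apply: continuous_tensor => i; apply: smooth1_continuous;
    exact: smooth1_smooth_bump.
apply: (@compactly_supported_box _ _ _ a b) => v i vi.
apply: tensor_bumps_out => /(_ i) /andP[/ltW ai /ltW bi].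
by move: vi; rewrite ai bi.
Qed.

Lemma measurable_bumps (a b : 'I_d -> R) n :
  measurable_fun setT (tensor (bumps a b n)).
Proof. by apply: continuous_measurable_rV; case: (in_Cc_bumps a b n). Qed.

Lemma obox_cst_gt0 (e : R) : (0 < e)%R ->
  0 < lam (obox (fun=> - e) (fun=> e))%R.
Proof.
move=> e0; have mI : measurable (`](- e)%R, e[%classic : set R) by [].
rewrite (_ : obox _ _ = [set v | forall i, `](- e)%R, e[%classic (v ord0 i)]).
  rewrite lebesgue_rV_cube// lebesgue_measure_itv/= lte_fin gtrN// -EFinB.
  by rewrite -EFin_expe lte_fin exprn_gt0// subr_gt0 gtrN.
by apply/seteqP; split => v /= H i; have := H i; rewrite in_itv.
Qed.

Lemma cube_lty (r : R) : lam (cube r) < +oo.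
Proof.
have mI : measurable (`[(- r)%R, r]%classic : set R) by [].
rewrite (_ : cube _ = [set v | forall i, `[(- r)%R, r]%classic (v ord0 i)]).
  rewrite lebesgue_rV_cube// lebesgue_measure_itv/=.
  by case: ifP => _; rewrite -?EFinB -EFin_expe ltry.
by apply/seteqP; split => v /= H i; have := H i; rewrite in_itv.
Qed.

Variable eps : R.
Hypothesis eps0 : (0 < eps)%R.

(** The kernel is not normalised: being at most 1, it and its translates are directly admissible as
    bounded test functions. Its mass reappears as the factor in front of [f] in the estimates. *)
Definition bump_kernel : 'rV[R]_d -> R :=
  tensor (bumps (fun=> - eps)%R (fun=> eps) 0).

Lemma measurable_bump_kernel : measurable_fun setT bump_kernel.
Proof. exact: measurable_bumps. Qed.

Lemma bump_kernel_ge0 w : (0 <= bump_kernel w)%R.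
Proof. by have /andP[] := tensor_bumps_itv (fun=> - eps)%R (fun=> eps) 0 w. Qed.

Lemma bump_kernel_le1 w : (bump_kernel w <= 1)%R.
Proof. by have /andP[] := tensor_bumps_itv (fun=> - eps)%R (fun=> eps) 0 w. Qed.

Lemma bump_kernel_norm_le1 w : (`|bump_kernel w| <= 1)%R.
Proof. by rewrite ger0_norm ?bump_kernel_ge0 ?bump_kernel_le1. Qed.

Lemma bump_kernel_out w : ~ cube eps w -> bump_kernel w = 0%R.
Proof.
move=> we; apply: tensor_bumps_out; apply: contra_not we => H i.
by have /andP[/ltW -> /ltW ->] := H i.
Qed.

Lemma bump_kernel_shift v u : bump_kernel (u - v)%R =
  tensor (bumps (fun j => v ord0 j - eps)%R (fun j => v ord0 j + eps)%R 0) u.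
Proof.
rewrite /bump_kernel /tensor; apply: eq_bigr => j _; rewrite !mxE /bumps /smooth_bump.
congr (flat 1 (_ * _) * flat 1 (_ * _))%R; ring.
Qed.

Lemma integrable_bump_kernel : lam.-integrable setT (EFin \o bump_kernel).
Proof.
have lc : locint (fun _ : 'rV[R]_d => 1%R : R).
  move=> r; apply: measurable_bounded_integrable.
  - exact: measurable_cube.
  - exact: cube_lty.
  - exact: measurable_cst.
  - exists 1%R; split => // M M1 v _ /=; rewrite normr1; exact: ltW.
have mc : measurable_fun setT (fun _ : 'rV[R]_d => 1%R : R).
  exact: measurable_cst.
have := locint_mul_integrable mc lc measurable_bump_kernel bump_kernel_norm_le1 bump_kernel_out.
by apply: eq_integrable => // v _ /=; rewrite mul1r.
Qed.

Definition bump_kernel_mass : R := (\int[lam]_w bump_kernel w)%R.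

Lemma bump_kernel_massE : \int[lam]_w (bump_kernel w)%:E = bump_kernel_mass%:E.
Proof.
by rewrite /bump_kernel_mass /Rintegral fineK//; apply: integrable_fin_num => //;
  exact: integrable_bump_kernel.
Qed.

(** Zero mass would make the nonnegative kernel vanish almost everywhere, but it is positive on an
    open box, which has positive measure. *)
Lemma bump_kernel_mass_gt0 : (0 < bump_kernel_mass)%R.
Proof.
rewrite lt_neqAle Rintegral_ge0 ?andbT; last by move=> w _; exact: bump_kernel_ge0.
apply/eqP => m0.
have H0 : \int[lam]_w `|(EFin \o bump_kernel) w| = 0.
  rewrite -[RHS]/(0%R%:E) m0 -bump_kernel_massE; apply: eq_integral => w _.
  by rewrite gee0_abs// lee_fin bump_kernel_ge0.
have mk : measurable_fun setT (EFin \o bump_kernel).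
  by apply/measurable_EFinP; exact: measurable_bump_kernel.
have [N [mN N0 subN]] := (ae_eq_integral_abs lam measurableT mk).1 H0.
have := obox_cst_gt0 eps0; rewrite ltNge => /negP; apply.
rewrite -N0; apply: le_measure; rewrite ?inE//; first exact: measurable_obox.
move=> v vb; apply: subN => /= vk; have := EFin_inj (vk Logic.I).
apply/eqP; rewrite gt_eqF//; apply: prodr_gt0 => i _.
have /andP[v1 v2] := vb i.
by apply: mulr_gt0; apply: flat1_gt0; rewrite mul1r subr_gt0.
Qed.

(** Written with [f (v + w)] to match the increments of the translation estimate. For fixed [v] it
    is also an average of [f] against a translated bump, which is the form needed for (P2). *)
Definition mollify (f : 'rV[R]_d -> R) v : R :=
  (\int[lam]_w (f (v + w) * bump_kernel w))%R.

Variable f : 'rV[R]_d -> R.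
Hypothesis mf : measurable_fun setT f.
Hypothesis lf : locint f.

Let mfs v : measurable_fun setT (fun w : 'rV[R]_d => f (v + w)%R).
Proof.
under eq_fun do rewrite addrC.
by apply: (measurableT_comp mf); exact: measurable_rV_shift.
Qed.

Lemma mollify_integrable v :
  lam.-integrable setT (EFin \o (fun w => f (v + w) * bump_kernel w)%R).
Proof.
have lfs : locint (fun w : 'rV[R]_d => f (v + w)%R).
  by move=> r; under eq_fun do rewrite addrC; exact: locint_shift.
exact: (locint_mul_integrable (mfs v) lfs measurable_bump_kernel bump_kernel_norm_le1
  bump_kernel_out).
Qed.

Lemma mollifyE v : mollify f v = (\int[lam]_u (f u *
  tensor (bumps (fun j => v ord0 j - eps)%R (fun j => v ord0 j + eps)%R 0) u))%R.
Proof.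
rewrite /mollify /Rintegral; congr fine.
rewrite -[RHS](integral_rV_shift v).
  by apply: eq_integral => w _; rewrite -bump_kernel_shift addrK addrC.
apply/measurable_EFinP; apply: measurable_funM => //; exact: measurable_bumps.
Qed.

Let mjoint : measurable_fun setT
  (fun z : 'rV[R]_d * 'rV[R]_d => (`|f (z.1 + z.2) - f z.1| * bump_kernel z.2)%R).
Proof.
apply: measurable_funM; last exact: (measurableT_comp measurable_bump_kernel).
apply: measurableT_comp => //; apply: measurable_funB.
  apply: (measurableT_comp mf); apply: measurable_fun_rV => i.
  under eq_fun do rewrite mxE.
  by apply: measurable_funD; exact: (measurableT_comp (measurable_coord_rV i)).
exact: (measurableT_comp mf).
Qed.

(** The difference is the integral over [w] of [(f v - f (v + w)) * bump_kernel w]. After Tonelli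
    only the [w] in [cube eps] contribute, each at most [B * bump_kernel w]. *)
Lemma mollify_dist_bound (B : \bar R) : (forall w, cube eps w ->
    \int[lam]_v `|(f (v + w) - f v)%:E| <= B) ->
  \int[lam]_v `|(bump_kernel_mass * f v - mollify f v)%:E| <= bump_kernel_mass%:E * B.
Proof.
move=> fB.
have mj : measurable_fun setT (fun z : 'rV[R]_d * 'rV[R]_d =>
    (`|f (z.1 + z.2) - f z.1| * bump_kernel z.2)%:E) by exact/measurable_EFinP.
have j0 z : 0 <= (`|f (z.1 + z.2) - f z.1| * bump_kernel z.2)%:E.
  by rewrite lee_fin mulr_ge0// bump_kernel_ge0.
apply: (@le_trans _ _ (\int[lam]_v \int[lam]_w
    (`|f (v + w) - f v| * bump_kernel w)%:E)).
  apply: ae_ge0_le_integral_any => [v _|v _|]; first exact: abse_ge0.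
    by apply: integral_ge0 => w _; exact: (j0 (v, w)).
  apply: aeW => v _.
  have ik : lam.-integrable setT (EFin \o (fun w => f v * bump_kernel w)%R).
    exact: (integrableZl measurableT (f v) integrable_bump_kernel).
  have id : lam.-integrable setT
      (EFin \o (fun w => f v * bump_kernel w - f (v + w) * bump_kernel w)%R).
    exact: (integrableB measurableT ik (mollify_integrable v)).
  rewrite mulrC -RintegralZl//; last exact: integrable_bump_kernel.
  rewrite -RintegralB//; last exact: mollify_integrable.
  rewrite /Rintegral fineK; last exact: integrable_fin_num.
  apply: le_trans (le_abse_integral _ _ (measurable_int _ id)) _ => //.
  rewrite le_eqVlt; apply/orP; left; apply/eqP/eq_integral => w _ /=.
  by rewrite -mulrBl normrM distrC [`|bump_kernel w|%R]ger0_norm// bump_kernel_ge0.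
rewrite (fubini_tonelli (fun z : 'rV[R]_d * 'rV[R]_d =>
    (`|f (z.1 + z.2) - f z.1| * bump_kernel z.2)%:E))//=.
(* The hypothesis at [w = 0], which lies in the cube, gives the sign of [B]. *)
have B0 : 0 <= B.
  apply: le_trans (fB 0%R _); first by apply: integral_ge0.
  by move=> i; rewrite mxE oppr_le0 (ltW eps0).
rewrite -bump_kernel_massE -ge0_integralZr//; last 2 first.
  by apply/measurable_EFinP; exact: measurable_bump_kernel.
  by move=> w _; rewrite lee_fin bump_kernel_ge0.
apply: ge0_le_integral => //.
- move=> w _; apply: integral_ge0 => v _; exact: (j0 (v, w)).
- exact: (measurable_fun_fubini_tonelli_G (fun z : 'rV[R]_d * 'rV[R]_d =>
    (`|f (z.1 + z.2) - f z.1| * bump_kernel z.2)%:E)).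
- apply: emeasurable_funM; last exact: measurable_cst.
  by apply/measurable_EFinP; exact: measurable_bump_kernel.
move=> w _; have [we|/bump_kernel_out ->] := pselect (cube eps w); last first.
  by rewrite mul0e integral0_eq// => v _; rewrite mulr0.
under eq_integral do rewrite EFinM.
rewrite ge0_integralZr//; last 2 first.
  apply/measurable_EFinP; apply: measurableT_comp => //.
  apply: measurable_funB => //; apply: (measurableT_comp mf).
  exact: measurable_rV_shift.
  by rewrite lee_fin bump_kernel_ge0.
by rewrite muleC lee_wpmul2l ?lee_fin ?bump_kernel_ge0//; exact: fB.
Qed.

End bump_kernel.

(** * Slices, marginals and velocity averages *)

Section product_Fubini.
Local Open Scope ereal_scope.
Context d1 d2 (T1 : measurableType d1) (T2 : measurableType d2) (R : realType).
Variable m1 : {sigma_finite_measure set T1 -> \bar R}.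
Variable m2 : {sigma_finite_measure set T2 -> \bar R}.
Variable f : T1 * T2 -> R.
Hypothesis intf : (m1 \x m2).-integrable setT (EFin \o f).

Lemma integrable_slice : {ae m1, forall x,
  m2.-integrable setT (EFin \o (fun y => f (x, y)))}.
Proof. exact: ae_integrable1 intf. Qed.

Lemma integrable_marginal :
  m1.-integrable setT (EFin \o (fun x => \int[m2]_y f (x, y))%R).
Proof.
have := integrable_fubini_F intf; apply: le_integrable => //.
  apply/measurable_EFinP; apply: measurableT_comp => //.
  by apply: (@measurable_fun_marginal _ _ _ _ _ m2 (EFin \o f)); exact: (measurable_int _ intf).
move=> x _; rewrite /= /Rintegral /fubini_F.
by case: integral => [r| |]//=; rewrite leey.
Qed.

Lemma Rintegral_product :
  (\int[m1 \x m2]_z f z = \int[m1]_x \int[m2]_y f (x, y))%R.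
Proof.
rewrite /Rintegral -(integral12_prod_meas1 intf); congr fine.
apply: ae_eq_integral_any.
apply: filterS (integrable_ae measurableT (integrable_fubini_F intf)).
by move=> x /(_ Logic.I) fx _; rewrite /= fineK.
Qed.

Lemma L1_marginal_le (psi : T2 -> R) : measurable_fun setT psi ->
  (forall y, `|psi y| <= 1)%R ->
  \int[m1]_x `|(\int[m2]_y (f (x, y) * psi y))%R%:E| <=
  \int[m1 \x m2]_z `|(f z)%:E|.
Proof.
move=> mpsi psi1.
have mabs : measurable_fun setT (fun z => `|(f z)%:E|).
  by apply: measurableT_comp => //; exact: (measurable_int _ intf).
rewrite (fubini_tonelli1 (fun z => `|(f z)%:E|))//.
apply: ae_ge0_le_integral_any => [x _|x _|]; first exact: abse_ge0.
  by apply: integral_ge0.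
apply: filterS integrable_slice => x ifx _.
exact: le_normr_Rintegral_bounded ifx mpsi psi1.
Qed.

End product_Fubini.

Section averages.
Local Open Scope ereal_scope.
Context d1 d2 (T1 : measurableType d1) (T2 : measurableType d2) (R : realType).
Variable m1 : {sigma_finite_measure set T1 -> \bar R}.
Variable m2 : {sigma_finite_measure set T2 -> \bar R}.
Variables (F_ : nat -> T1 * T2 -> R) (F : T1 * T2 -> R).
Hypothesis iF_ : forall n, (m1 \x m2).-integrable setT (EFin \o F_ n).
Hypothesis iF : (m1 \x m2).-integrable setT (EFin \o F).
Hypothesis weakF : forall s : T1 * T2 -> R, measurable_fun setT s ->
  (forall z, `|s z| <= 1)%R ->
  (fun n => \int[m1 \x m2]_z (F_ n z * s z))%R @ \oo -->
  (\int[m1 \x m2]_z (F z * s z))%R.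

Let avg (G : T1 * T2 -> R) (psi : T2 -> R) x : R :=
  (\int[m2]_y (G (x, y) * psi y))%R.

Let iM (G : T1 * T2 -> R) (psi : T2 -> R) :
  (m1 \x m2).-integrable setT (EFin \o G) ->
  measurable_fun setT psi -> (forall y, `|psi y| <= 1)%R ->
  (m1 \x m2).-integrable setT (EFin \o (fun z => G z * psi z.2)%R).
Proof.
move=> iG mpsi psi1; apply: integrableM_bounded => //.
exact: (measurableT_comp mpsi).
Qed.

Let avgM (G : T1 * T2 -> R) (psi : T2 -> R) (s : T1 -> R) :
  (m1 \x m2).-integrable setT (EFin \o G) ->
  measurable_fun setT psi -> (forall y, `|psi y| <= 1)%R ->
  measurable_fun setT s -> (forall x, `|s x| <= 1)%R ->
  (\int[m1]_x (avg G psi x * s x) =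
   \int[m1 \x m2]_z (G z * (psi z.2 * s z.1)))%R.
Proof.
move=> iG mpsi psi1 ms s1.
have iGp := iM iG mpsi psi1.
have iGps : (m1 \x m2).-integrable setT
    (EFin \o (fun z => G z * (psi z.2 * s z.1))%R).
  apply: integrableM_bounded => //.
    by apply: measurable_funM; [exact: (measurableT_comp mpsi)|
                                exact: (measurableT_comp ms)].
  by move=> z; rewrite normrM mulr_ile1.
rewrite (Rintegral_product iGps); apply: ae_eq_Rintegral_any.
apply: filterS (integrable_slice iGp) => x ix _.
rewrite /avg -RintegralZr//; apply: eq_Rintegral => y _ /=.
by rewrite mulrA.
Qed.

(** The strong limit of the averages is identified through the weak limit. *)
Lemma averages_cvg (psi : T2 -> R) (rho : T1 -> R) :
  measurable_fun setT psi -> (forall y, `|psi y| <= 1)%R ->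
  m1.-integrable setT (EFin \o rho) ->
  (fun n => \int[m1]_x `|(avg (F_ n) psi x - rho x)%:E|) @ \oo --> 0 ->
  (fun n => \int[m1]_x `|(avg (F_ n) psi x - avg F psi x)%:E|) @ \oo --> 0.
Proof.
move=> mpsi psi1 irho avg_rho.
have iavg (G : T1 * T2 -> R) : (m1 \x m2).-integrable setT (EFin \o G) ->
    m1.-integrable setT (EFin \o avg G psi).
  by move=> iG; exact: (integrable_marginal (iM iG mpsi psi1)).
have mavg (G : T1 * T2 -> R) : (m1 \x m2).-integrable setT (EFin \o G) ->
    measurable_fun setT (avg G psi).
  by move=> /iavg iG; apply/measurable_EFinP; exact: (measurable_int _ iG).
have mrho : measurable_fun setT rho.
  by apply/measurable_EFinP; exact: (measurable_int _ irho).
have idist (G : T1 * T2 -> R) : (m1 \x m2).-integrable setT (EFin \o G) ->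
    m1.-integrable setT (EFin \o (fun x => avg G psi x - rho x)%R).
  by move=> /iavg iG; exact: (integrableB measurableT iG irho).
have dist0 n : 0 <= \int[m1]_x `|(avg (F_ n) psi x - rho x)%:E|.
  by apply: integral_ge0.
(* The differences [avg (F_ n) psi - rho] converge weakly to [avg F psi - rho] and are eventually of
   norm at most [eta]; lower semicontinuity passes the bound to the limit for every [eta], so [rho]
   is the average of [F]. *)
have rhoE (eta : R) : (0 < eta)%R ->
    \int[m1]_x `|(avg F psi x - rho x)%:E| <= eta%:E.
  move=> eta0; apply: (L1_norm_lsc (fun n => idist _ (iF_ n)) (idist _ iF)).
    move=> s ms s1.
    have split G : (m1 \x m2).-integrable setT (EFin \o G) ->
        (\int[m1]_x ((avg G psi x - rho x) * s x) =
         \int[m1 \x m2]_z (G z * (psi z.2 * s z.1)) -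
         \int[m1]_x (rho x * s x))%R.
      move=> iG; rewrite -avgM//.
      under eq_Rintegral do rewrite mulrBl.
      rewrite RintegralB//.
        exact: (integrableM_bounded (iavg _ iG) ms s1).
      exact: (integrableM_bounded irho ms s1).
    under eq_fun do rewrite split//.
    rewrite split//; apply: cvgB; last exact: cvg_cst.
    apply: weakF.
      by apply: measurable_funM; [exact: (measurableT_comp mpsi)|
                                  exact: (measurableT_comp ms)].
    by move=> z; rewrite normrM mulr_ile1.
  exact: ((cvge0P dist0).1 avg_rho _ eta0).
apply/cvge0P => [n|eta eta0]; first exact: integral_ge0.
have eta20 : (0 < eta / 2)%R by rewrite divr_gt0.
apply: filterS ((cvge0P dist0).1 avg_rho _ eta20) => n rhon.
apply: le_trans (L1_dist_triangle m1 _ mrho _) _; [exact: mavg|exact: mavg|].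
rewrite [eta]splitr EFinD leeD//.
rewrite (_ : \int[m1]_x _ = \int[m1]_x `|(avg F psi x - rho x)%:E|); last first.
  by apply: eq_integral => x _; rewrite !abse_EFin distrC.
exact: rhoE.
Qed.

End averages.

Lemma integrable_locint {R : realType} d (f : 'rV[R]_d -> R) :
  (lebesgue_rV d).-integrable setT (EFin \o f) -> locint f.
Proof.
by move=> iff r; apply: integrableS iff => //; exact: measurable_cube.
Qed.

Section product_mollification.
Local Open Scope ereal_scope.
Context {R : realType} (d : nat) dX (X : measurableType dX).
Variable m : {sigma_finite_measure set X -> \bar R}.
Local Notation lam := (@lebesgue_rV R d).
Local Notation P := (m \x lam).

Definition mollP (eps : R) (F : X * 'rV[R]_d -> R) (z : X * 'rV[R]_d) : R :=
  mollify eps (fun v => F (z.1, v)) z.2.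

Lemma measurable_slice (F : X * 'rV[R]_d -> R) x : measurable_fun setT F ->
  measurable_fun setT (fun v => F (x, v)).
Proof. by move=> mF; exact: (measurableT_comp mF (measurable_pair1 x)). Qed.

Lemma measurable_mollP eps F : measurable_fun setT F ->
  measurable_fun setT (mollP eps F).
Proof.
move=> mF; rewrite (_ : mollP eps F = fine \o (fun z => \int[lam]_w
    (F (z.1, z.2 + w)%R * bump_kernel eps w)%:E))//.
apply: measurableT_comp => //.
apply: (@measurable_fun_marginal _ _ (X * 'rV[R]_d)%type _ _ lam
  (fun y => (F (y.1.1, y.1.2 + y.2) * bump_kernel eps y.2)%:E)%R).
apply/measurable_EFinP; apply: measurable_funM; last first.
  exact: (measurableT_comp (@measurable_bump_kernel R d eps) measurable_snd).
apply: (measurableT_comp mF); apply: measurable_fun_pair.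
  exact: (measurableT_comp measurable_fst measurable_fst).
apply: measurable_fun_rV => i; under eq_fun do rewrite mxE.
apply: measurable_funD.
  apply: (measurableT_comp (measurable_coord_rV i)).
  exact: (measurableT_comp measurable_snd measurable_fst).
exact: (measurableT_comp (measurable_coord_rV i)).
Qed.

Variable eps : R.
Hypothesis eps0 : (0 < eps)%R.
Local Notation kappa := (@bump_kernel_mass R d eps).

Lemma mollP_dist_bound (F : X * 'rV[R]_d -> R) (A : set X) (B : X -> \bar R) :
  P.-integrable setT (EFin \o F) -> measurable A -> measurable_fun setT B ->
  (forall x, 0 <= B x) ->
  {ae m, forall x, A x -> forall w, cube eps w ->
    \int[lam]_v `|(F (x, v + w) - F (x, v))%:E| <= B x} ->
  \int[P]_z `|((kappa * F z - mollP eps F z) * \1_A z.1)%:E| <=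
  kappa%:E * \int[m]_(x in A) B x.
Proof.
move=> iF mA mB B0 FB.
have mF : measurable_fun setT F by apply/measurable_EFinP; exact: (measurable_int _ iF).
have k0 : (0 <= kappa)%R by apply: ltW; exact: bump_kernel_mass_gt0.
have mI : measurable_fun setT (fun z : X * 'rV[R]_d =>
    `|((kappa * F z - mollP eps F z) * \1_A z.1)%:E|).
  apply: measurableT_comp => //; apply/measurable_EFinP; apply: measurable_funM.
    apply: measurable_funB; first exact: measurable_funM.
    exact: measurable_mollP.
  exact: (measurableT_comp (measurable_indic mA) measurable_fst).
rewrite (fubini_tonelli1 (fun z => `|((kappa * F z - mollP eps F z) * \1_A z.1)%:E|))//.
rewrite -ge0_integralZl_EFin//; last exact: measurable_funTS.
rewrite [leRHS]integral_mkcond.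
apply: ae_ge0_le_integral_any => [x _|x _|].
- by apply: integral_ge0.
- by apply: erestrict_ge0 => y _; rewrite mule_ge0.
apply: filterS2 FB (integrable_slice iF) => x FB ix _.
rewrite patchE /fubini_F/=; case: ifPn => xA; last first.
  by rewrite integral0_eq// => v _; rewrite indicE (negbTE xA) mulr0 normr0.
rewrite (_ : \int[lam]_v _ = \int[lam]_v
    `|(kappa * F (x, v) - mollify eps (fun v => F (x, v)) v)%:E|); last first.
  by apply: eq_integral => v _; rewrite indicE xA mulr1.
apply: mollify_dist_bound => //.
- exact: measurable_slice.
- exact: integrable_locint.
- by move=> w; apply: FB; rewrite inE in xA.
Qed.

(** [mollP] is [kappa * F] minus the mollification error, and the error is integrable since any
    translate satisfies the crude bound [B], twice the L^1 norm of the slice. *)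
Lemma mollP_integrable (F : X * 'rV[R]_d -> R) :
  P.-integrable setT (EFin \o F) -> P.-integrable setT (EFin \o mollP eps F).
Proof.
move=> iF.
have mF : measurable_fun setT F by apply/measurable_EFinP; exact: (measurable_int _ iF).
have mM := measurable_mollP eps mF.
pose B x := 2%:E * \int[lam]_v `|(F (x, v))%:E|.
have mabs : measurable_fun setT (fun z => `|(F z)%:E|).
  by apply: measurableT_comp => //; exact/measurable_EFinP.
have mB0 : measurable_fun setT (fun x => \int[lam]_v `|(F (x, v))%:E|).
  exact: (measurable_fun_fubini_tonelli_F (fun z => `|(F z)%:E|)).
have mB : measurable_fun setT B.
  by apply: emeasurable_funM => //; exact: measurable_cst.
have B0 x : 0 <= B x by rewrite mule_ge0// integral_ge0.
have H := @mollP_dist_bound F setT B iF measurableT mB B0.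
have iD : P.-integrable setT (EFin \o (fun z => kappa * F z - mollP eps F z)%R).
  apply/integrableP; split.
    apply/measurable_EFinP; apply: measurable_funB => //; exact: measurable_funM.
  rewrite (_ : \int[P]_z _ = \int[P]_z
      `|((kappa * F z - mollP eps F z) * \1_setT z.1)%:E|); last first.
    by apply: eq_integral => z _; rewrite indicE in_setT mulr1.
  apply: le_lt_trans (H _) _.
    apply: aeW => x _ w _.
    have mFx := measurable_slice x mF.
    have mFxw : measurable_fun setT (fun v : 'rV[R]_d => F (x, v + w)%R).
      by apply: (measurableT_comp mFx); exact: measurable_rV_shift.
    apply: le_trans (L1_normD _ mFxw (measurable_funN _ )) _ => //.
    rewrite (ge0_integral_rV_shift w (f := fun v => `|(F (x, v))%:E|))//; last first.
      by apply: measurableT_comp => //; exact/measurable_EFinP.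
    rewrite [X in _ + X](_ : _ = \int[lam]_v `|(F (x, v))%:E|); last first.
      by apply: eq_integral => v _; rewrite !abse_EFin normrN.
    by rewrite /B -[2%:E]/((1 + 1)%:E) EFinD ge0_muleDl// mul1e.
  rewrite /B ge0_integralZl//; last by move=> x _; apply: integral_ge0.
  have /integrableP[_] := iF.
  rewrite (fubini_tonelli1 (fun z => `|(F z)%:E|))// => Foo.
  rewrite muleA lte_mul_pinfty//.
  by rewrite lee_fin mulr_ge0// ltW//; exact: bump_kernel_mass_gt0.
have := integrableB measurableT (integrableZl measurableT kappa iF) iD.
by apply: eq_integrable => // z _ /=; rewrite -!EFinM -EFinB; congr EFin; ring.
Qed.

End product_mollification.

(** * Strong convergence *)

Section local_convergence.
Local Open Scope ereal_scope.
Context {R : realType} (d : nat) dX (X : measurableType dX).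
Variable m : {sigma_finite_measure set X -> \bar R}.
Local Notation lam := (@lebesgue_rV R d).
Local Notation P := (m \x lam).
Variables (F_ : nat -> X * 'rV[R]_d -> R) (F : X * 'rV[R]_d -> R).
Hypothesis iF_ : forall n, P.-integrable setT (EFin \o F_ n).
Hypothesis iF : P.-integrable setT (EFin \o F).
Hypothesis weakF : forall s : X * 'rV[R]_d -> R, measurable_fun setT s ->
  (forall z, `|s z| <= 1)%R ->
  (fun n => \int[P]_z (F_ n z * s z))%R @ \oo --> (\int[P]_z (F z * s z))%R.
Hypothesis avgF : forall psi, in_Cc psi -> exists2 rho,
  m.-integrable setT (EFin \o rho) &
  (fun n => \int[m]_x `|((\int[lam]_v (F_ n (x, v) * psi v))%R - rho x)%:E|)
    @ \oo --> 0.
Variable K0 : R.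
Hypothesis massF : forall n, \int[P]_z `|(F_ n z)%:E| <= K0%:E.

Let mF_ n : measurable_fun setT (F_ n).
Proof. by apply/measurable_EFinP; exact: (measurable_int _ (iF_ n)). Qed.

Let mF : measurable_fun setT F.
Proof. by apply/measurable_EFinP; exact: (measurable_int _ iF). Qed.

Let mollPE eps (G : X * 'rV[R]_d -> R) x v : measurable_fun setT G ->
  mollP eps G (x, v) = (\int[lam]_u (G (x, u) *
    tensor (bumps (fun j => v ord0 j - eps)%R (fun j => v ord0 j + eps)%R 0) u))%R.
Proof. by move=> mG; rewrite /mollP mollifyE//; exact: measurable_slice. Qed.

Let bumps_norm_le1 (a b : 'I_d -> R) v : (`|tensor (bumps a b 0) v| <= 1)%R.
Proof. by have /andP[? ?] := tensor_bumps_itv a b 0 v; rewrite ger0_norm. Qed.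

(** For each fixed [v] the mollification is an average against one bump, so its convergence in L^1
    of [X] follows from [averages_cvg]. Dominated convergence then integrates over [v]; the cube has
    finite measure, so a constant dominates. *)
Lemma mollP_cvg eps r :
  (fun n => \int[P]_z
     `|((mollP eps (F_ n) z - mollP eps F z) * \1_(cube r) z.2)%:E|) @ \oo --> 0.
Proof.
pose D n (z : X * 'rV[R]_d) := `|(mollP eps (F_ n) z - mollP eps F z)%:E|.
pose J n v := \int[m]_x D n (x, v).
have mD n : measurable_fun setT (D n).
  apply: measurableT_comp => //; apply/measurable_EFinP.
  by apply: measurable_funB; exact: measurable_mollP.
have D0 n z : 0 <= D n z by exact: abse_ge0.
have J0 n v : 0 <= J n v by apply: integral_ge0.
have mJ n : measurable_fun setT (J n).
  exact: (measurable_fun_fubini_tonelli_G (D n)).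
have -> : (fun n => \int[P]_z
     `|((mollP eps (F_ n) z - mollP eps F z) * \1_(cube r) z.2)%:E|) =
    (fun n => \int[lam]_(v in cube r) J n v).
  apply/funext => n.
  pose E (z : X * 'rV[R]_d) :=
    `|((mollP eps (F_ n) z - mollP eps F z) * \1_(cube r) z.2)%:E|.
  have mE : measurable_fun setT E.
    apply: measurableT_comp => //; apply/measurable_EFinP.
    apply: measurable_funM.
      by apply: measurable_funB; exact: measurable_mollP.
    have mc := @measurable_cube R d r.
    exact: (measurableT_comp (measurable_indic mc) measurable_snd).
  have E0 z : 0 <= E z by exact: abse_ge0.
  transitivity (\int[lam]_v \int[m]_x E (x, v)); first exact: (fubini_tonelli2 E mE E0).
  rewrite [RHS]integral_mkcond; apply: eq_integral => v _.
  rewrite patchE; case: ifPn => vr.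
    by apply: eq_integral => x _; rewrite /E/= indicE vr mulr1.
  by rewrite integral0_eq// => x _; rewrite /E/= indicE (negbTE vr) mulr0 normr0.
have [_ Foo] := integrableP _ _ _ iF.
pose K1 := fine (\int[P]_z `|(F z)%:E|).
have K1E : \int[P]_z `|(F z)%:E| = K1%:E.
  by rewrite /K1 fineK// ge0_fin_numE// integral_ge0.
have Jle n v : J n v <= (K0 + K1)%:E.
  pose I (G : X * 'rV[R]_d -> R) x := mollP eps G (x, v).
  have mI G : measurable_fun setT G -> measurable_fun setT (I G).
    move=> mG; exact: (measurableT_comp (measurable_mollP eps mG)
      (measurable_pair2 v)).
  (* Since the kernel is at most 1, each slice of the mollification is bounded by the full L^1 norm,
     uniformly in [v]. *)
  have Ile (G : X * 'rV[R]_d -> R) : P.-integrable setT (EFin \o G) ->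
      \int[m]_x `|(I G x)%:E| <= \int[P]_z `|(G z)%:E|.
    move=> iG; apply: le_trans (L1_marginal_le iG _ _); last 2 first.
    - exact: (measurable_bumps (fun j => v ord0 j - eps)%R
        (fun j => v ord0 j + eps)%R 0).
    - exact: bumps_norm_le1.
    rewrite le_eqVlt; apply/orP; left; apply/eqP/eq_integral => x _.
    rewrite /I mollPE//.
    by apply/measurable_EFinP; exact: (measurable_int _ iG).
  apply: (@le_trans _ _ (\int[m]_x `|(I (F_ n) x)%:E| + \int[m]_x `|(I F x)%:E|)).
    have := L1_normD m (mI _ (mF_ n)) (measurable_funN (mI _ mF)).
    rewrite [X in _ <= _ + X -> _](_ : _ = \int[m]_x `|(I F x)%:E|)//.
    by apply: eq_integral => x _; rewrite !abse_EFin normrN.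
  rewrite EFinD leeD//; first exact: le_trans (Ile _ (iF_ n)) (massF n).
  by rewrite -K1E; exact: Ile.
have Jcvg v : J ^~ v @ \oo --> 0.
  have [rho irho rhocvg] := avgF (in_Cc_bumps (fun j => v ord0 j - eps)%R
        (fun j => v ord0 j + eps)%R 0).
  have := averages_cvg iF_ iF weakF (measurable_bumps _ _ _)
    (bumps_norm_le1 _ _) irho rhocvg.
  apply: cvg_trans; apply: near_eq_cvg; apply: nearW => n.
  by apply: eq_integral => x _; rewrite /D !mollPE.
have mcube := @measurable_cube R d r.
have icst : lam.-integrable (cube r) (cst (K0 + K1)%:E).
  apply/integrableP; split; first exact: measurable_cst.
  rewrite integral_cst//= lte_mul_pinfty//; exact: cube_lty.
have Jabs v n : cube r v -> `|J n v| <= cst (K0 + K1)%:E v.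
  by move=> _; rewrite gee0_abs//; exact: Jle.
have [_ _] := @dominated_convergence _ _ _ lam (cube r) mcube J (cst 0)
  (cst (K0 + K1)%:E) (fun n => measurable_funTS (mJ n))
  (measurable_cst _) (aeW _ (fun v _ => Jcvg v)) icst
  (aeW _ Jabs).
by rewrite integral0.
Qed.

Local Notation kappa := (@bump_kernel_mass R d).

(** [kappa F_ n - mollP (F_ n)] is small uniformly in [n] and converges weakly
    to [kappa F - mollP F], which is hence small too, while the mollifications
    converge strongly. *)
Lemma local_L1_cvg (A : set X) (K : R) : measurable A -> (0 <= K)%R ->
  (\forall n \near \oo, forall eps, (0 < eps)%R ->
    \int[P]_z `|((kappa eps * F_ n z - mollP eps (F_ n) z) * \1_A z.1)%:E| <=
    (kappa eps * (eps * K))%:E) ->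
  forall r, (fun n => \int[P]_z
    `|((F_ n z - F z) * (\1_A z.1 * \1_(cube r) z.2))%:E|) @ \oo --> 0.
Proof.
move=> mA K_ge0 small r; apply/cvge0P => [n|eta eta0]; first exact: integral_ge0.
(* This makes [eps * K <= eta / 4]; [K + 1] guards against [K = 0]. The two mollification errors
   then take a quarter of [eta] each, leaving half for the difference of the mollifications. *)
pose eps := (eta / (4 * (K + 1)))%R.
have eps0 : (0 < eps)%R by rewrite divr_gt0// mulr_gt0// ltr_wpDl.
have epsK : (eps * K <= eta / 4)%R.
  rewrite /eps invfM mulrA -mulrA ler_piMr//; first by rewrite divr_ge0// ltW.
  by rewrite mulrC ler_pdivrMr ?ltr_wpDl// mul1r lerDl.
set k := kappa eps; have k0 : (0 < k)%R by exact: bump_kernel_mass_gt0.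
pose I (z : X * 'rV[R]_d) : R := (\1_A z.1 * \1_(cube r) z.2)%R.
have mcube := @measurable_cube R d r.
have m1 : measurable_fun setT (fun z : X * 'rV[R]_d => \1_A z.1 : R).
  exact: (measurableT_comp (measurable_indic mA) measurable_fst).
have m2 : measurable_fun setT (fun z : X * 'rV[R]_d => \1_(cube r) z.2 : R).
  exact: (measurableT_comp (measurable_indic mcube) measurable_snd).
have mI : measurable_fun setT I by exact: measurable_funM.
have I01 z : (0 <= I z <= 1)%R.
  by rewrite /I !indicE; case: (_ \in _); case: (_ \in _);
    rewrite ?mulr1 ?mulr0 ?lexx ?ler01.
have I1 z : (`|I z| <= 1)%R.
  by have /andP[? ?] := I01 z; rewrite ger0_norm.
pose U n z := (k * F_ n z - mollP eps (F_ n) z)%R.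
pose V z := (k * F z - mollP eps F z)%R.
have imoll G : P.-integrable setT (EFin \o G) ->
    P.-integrable setT (EFin \o (fun z => k * G z - mollP eps G z)%R).
  move=> iG.
  exact: (integrableB measurableT (integrableZl measurableT k iG)
    (mollP_integrable eps0 iG)).
have iUI n : P.-integrable setT (EFin \o (fun z => U n z * I z)%R).
  by apply: integrableM_bounded => //; exact: imoll.
have iVI : P.-integrable setT (EFin \o (fun z => V z * I z)%R).
  by apply: integrableM_bounded => //; exact: imoll.
have mR G : P.-integrable setT (EFin \o G) -> measurable_fun setT G.
  by move=> iG; apply/measurable_EFinP; exact: (measurable_int _ iG).
have mabs (u : X * 'rV[R]_d -> R) : measurable_fun setT u ->
    measurable_fun setT (fun z => `|(u z)%:E|).
  by move=> mu_; apply: measurableT_comp => //; exact/measurable_EFinP.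
have UI_le : \forall n \near \oo, \int[P]_z `|(U n z * I z)%:E| <=
    (k * (eta / 4))%:E.
  apply: filterS small => n /(_ _ eps0) H.
  apply: (@le_trans _ _ (k * (eps * K))%:E); last first.
    by rewrite lee_fin ler_pM2l.
  apply: le_trans H; apply: ge0_le_integral => //.
  - exact: (mabs _ (mR _ (iUI n))).
  - by apply: mabs; apply: measurable_funM => //; exact: (mR _ (imoll _ (iF_ n))).
  move=> z _; rewrite lee_fin !normrM ler_wpM2l// [`|\1_(cube r) _|%R]ger0_norm//.
  by rewrite ler_piMr// indicE; case: (_ \in _).
pose W n z := ((mollP eps (F_ n) z - mollP eps F z) * \1_(cube r) z.2)%R.
have W_cvg : (fun n => \int[P]_z `|(W n z)%:E|) @ \oo --> 0 by exact: mollP_cvg.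
have W0 n : 0 <= \int[P]_z `|(W n z)%:E| by exact: integral_ge0.
have iW n : P.-integrable setT (EFin \o W n).
  apply: integrableM_bounded => //.
    exact: (integrableB measurableT (mollP_integrable eps0 (iF_ n))
      (mollP_integrable eps0 iF)).
  by move=> z; rewrite indicE; case: (_ \in _); rewrite ?normr1 ?normr0.
have VI_le : \int[P]_z `|(V z * I z)%:E| <= (k * (eta / 4))%:E.
  (* Weak convergence of [U n * I] to [V * I]: the part [k * F_ n] converges weakly by hypothesis,
     and its mollification differs from that of [F] by [W n], which tends to 0 strongly. *)
  apply: (L1_norm_lsc iUI iVI _ UI_le) => s ms s1.
  have ms1 : measurable_fun setT (fun z => I z * s z)%R by exact: measurable_funM.
  have ms2 : measurable_fun setT (fun z => \1_A z.1 * s z)%R by exact: measurable_funM.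
  have s11 z : (`|I z * s z| <= 1)%R by rewrite normrM mulr_ile1.
  have s12 z : (`|\1_A z.1 * s z| <= 1)%R.
    rewrite normrM mulr_ile1//.
    by rewrite indicE; case: (_ \in _); rewrite ?normr1 ?normr0.
  have E n : (\int[P]_z (U n z * I z * s z) =
      k * \int[P]_z (F_ n z * (I z * s z)) -
      (\int[P]_z (W n z * (\1_A z.1 * s z)) +
       \int[P]_z (mollP eps F z * (I z * s z))))%R.
    have i1 := integrableM_bounded (iF_ n) ms1 s11.
    have i2 := integrableM_bounded (iW n) ms2 s12.
    have i3 := integrableM_bounded (mollP_integrable eps0 iF) ms1 s11.
    rewrite -RintegralZl// -RintegralD// -RintegralB//; last 2 first.
    - exact: (integrableZl measurableT k i1).
    - exact: (integrableD measurableT i2 i3).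
    by apply: eq_Rintegral => z _; rewrite /U /W /I; ring.
  have E' : (\int[P]_z (V z * I z * s z) =
      k * \int[P]_z (F z * (I z * s z)) -
      (0 + \int[P]_z (mollP eps F z * (I z * s z))))%R.
    have i1 := integrableM_bounded iF ms1 s11.
    have i3 := integrableM_bounded (mollP_integrable eps0 iF) ms1 s11.
    rewrite add0r -RintegralZl// -RintegralB//; last first.
    - exact: (integrableZl measurableT k i1).
    by apply: eq_Rintegral => z _; rewrite /V /I; ring.
  rewrite E'; under eq_fun do rewrite E.
  apply: cvgB.
    by apply: cvgM; [exact: cvg_cst|exact: weakF].
  apply: cvgD; last exact: cvg_cst.
  apply/cvgr0Pnorm_le => e e0.
  apply: filterS ((cvge0P W0).1 W_cvg e e0) => n Wn.
  by rewrite -lee_fin; apply: le_trans Wn; exact: le_normr_Rintegral_bounded.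
have keta : (0 < k * (eta / 2))%R by rewrite mulr_gt0// divr_gt0.
apply: filterS2 UI_le ((cvge0P W0).1 W_cvg _ keta) => n Un Wn.
(* After multiplication by [k], the integrand is [U n * I + W n * 1_A - V * I]. *)
rewrite -(@lee_pmul2l _ k%:E)// ?lte_fin// -ge0_integralZl//; last 2 first.
- by apply: mabs; apply: measurable_funM => //; exact: measurable_funB.
- by rewrite lee_fin ltW.
have mUI := mR _ (iUI n); have mVI := mR _ iVI.
have mWA : measurable_fun setT (fun z => W n z * \1_A z.1)%R.
  by apply: measurable_funM => //; exact: (mR _ (iW n)).
apply: (@le_trans _ _ (\int[P]_z `|(U n z * I z)%:E| +
   (\int[P]_z `|(W n z * \1_A z.1)%:E| + \int[P]_z `|(V z * I z)%:E|))).
  apply: (@le_trans _ _ (\int[P]_z `|(U n z * I z + (W n z * \1_A z.1 -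
      V z * I z))%:E|)).
    rewrite le_eqVlt; apply/orP; left; apply/eqP/eq_integral => z _.
    rewrite -[k%:E]gee0_abs ?lee_fin ?ltW// -abseM -EFinM.
    by congr (`|_%:E|); rewrite /U /W /V /I; ring.
  apply: le_trans (L1_normD _ mUI (measurable_funB mWA mVI)) _.
  rewrite leeD2l//; apply: le_trans (L1_normD _ mWA (measurable_funN mVI)) _.
  rewrite leeD2l// le_eqVlt; apply/orP; left; apply/eqP/eq_integral => z _.
  by rewrite !abse_EFin normrN.
have -> : (k%:E * eta%:E = (k * (eta / 4))%:E + ((k * (eta / 2))%:E +
    (k * (eta / 4))%:E))%E.
  by rewrite -EFinM -!EFinD; congr EFin; field.
apply: (leeD Un (leeD _ VI_le)); apply: le_trans Wn.
apply: ge0_le_integral => //.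
- exact: mabs.
- exact: (mabs _ (mR _ (iW n))).
move=> z _; rewrite lee_fin normrM ler_piMr//.
by rewrite indicE; case: (_ \in _); rewrite ?normr1 ?normr0.
Qed.

End local_convergence.

Section strong_convergence.
Local Open Scope ereal_scope.
Context {R : realType} (d : nat) dX (X : measurableType dX).
Variable m : {sigma_finite_measure set X -> \bar R}.
Local Notation lam := (@lebesgue_rV R d).
Local Notation P := (m \x lam).
Variables (F_ : nat -> X * 'rV[R]_d -> R) (F : X * 'rV[R]_d -> R).
Variables (a_ N_ : nat -> X -> \bar R) (a : X -> \bar R) (C : R).
Hypothesis F_0 : forall n z, (0 <= F_ n z)%R.
Hypothesis F0 : forall z, (0 <= F z)%R.
Hypothesis iF_ : forall n, P.-integrable setT (EFin \o F_ n).
Hypothesis iF : P.-integrable setT (EFin \o F).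
Hypothesis weakF : forall s : X * 'rV[R]_d -> R, measurable_fun setT s ->
  (forall z, `|s z| <= 1)%R ->
  (fun n => \int[P]_z (F_ n z * s z))%R @ \oo --> (\int[P]_z (F z * s z))%R.
Hypothesis avgF : forall psi, in_Cc psi -> exists2 rho,
  m.-integrable setT (EFin \o rho) &
  (fun n => \int[m]_x `|((\int[lam]_v (F_ n (x, v) * psi v))%R - rho x)%:E|)
    @ \oo --> 0.
Hypothesis ma_ : forall n, measurable_fun setT (a_ n).
Hypothesis a0 : forall x, 0 <= a x.
Hypothesis a_0 : forall n x, 0 <= a_ n x.
Hypothesis mN_ : forall n, measurable_fun setT (N_ n).
Hypothesis N_0 : forall n x, 0 <= N_ n x.
Hypothesis aN_ : forall n, \int[m]_x (a_ n x * N_ n x) <= C%:E.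
Hypothesis translF : forall n, {ae m, forall x, 0 < a_ n x -> forall w,
  \int[lam]_v `|(F_ n (x, v + w) - F_ n (x, v))%:E| <=
  (\sum_i `|w ord0 i|)%:E * (N_ n x + 2%:E * \int[lam]_v (F_ n (x, v))%:E)}.
Hypothesis a_cvg : {ae m, forall x, 0 < a x -> a_ ^~ x @ \oo --> a x}.
Hypothesis suppF : {ae P, forall z, a z.1 = 0 -> F z = 0%R}.

Let mF_ n : measurable_fun setT (F_ n).
Proof. by apply/measurable_EFinP; exact: (measurable_int _ (iF_ n)). Qed.

Let mF : measurable_fun setT F.
Proof. by apply/measurable_EFinP; exact: (measurable_int _ iF). Qed.

(** The constant 1 is an admissible test function on the whole, possibly infinite, measure space: no
    mass escapes. *)
Let mass_cvg : (fun n => \int[P]_z F_ n z)%R @ \oo --> (\int[P]_z F z)%R.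
Proof.
have := @weakF (cst 1%R) (measurable_cst _)
  (fun=> ltac:(by rewrite /= normr1)).
rewrite (_ : (\int[P]_z (F z * _))%R = (\int[P]_z F z)%R); last first.
  by apply: eq_Rintegral => z _; rewrite mulr1.
apply: cvg_trans; apply: near_eq_cvg; apply: nearW => n.
by apply: eq_Rintegral => z _; rewrite mulr1.
Qed.

Let mass_bound : exists2 K0 : R, (0 <= K0)%R &
  forall n, \int[P]_z `|(F_ n z)%:E| <= K0%:E.
Proof.
have [M [Mreal HM]] := cvg_seq_bounded (cvgP _ mass_cvg).
exists (`|M| + 1)%R => [|n]; first by rewrite addr_ge0.
rewrite (_ : \int[P]_z _ = (\int[P]_z F_ n z)%R%:E); last first.
  rewrite /Rintegral fineK; last exact: (integrable_fin_num measurableT (iF_ n)).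
  by apply: eq_integral => z _; rewrite gee0_abs// lee_fin.
rewrite lee_fin; apply: (le_trans (ler_norm _)).
by apply: HM => //; rewrite (le_lt_trans (ler_norm M))// ltrDl.
Qed.

(** One index [k] sets both the threshold [1 / (k + 1)] and the rank from which it holds; these sets
    exhaust the points where [a > 0], up to a null set. *)
Let A (k : nat) : set X :=
  [set x | forall n, (k <= n)%N -> (k.+1%:R^-1)%:E <= a_ n x].

Let mA k : measurable (A k).
Proof.
rewrite (_ : A k = \bigcap_(n in [set n | (k <= n)%N])
    [set x | (k.+1%:R^-1)%:E <= a_ n x]).
  apply: bigcap_measurable => [|n _]; first by exists k => /=.
  rewrite -[X in measurable X]setTI; exact: emeasurable_fun_c_infty.
by apply/seteqP; split => x /= H n; exact: H.
Qed.

Let C0 : (0 <= C)%R.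
Proof.
rewrite -lee_fin; apply: le_trans (aN_ 0); apply: integral_ge0 => x _.
by rewrite mule_ge0.
Qed.

Let small k : exists2 K : R, (0 <= K)%R &
  \forall n \near \oo, forall eps, (0 < eps)%R ->
    \int[P]_z `|((bump_kernel_mass d eps * F_ n z - mollP eps (F_ n) z) *
      \1_(A k) z.1)%:E| <= (bump_kernel_mass d eps * (eps * K))%:E.
Proof.
have [K0 K00 HK0] := mass_bound.
(* [d] comes from [|w|_1 <= d * eps] on the cube, [k.+1 * C] from dividing the weighted bound by the
   threshold of [A k], and [2 * K0] from the mass term of the translation estimate. *)
exists (d%:R * (k.+1%:R * C + 2 * K0))%R.
  by rewrite mulr_ge0// addr_ge0// mulr_ge0.
exists k => // n /= kn eps eps0.
pose I x := \int[lam]_v (F_ n (x, v))%:E.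
have I0 x : 0 <= I x by apply: integral_ge0 => v _; rewrite lee_fin.
have mI : measurable_fun setT I.
  apply: (measurable_fun_fubini_tonelli_F (EFin \o F_ n)) => [|z].
    exact/measurable_EFinP.
  by rewrite lee_fin.
have mNI : measurable_fun setT (fun x => N_ n x + 2%:E * I x).
  by apply: emeasurable_funD => //; apply: emeasurable_funM => //; exact: measurable_cst.
have NI0 x : 0 <= N_ n x + 2%:E * I x by rewrite adde_ge0// mule_ge0.
have de0 : (0 <= d%:R * eps :> R)%R by rewrite mulr_ge0// ltW.
pose B x := (d%:R * eps)%:E * (N_ n x + 2%:E * I x).
have mB : measurable_fun setT B by apply: emeasurable_funM => //; exact: measurable_cst.
have B0 x : 0 <= B x by rewrite mule_ge0.
apply: le_trans (mollP_dist_bound eps0 (iF_ n) (mA k) mB B0 _) _.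
  apply: filterS (translF n) => x trx Akx w we.
  have ax : 0 < a_ n x by apply: lt_le_trans (Akx n kn); rewrite lte_fin invr_gt0.
  apply: le_trans (trx ax w) _; rewrite lee_wpmul2r// lee_fin.
  apply: (@le_trans _ _ (\sum_(i < d) eps)%R).
    by apply: ler_sum => i _; rewrite ler_norml.
  by rewrite sumr_const card_ord mulr_natl.
rewrite EFinM; apply: lee_wpmul2l.
  by rewrite lee_fin ltW//; exact: bump_kernel_mass_gt0.
rewrite /B ge0_integralZl_EFin//; last exact: measurable_funTS.
rewrite mulrA [(eps * _)%R]mulrC [leRHS]EFinM; apply: lee_wpmul2l.
  by rewrite lee_fin.
rewrite ge0_integralD//; first last.
- by apply/measurable_funTS/emeasurable_funM => //; exact: measurable_cst.
- by move=> x _; rewrite mule_ge0.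
- exact: measurable_funTS.
rewrite [leRHS]EFinD; apply: leeD.
  rewrite EFinM; apply: le_trans (lee_wpmul2l _ (aN_ n)); last by rewrite lee_fin.
  have maN : measurable_fun setT (fun x => a_ n x * N_ n x).
    exact: emeasurable_funM.
  rewrite -ge0_integralZl_EFin//; last by move=> x _; rewrite mule_ge0.
  apply: (@le_trans _ _ (\int[m]_(x in A k) (k.+1%:R%:E * (a_ n x * N_ n x)))).
    apply: ge0_le_integral => //.
    - exact: measurable_funTS.
    - apply: measurable_funTS; apply: emeasurable_funM => //; exact: measurable_cst.
    move=> x Akx; rewrite muleA -[leLHS]mul1e lee_wpmul2r//.
    apply: le_trans (lee_wpmul2l _ (Akx n kn)); last by rewrite lee_fin.
    by rewrite -EFinM mulfV.
  apply: ge0_subset_integral => //.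
  - apply: emeasurable_funM => //; exact: measurable_cst.
  - by move=> x _; rewrite !mule_ge0.
rewrite ge0_integralZl_EFin//; last exact: measurable_funTS.
rewrite EFinM lee_wpmul2l ?lee_fin//; apply: le_trans (HK0 n).
have mabs : measurable_fun setT (fun z => `|(F_ n z)%:E|).
  by apply: measurableT_comp => //; exact/measurable_EFinP.
rewrite (fubini_tonelli1 _ mabs)//.
apply: (@le_trans _ _ (\int[m]_x I x)).
  by apply: ge0_subset_integral.
rewrite le_eqVlt; apply/orP; left; apply/eqP/eq_integral => x _.
by apply: eq_integral => v _; rewrite gee0_abs// lee_fin.
Qed.

Let I k (z : X * 'rV[R]_d) : R := (\1_(A k) z.1 * \1_(cube k%:R) z.2)%R.

Let mI k : measurable_fun setT (I k).
Proof.
have mcube := @measurable_cube R d k%:R.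
apply: measurable_funM.
  exact: (measurableT_comp (measurable_indic (mA k)) measurable_fst).
exact: (measurableT_comp (measurable_indic mcube) measurable_snd).
Qed.

Let I01 k z : (0 <= I k z <= 1)%R.
Proof.
by rewrite /I !indicE; case: (_ \in _); case: (_ \in _);
  rewrite ?mulr1 ?mulr0 ?lexx ?ler01.
Qed.

Let A_eventually x : 0 < a x -> a_ ^~ x @ \oo --> a x ->
  \forall k \near \oo, A k x.
Proof.
move=> ax0 acvg.
have [b b0 bax] : exists2 b : R, (0 < b)%R & b%:E < a x.
  (* The limit may be [+oo], in which case any positive real would do. *)
  case: (a x) ax0 => [r|_|//]; last by exists 1%R => //; exact: ltry.
  rewrite lte_fin => r0; exists (r / 2)%R; first by rewrite divr_gt0.
  by rewrite lte_fin gtr_pMr// invf_lt1 ?ltr1n.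
have [n0 _ Hn0] : \forall n \near \oo, b%:E < a_ n x.
  apply: (acvg [set y | b%:E < y]); apply: open_nbhs_nbhs; split => //.
  exact: open_ereal_gt_ereal.
near=> k => n kn; apply: (@le_trans _ _ b%:E).
  rewrite lee_fin ltW//; near: k.
  exact: (near_infty_natSinv_lt (PosNum b0)).
apply: ltW; apply: Hn0; apply: leq_trans kn; near: k; exact: nbhs_infty_ge.
Unshelve. all: by end_near. Qed.

Let cube_eventually (v : 'rV[R]_d) : \forall k \near \oo, cube k%:R v.
Proof.
near=> k => i; rewrite -ler_norml.
apply: (@le_trans _ _ (\sum_j `|v ord0 j|)%R).
  by rewrite (bigD1 i)//= lerDl sumr_ge0.
near: k; exact: nbhs_infty_ger.
Unshelve. all: by end_near. Qed.

(** Almost everywhere, either [a] is zero and so is [F], or [I k] is eventually 1; [F] itself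
    dominates. *)
Let tail_cvg : (fun k => \int[P]_z (F z * (1 - I k z))%:E) @ \oo --> 0.
Proof.
have mf k : measurable_fun setT (fun z => (F z * (1 - I k z))%:E).
  apply/measurable_EFinP; apply: measurable_funM => //.
  by apply: measurable_funB => //; exact: measurable_cst.
have cvg0 : {ae P, forall z, setT z ->
    (fun k => (F z * (1 - I k z))%:E) @ \oo --> cst 0 z}.
  have acvgP : {ae P, forall z, 0 < a z.1 -> a_ ^~ z.1 @ \oo --> a z.1}.
    exact: (ae_prod_fst lam a_cvg).
  apply: filterS2 suppF acvgP => z sz az _.
  have [az0|az0] := eqVneq (a z.1) 0.
    rewrite (_ : (fun k => _) = fun=> 0); first exact: cvg_cst.
    by apply/funext => k; rewrite sz// mul0r.
  have {}az0 : 0 < a z.1 by rewrite lt_neqAle eq_sym az0 a0.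
  apply: cvg_near_cst.
  apply: filterS2 (A_eventually az0 (az az0)) (cube_eventually z.2) => k Ak ck.
  by rewrite /I !indicE !mem_set// mulr1 subrr mulr0.
have dom : {ae P, forall z k, setT z ->
    `|(F z * (1 - I k z))%:E| <= (EFin \o F) z}.
  apply: aeW => z k _; have /andP[Ik0 Ik1] := I01 k z.
  rewrite gee0_abs; last by rewrite lee_fin mulr_ge0// subr_ge0.
  by rewrite lee_fin ler_piMr// gerBl.
have [_ _] := dominated_convergence measurableT mf (measurable_cst _) cvg0 iF dom.
by rewrite integral0.
Qed.

Lemma strong_L1_cvg : (fun n => \int[P]_z `|(F_ n z - F z)%:E|) @ \oo --> 0.
Proof.
have [K0 K00 HK0] := mass_bound.
apply: Scheffe => //.
have max0 n z : 0 <= (Num.max (F z - F_ n z) 0)%R%:E.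
  by rewrite lee_fin le_max lexx orbT.
apply/cvge0P => [n|eta eta0]; first exact: integral_ge0.
have eta20 : (0 < eta / 2)%R by rewrite divr_gt0.
have tail0 k : 0 <= \int[P]_z (F z * (1 - I k z))%:E.
  apply: integral_ge0 => z _; rewrite lee_fin mulr_ge0// subr_ge0.
  by have /andP[] := I01 k z.
(* The cut-off [k] is chosen from [F] alone, before [n]; local convergence is then used for this
   single [k]. *)
have [k _ /(_ k (leqnn _)) tailk] := (cvge0P tail0).1 tail_cvg _ eta20.
have [K K_ge0 smallK] := small k.
have loc := local_L1_cvg iF_ iF weakF avgF HK0 (mA k) K_ge0 smallK k%:R.
have loc0 n : 0 <= \int[P]_z `|((F_ n z - F z) * I k z)%:E| by apply: integral_ge0.
apply: filterS ((cvge0P loc0).1 loc _ eta20) => n locn.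
have ml : measurable_fun setT (fun z => `|((F_ n z - F z) * I k z)%:E|).
  apply: measurableT_comp => //; apply/measurable_EFinP.
  by apply: measurable_funM => //; exact: measurable_funB.
have mt : measurable_fun setT (fun z => (F z * (1 - I k z))%:E).
  apply/measurable_EFinP; apply: measurable_funM => //.
  by apply: measurable_funB => //; exact: measurable_cst.
have t0 z : 0 <= (F z * (1 - I k z))%:E.
  by rewrite lee_fin mulr_ge0// subr_ge0; have /andP[] := I01 k z.
apply: (@le_trans _ _ (\int[P]_z (`|((F_ n z - F z) * I k z)%:E| +
    (F z * (1 - I k z))%:E))).
  apply: ge0_le_integral => //.
  - apply/measurable_EFinP; apply: measurable_maxr; last exact: measurable_cst.
    exact: measurable_funB.
  - exact: emeasurable_funD.
  move=> z _; rewrite -EFinD lee_fin ge_max; have /andP[Ik0 Ik1] := I01 k z.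
  have I1 : (0 <= F z * (1 - I k z))%R by rewrite mulr_ge0// subr_ge0.
  have I2 : (0 <= F_ n z * (1 - I k z))%R by rewrite mulr_ge0// subr_ge0.
  rewrite addr_ge0// andbT normrM [`|I k z|%R]ger0_norm//.
  have H : ((F z - F_ n z) * I k z <= `|F_ n z - F z| * I k z)%R.
    by rewrite ler_wpM2r// distrC ler_norm.
  (* Nonnegativity of [F_ n] enters here: on the part weighted by [1 - I k] it is simply dropped, so
     only the tail of [F] has to be small. *)
  apply: (@le_trans _ _ ((F z - F_ n z) * I k z + F z * (1 - I k z)))%R.
    by rewrite -subr_ge0; move: I2; congr (_ <= _)%R; ring.
  by rewrite lerD2r.
rewrite ge0_integralD// [eta]splitr EFinD; exact: leeD.
Qed.

End strong_convergence.

(** * Measurable representatives vanishing off the domain *)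

Section representatives.
Local Open Scope ereal_scope.
Context d (T : measurableType d) (R : realType) (mu : {measure set T -> \bar R}).
Variable D : set T.
Hypothesis mD : measurable D.

Lemma measurable_representative (f : T -> R) : lebesgue_measurable_fun mu D f ->
  exists g : T -> R, [/\ measurable_fun setT g, forall x, ~ D x -> g x = 0%R &
    {ae mu, forall x, D x -> g x = f x}].
Proof.
move=> [g mg fg]; exists (g \_ D); split.
- exact: (measurable_restrictT _ mD).1.
- by move=> x Dx; rewrite patchE memNset.
- by apply: filterS fg => x fg Dx; rewrite patchE mem_set// fg.
Qed.

Lemma ge0_measurable_representative (f : T -> R) :
  {ae mu, forall x, D x -> (0 <= f x)%R} -> lebesgue_measurable_fun mu D f ->
  exists g : T -> R, [/\ measurable_fun setT g, forall x, (0 <= g x)%R,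
    forall x, ~ D x -> g x = 0%R & {ae mu, forall x, D x -> g x = f x}].
Proof.
move=> f0 /measurable_representative[g [mg g0 gf]].
exists (fun x => Num.max (g x) 0)%R; split.
- by apply: measurable_maxr => //; exact: measurable_cst.
- by move=> x; rewrite le_max lexx orbT.
- by move=> x /g0 ->; rewrite maxxx.
- by apply: filterS2 f0 gf => x f0 gf Dx; rewrite gf// max_l// f0.
Qed.

Lemma ge0_emeasurable_representative (f : T -> \bar R) :
  (forall x, D x -> 0 <= f x) -> lebesgue_measurable_fun mu D f ->
  exists g : T -> \bar R, [/\ measurable_fun setT g, forall x, 0 <= g x,
    forall x, ~ D x -> g x = 0 & {ae mu, forall x, D x -> g x = f x}].
Proof.
move=> f0 [g mg fg]; exists (fun x => maxe ((g \_ D) x) 0); split.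
- apply: measurable_maxe; last exact: measurable_cst.
  exact: (measurable_restrictT _ mD).1.
- by move=> x; rewrite le_max lexx orbT.
- by move=> x Dx; rewrite patchE memNset// maxxx.
- by apply: filterS fg => x fg Dx; rewrite patchE mem_set// -fg// max_l// f0.
Qed.

Lemma representative_integrable (f g : T -> R) : in_L1 mu D f ->
  measurable_fun setT g -> (forall x, ~ D x -> g x = 0%R) ->
  {ae mu, forall x, D x -> g x = f x} -> mu.-integrable setT (EFin \o g).
Proof.
move=> [_ foo] mg g0 gf; apply/integrableP; split; first exact/measurable_EFinP.
rewrite (_ : \int[mu]_x _ = \int[mu]_(x in D) `|f x|%:E)//.
rewrite [RHS]integral_mkcond; apply: ae_eq_integral_any.
apply: filterS gf => x gf _; rewrite patchE.
case: ifPn => [|]; first by rewrite inE => Dx; rewrite /= gf.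
by rewrite notin_setE => Dx; rewrite /= g0// normr0.
Qed.

Lemma representative_Rintegral (f g s : T -> R) :
  (forall x, ~ D x -> g x = 0%R) -> {ae mu, forall x, D x -> g x = f x} ->
  (\int[mu]_x (g x * s x) = \int[mu]_(x in D) (f x * s x))%R.
Proof.
move=> g0 gf; rewrite [RHS]Rintegral_mkcond; apply: ae_eq_Rintegral_any.
apply: filterS gf => x gf _; rewrite patchE.
case: ifPn => [|]; first by rewrite inE => Dx; rewrite gf.
by rewrite notin_setE => Dx; rewrite g0// mul0r.
Qed.

Lemma representative_L1_dist (f f' g g' : T -> R) :
  (forall x, ~ D x -> g x = 0%R) -> (forall x, ~ D x -> g' x = 0%R) ->
  {ae mu, forall x, D x -> g x = f x} -> {ae mu, forall x, D x -> g' x = f' x} ->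
  \int[mu]_x `|(g x - g' x)%:E| = \int[mu]_(x in D) `|f x - f' x|%:E.
Proof.
move=> g0 g0' gf gf'; rewrite [RHS]integral_mkcond; apply: ae_eq_integral_any.
apply: filterS2 gf gf' => x gf gf' _; rewrite patchE.
case: ifPn => [|]; first by rewrite inE => Dx; rewrite gf// gf'.
by rewrite notin_setE => Dx; rewrite g0// g0'// subrr abse0.
Qed.

Lemma in_Loo_bounded (s : T -> R) : measurable_fun setT s ->
  (forall x, `|s x| <= 1)%R -> in_Loo mu D s.
Proof.
move=> ms s1; split; last by exists 1%R; apply: aeW.
by exists s; [exact: measurable_funTS|apply: aeW].
Qed.

(** Tested against the indicator of the set where the representative [g] of [f] is negative, the
    limit integral is at least 0 although its integrand is at most 0, so [f] vanishes almost
    everywhere on that set. *)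
Lemma weak_cvg_L1_ge0 (f_ : nat -> T -> R) (f : T -> R) :
  (forall n x, D x -> (0 <= f_ n x)%R) -> weak_cvg_L1 mu D f_ f ->
  {ae mu, forall x, D x -> (0 <= f x)%R}.
Proof.
move=> f_0 [_ fL1 fw].
have [g [mg g0 gf]] := measurable_representative fL1.1.
pose s x : R := (if g x < 0 then 1 else 0)%R.
have ms : measurable_fun setT s.
  apply: measurable_fun_ifT; [|exact: measurable_cst|exact: measurable_cst].
  by apply: measurable_fun_ltr => //; exact: measurable_cst.
have s0 x : (0 <= s x)%R by rewrite /s; case: ifP.
have s1 x : (`|s x| <= 1)%R.
  by rewrite /s; case: ifP; rewrite ?normr1 ?normr0.
have ge0 : (0 <= \int[mu]_(x in D) (f x * s x))%R.
  apply: (cvgr_to_ge (fw s (in_Loo_bounded ms s1))); apply: nearW => n.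
  by apply: Rintegral_ge0 => x Dx; rewrite mulr_ge0// f_0.
have ig := representative_integrable fL1 mg g0 gf.
have igs := integrableM_bounded ig ms s1.
have gsE x : (`|g x * s x| = - (g x * s x))%R.
  rewrite /s; case: ifPn => gx; first by rewrite mulr1 ltr0_norm.
  by rewrite mulr0 normr0 oppr0.
have int0 : \int[mu]_x `|(EFin \o (fun x => g x * s x)%R) x| = 0.
  apply/eqP; rewrite eq_le integral_ge0 ?andbT//.
  rewrite (_ : \int[mu]_x _ = (-1 * \int[mu]_x (g x * s x))%R%:E).
    by rewrite lee_fin mulN1r oppr_le0 (representative_Rintegral s g0 gf).
  rewrite -RintegralZl// /Rintegral fineK.
    by apply: eq_integral => x _ /=; rewrite gsE mulN1r.
  exact: (integrable_fin_num measurableT (integrableZl measurableT (-1)%R igs)).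
have := (ae_eq_integral_abs mu measurableT (measurable_int _ igs)).1 int0.
apply: filterS2 gf => x gf gs0 Dx.
have {}gs0 := EFin_inj (gs0 Logic.I).
rewrite -gf// leNgt; apply/negP => gx; move: gs0; rewrite /s gx mulr1 => gx0.
by rewrite gx0 ltxx in gx.
Qed.

End representatives.

(** * Almost everywhere convergent subsequences *)

Section L1_cvg_subsequence.
Local Open Scope ereal_scope.
Context d (T : measurableType d) (R : realType).
Variable mu : {measure set T -> \bar R}.

Lemma near_subseq (P : nat -> nat -> Prop) :
  (forall k, \forall n \near \oo, P k n) ->
  exists s : nat -> nat, {homo s : m n / (m < n)%N} /\ forall k, P k (s k).
Proof.
move=> nearP.
have /choice[N HN] : forall k, exists N, forall n, (N <= n)%N -> P k n.
  by move=> k; have [N _ HN] := nearP k; exists N => n Nn; exact: HN.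
pose s := fix s k := if k is k'.+1 then maxn (N k) (s k').+1 else N 0%N.
exists s; split.
  by apply: homo_ltn; [exact: ltn_trans|move=> k; rewrite /= leq_max leqnn orbT].
by case=> [|k]; apply: HN => //=; rewrite leq_max leqnn.
Qed.

Lemma homo_ltn_ge (s : nat -> nat) : {homo s : m n / (m < n)%N} ->
  forall k, (k <= s k)%N.
Proof.
by move=> hs; elim=> // k IH; apply: leq_ltn_trans IH _; exact: hs.
Qed.

(** The [k]-th index is chosen so late that the L^1 distance is at most [2^-(k+1)], which makes the
    distances summable. *)
Lemma L1_cvg_ae_subseq (u : nat -> T -> R) (v : T -> R) :
  (forall n, measurable_fun setT (u n)) -> measurable_fun setT v ->
  (fun n => \int[mu]_x `|(u n x - v x)%:E|) @ \oo --> 0 ->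
  exists s : nat -> nat, {homo s : m n / (m < n)%N} /\
    {ae mu, forall x, (fun k => u (s k) x) @ \oo --> v x}.
Proof.
move=> mu_ mv uv.
have u0 n : 0 <= \int[mu]_x `|(u n x - v x)%:E| by exact: integral_ge0.
have [s [hs sP]] := near_subseq (fun k => (cvge0P u0).1 uv (1 / (2 ^ k.+1)%:R)%R
  ltac:(by rewrite divr_gt0// ltr0n expn_gt0)).
exists s; split => //.
have : {ae mu, forall x, (fun k => `|(u (s k) x - v x)%:E|) @ \oo --> 0}.
  apply: (@ae_cvg_summable_integral _ T R mu (fun k x => `|(u (s k) x - v x)%:E|)) => //.
  move=> k; apply: measurableT_comp => //; apply/measurable_EFinP.
  exact: measurable_funB.
apply: filterS => x /fine_cvg /= H; apply/cvgrPdist_le => e e0.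
have /cvgr0Pnorm_le /(_ e e0) := H; apply: filterS => k /=.
by rewrite normr_id distrC.
Qed.

End L1_cvg_subsequence.

(** * Transfer from representatives to the given data *)

Unset Implicit Arguments.

Theorem proposition2p1 (R : realType) (d : nat)
  (Omega : set 'rV[R]_d) (T : R)
  (Omega_open : open Omega) (T_gt0 : 0 < T)
  (f_ : nat -> (measurableTypeR R * 'rV[R]_d) * 'rV[R]_d -> R)
  (f : (measurableTypeR R * 'rV[R]_d) * 'rV[R]_d -> R)
  (a_ : nat -> measurableTypeR R * 'rV[R]_d -> \bar R)
  (a : measurableTypeR R * 'rV[R]_d -> \bar R)
  (C : R)
  (f_ge0 : forall m z, domain_txv T Omega z -> 0 <= f_ m z)
  (P1 : weak_cvg_L1 (lebesgue_txv d) (domain_txv T Omega) f_ f)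
  (P2 : forall psi : 'rV[R]_d -> R, in_Cc psi ->
    exists rho : measurableTypeR R * 'rV[R]_d -> R,
      cvg_L1 (lebesgue_tx d) (domain_tx T Omega)
        (fun m tx => \int[lebesgue_rV d]_v (f_ m (tx, v) * psi v)) rho)
  (a_ge0 : forall m tx, domain_tx T Omega tx -> (0 <= a_ m tx)%E)
  (a_meas : forall m,
    lebesgue_measurable_fun (lebesgue_tx d) (domain_tx T Omega) (a_ m))
  (P3 : forall m,
    exists G : (measurableTypeR R * 'rV[R]_d) * 'rV[R]_d -> 'rV[R]_d,
    [/\ forall i, lebesgue_measurable_fun (lebesgue_txv d) (domain_txv T Omega)
          (fun z => G z ord0 i),
        {ae lebesgue_tx d, forall tx, domain_tx T Omega tx -> (0 < a_ m tx)%E ->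
          is_weak_gradient (fun v => Num.sqrt (f_ m (tx, v)))
            (fun v => G (tx, v))} &
        (\int[lebesgue_txv d]_(z in domain_txv T Omega)
           (a_ m z.1 * (eucl_norm_sq (G z))%:E) <= C%:E)%E])
  (alim_ge0 : forall tx, domain_tx T Omega tx -> (0 <= a tx)%E)
  (alim_meas : lebesgue_measurable_fun (lebesgue_tx d) (domain_tx T Omega) a)
  (P4_cvg : {ae lebesgue_tx d, forall tx, domain_tx T Omega tx -> (0 < a tx)%E ->
    a_ ^~ tx @ \oo --> a tx})
  (P4_supp : {ae lebesgue_tx d, forall tx, domain_tx T Omega tx ->
    ((0 < a tx)%E <-> (0 < \int[lebesgue_rV d]_v (f (tx, v))%:E)%E)}) :
  exists s : nat -> nat,
    [/\ {homo s : m n / (m < n)%N},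
        {ae lebesgue_txv d, forall z, domain_txv T Omega z ->
          (fun k => f_ (s k) z) @ \oo --> f z} &
        cvg_L1 (lebesgue_txv d) (domain_txv T Omega) (fun k => f_ (s k)) f].
Proof.
set D := domain_tx T Omega; set Dv := domain_txv T Omega.
set tx := @lebesgue_tx R d; set lam := @lebesgue_rV R d.
have mD : measurable D.
  by apply: measurableX; [exact: measurable_itv|exact: open_measurable_rV].
have mDv : measurable Dv by exact: measurableX.
have [f_L1 fL1 fweak] := P1.
have f0 := weak_cvg_L1_ge0 mDv f_ge0 P1.
have /choice[F_ HF_] n : exists g : (measurableTypeR R * 'rV[R]_d) * 'rV[R]_d -> R,
    [/\ measurable_fun setT g,
    forall x, (0 <= g x)%R, forall x, ~ Dv x -> g x = 0%R &
    {ae @lebesgue_txv R d, forall x, Dv x -> g x = f_ n x}].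
  apply: ge0_measurable_representative => //; last by case: (f_L1 n).
  by apply: aeW; exact: f_ge0.
have [F [mF F0 Fout FE]] := ge0_measurable_representative mDv f0 fL1.1.
have mF_ n : measurable_fun setT (F_ n) by case: (HF_ n).
have F_0 n z : 0 <= F_ n z by case: (HF_ n).
have F_out n z : ~ Dv z -> F_ n z = 0 by case: (HF_ n) => _ _ H _; exact: H.
have F_E n : {ae @lebesgue_txv R d, forall z, Dv z -> F_ n z = f_ n z}.
  by case: (HF_ n).
have iF_ n : (tx \x lam)%E.-integrable setT (EFin \o F_ n).
  (* [lebesgue_txv d] is by definition the product of [tx] and [lam], so [H] has the required type
     up to conversion. *)
  have H := representative_integrable (f_L1 n) (mF_ n) (F_out n) (F_E n).
  exact H.
have iF : (tx \x lam)%E.-integrable setT (EFin \o F).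
  have H := representative_integrable fL1 mF Fout FE; exact H.
have weakF (s : (measurableTypeR R * 'rV[R]_d) * 'rV[R]_d -> R) :
    measurable_fun setT s -> (forall z, `|s z| <= 1) ->
    (fun n => \int[(tx \x lam)%E]_z (F_ n z * s z)) @ \oo -->
    \int[(tx \x lam)%E]_z (F z * s z).
  move=> ms s1; have := fweak s (in_Loo_bounded _ _ ms s1).
  rewrite -(representative_Rintegral s Fout FE).
  apply: cvg_trans; apply: near_eq_cvg; apply: nearW => n.
  exact/esym/(representative_Rintegral s (F_out n) (F_E n)).
have slice_out (x : measurableTypeR R * 'rV[R]_d) (v : 'rV[R]_d) :
    ~ D x -> ~ Dv (x, v) by move=> Dx [].
have F_slice n : {ae tx, forall x, {ae lam, forall v, D x ->
    F_ n (x, v) = f_ n (x, v)}}.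
  apply: filterS (ae_prod_slice (F_E n)) => x; apply: filterS => v H Dx.
  by apply: H; split.
have avgF psi : in_Cc psi -> exists2 rho, tx.-integrable setT (EFin \o rho) &
    (fun n => \int[tx]_x `|((\int[lam]_v (F_ n (x, v) * psi v))%R - rho x)%:E|)%E
      @ \oo --> 0%E.
  move=> /P2[rho0 [_ rhoL1 cvgrho]].
  have [rho [mrho rho_out rhoE]] := measurable_representative mD rhoL1.1.
  exists rho; first exact: (representative_integrable rhoL1 mrho rho_out rhoE).
  apply: cvg_trans cvgrho; apply: near_eq_cvg; apply: nearW => n.
  apply/esym/(representative_L1_dist _ rho_out _ rhoE).
    move=> x Dx; rewrite /Rintegral integral0_eq// => v _.
    by rewrite F_out ?mul0r//; exact: slice_out.
  apply: filterS (F_slice n) => x Fx Dx; apply: ae_eq_Rintegral_any.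
  by apply: filterS Fx => v -> .
have /choice[A_ HA_] n := ge0_emeasurable_representative mD (a_ge0 n) (a_meas n).
have [A [mA A0 Aout AE]] := ge0_emeasurable_representative mD alim_ge0 alim_meas.
have [G HG] := choice P3.
have repD n i : exists g : (measurableTypeR R * 'rV[R]_d) * 'rV[R]_d -> R,
    [/\ measurable_fun setT g,
    forall z, ~ Dv z -> g z = 0 &
    {ae @lebesgue_txv R d, forall z, Dv z -> g z = G n z ord0 i}].
  by apply: measurable_representative => //; case: (HG n).
have [D2 HD2] := choice (fun p : nat * 'I_d => repD p.1 p.2).
pose D_ n i := D2 (n, i); have HD_ n i := HD2 (n, i).
have mD_ n i : measurable_fun setT (D_ n i) by case: (HD_ n i).
have mA_ n : measurable_fun setT (A_ n) by case: (HA_ n).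
have A_0 n x : (0 <= A_ n x)%E by case: (HA_ n).
have A_out n x : ~ D x -> A_ n x = 0%E by case: (HA_ n) => _ _ H _; exact: H.
have A_E n : {ae tx, forall x, D x -> A_ n x = a_ n x} by case: (HA_ n).
have D_E n i : {ae @lebesgue_txv R d, forall z, Dv z -> D_ n i z = G n z ord0 i}.
  by case: (HD_ n i).
pose sqD n i (z : (measurableTypeR R * 'rV[R]_d) * 'rV[R]_d) : \bar R :=
  (D_ n i z ^+ 2)%:E.
have msqD n i : measurable_fun setT (sqD n i).
  by apply/measurable_EFinP; exact: measurable_funX.
have sqD0 n i z : (0 <= sqD n i z)%E by rewrite lee_fin sqr_ge0.
pose N_ n (x : measurableTypeR R * 'rV[R]_d) : \bar R :=
  (\sum_i \int[lam]_v sqD n i (x, v))%E.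
have mN_ n : measurable_fun setT (N_ n).
  apply: emeasurable_sum => i.
  exact: (measurable_fun_fubini_tonelli_F (sqD n i)).
have N_0 n x : (0 <= N_ n x)%E.
  by apply: sume_ge0 => i _; apply: integral_ge0.
(* The left side equals the integral in (P3): Tonelli merges the two integrations, and the
   representatives agree with the data almost everywhere on the domain, while [A_ n] vanishes off
   it. *)
have aN_ n : (\int[tx]_x (A_ n x * N_ n x) <= C%:E)%E.
  case: (HG n) => _ _ HC.
  pose H (z : (measurableTypeR R * 'rV[R]_d) * 'rV[R]_d) : \bar R :=
    (A_ n z.1 * \sum_i sqD n i z)%E.
  have mH : measurable_fun setT H.
    apply: emeasurable_funM; first exact: (measurableT_comp (mA_ n) measurable_fst).
    exact: emeasurable_sum.
  have H0 z : (0 <= H z)%E by rewrite mule_ge0// sume_ge0.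
  apply: le_trans HC; rewrite le_eqVlt; apply/orP; left; apply/eqP.
  transitivity (\int[tx]_x \int[lam]_v H (x, v))%E.
    apply: eq_integral => x _; rewrite /H/= ge0_integralZl//.
    - rewrite ge0_integral_sum// => i.
      exact: (measurableT_comp (msqD n i) (measurable_pair1 x)).
    - apply: emeasurable_sum => i.
      exact: (measurableT_comp (msqD n i) (measurable_pair1 x)).
    - by move=> v _; rewrite sume_ge0.
  transitivity (\int[(tx \x lam)]_z H z)%E; first exact/esym/(fubini_tonelli1 H mH H0).
  rewrite [RHS]integral_mkcond; apply: ae_eq_integral_any.
  have DE : {ae @lebesgue_txv R d, forall z, forall i, Dv z ->
      D_ n i z = G n z ord0 i}.
    by apply: filter_forall => i; exact: D_E.
  apply: filterS2 (ae_prod_fst lam (A_E n)) DE => z Az Dz _.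
  rewrite patchE; case: ifPn => [|]; last first.
    rewrite notin_setE => zD; rewrite /H A_out ?mul0e//.
    by move=> Dz1; apply: zD; split.
  rewrite inE => zD; rewrite /H Az; last by case: zD.
  rewrite /eucl_norm_sq -sumEFin; congr (_ * _)%E; apply: eq_bigr => i _.
  by rewrite /sqD Dz.
have D_slice n : {ae tx, forall x, forall i, {ae lam, forall v, D x ->
    D_ n i (x, v) = G n (x, v) ord0 i}}.
  apply: filter_forall => i.
  apply: filterS (ae_prod_slice (D_E n i)) => x; apply: filterS => v H Dx.
  by apply: H; split.
have translF n : {ae tx, forall x, (0 < A_ n x)%E -> forall w : 'rV[R]_d,
    (\int[lam]_v `|(F_ n (x, v + w) - F_ n (x, v))%:E| <=
    (\sum_i `|w ord0 i|)%R%:E * (N_ n x + 2%:E * \int[lam]_v (F_ n (x, v))%:E))%E}.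
  case: (HG n) => _ HW _.
  apply: filterS2 (filterI HW (A_E n)) (filterI (F_slice n) (D_slice n)).
  move=> x [Wx Ax] [Fx Dx] Apos w.
  (* [A_ n] is zero off the domain, so its positivity puts [x] inside, where the weak gradient is
     available. *)
  have xD : D x.
    by apply: contrapT => xD; move: Apos; rewrite A_out// ltxx.
  apply: (@translation_bound R d (fun v => F_ n (x, v)) (fun v => f_ n (x, v))
    (fun i v => D_ n i (x, v)) (fun v => G n (x, v))).
  - exact: measurable_slice.
  - by move=> v; exact: F_0.
  - by apply: filterS Fx => v; apply.
  - by move=> i; exact: measurable_slice.
  - by move=> i; apply: filterS (Dx i) => v; apply.
  - by apply: Wx => //; rewrite -Ax.
have a_cvg : {ae tx, forall x, (0 < A x)%E -> A_ ^~ x @ \oo --> A x}.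
  apply: filterS2 (filterI P4_cvg AE) (ae_foralln A_E) => x [cvgx Ax] A_x Apos.
  have xD : D x.
    by apply: contrapT => xD; move: Apos; rewrite Aout// ltxx.
  rewrite Ax//; have := cvgx xD; rewrite -Ax// => /(_ Apos).
  by apply: cvg_trans; apply: near_eq_cvg; apply: nearW => n; rewrite A_x.
have suppF : {ae (tx \x lam)%E, forall z, A z.1 = 0%E -> F z = 0}.
  (* By (P4), for almost every [x] in the domain with [A x = 0] the integral of [f (x, v)] over [v]
     is not positive; as it equals that of the nonnegative [F (x, v)], it is zero. So [H] is
     nonnegative with zero integral, and vanishes almost everywhere. *)
  pose H (z : (measurableTypeR R * 'rV[R]_d) * 'rV[R]_d) : R :=
    F z * \1_[set x | A x = 0%E] z.1.
  have mA0 : measurable [set x | A x = 0%E].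
    by rewrite -[X in measurable X]setTI; exact: mA (emeasurable_set1 0%E).
  have mH : measurable_fun setT (EFin \o H).
    apply/measurable_EFinP; apply: measurable_funM => //.
    exact: (measurableT_comp (measurable_indic mA0) measurable_fst).
  have H0 z : (0 <= (EFin \o H) z)%E by rewrite lee_fin mulr_ge0.
  have intH : (\int[(tx \x lam)]_z `|(EFin \o H) z| = 0)%E.
    under eq_integral do rewrite gee0_abs//.
    rewrite (fubini_tonelli1 _ mH H0).
    have F_slice0 : {ae tx, forall x, {ae lam, forall v, D x -> F (x, v) = f (x, v)}}.
      apply: filterS (ae_prod_slice FE) => x; apply: filterS => v HFv Dx.
      by apply: HFv; split.
    rewrite -[RHS](@integral0 _ _ _ tx setT).
    apply: ae_eq_integral_any.
    apply: filterS2 (filterI P4_supp AE) F_slice0 => x [suppx Ax] Fx _.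
    rewrite /fubini_F /=; have [A0x|A0x] := eqVneq (A x) 0%E; last first.
      rewrite integral0_eq// => v _; rewrite /H indicE memNset ?mulr0//=.
      exact/eqP.
    rewrite (_ : (\int[lam]_v _ = \int[lam]_v (F (x, v))%:E)%E); last first.
      by apply: eq_integral => v _; rewrite /H indicE mem_set ?mulr1.
    have [xD|xD] := pselect (D x); last first.
      by rewrite integral0_eq// => v _; rewrite Fout//; exact: slice_out.
    have intE : (\int[lam]_v (F (x, v))%:E = \int[lam]_v (f (x, v))%:E)%E.
      by apply: ae_eq_integral_any; apply: filterS Fx => v -> .
    apply/eqP; rewrite eq_le integral_ge0 ?andbT; last first.
      by move=> v _; rewrite lee_fin.
    rewrite leNgt; apply/negP; rewrite intE => /(suppx xD).2.
    by rewrite -Ax// A0x ltxx.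
  have := (ae_eq_integral_abs (tx \x lam)%E measurableT mH).1 intH.
  apply: filterS => z Hz A0z; have := EFin_inj (Hz Logic.I).
  by rewrite /H indicE mem_set ?mulr1.
have Fcvg := strong_L1_cvg F_0 F0 iF_ iF weakF avgF mA_ A0 A_0 mN_ N_0 aN_
  translF a_cvg suppF.
have [s [hs aes]] := L1_cvg_ae_subseq mF_ mF Fcvg.
exists s; split => //.
  apply: filterS2 (filterI aes FE) (ae_foralln F_E) => z [cvgz Fz] F_z zD.
  rewrite -Fz//; apply: cvg_trans cvgz; apply: near_eq_cvg; apply: nearW => k.
  by rewrite /= F_z.
split => //.
have dist0 n : (0 <= \int[lebesgue_txv d]_(z in Dv) `|f_ n z - f z|%:E)%E.
  by apply: integral_ge0 => z _; rewrite lee_fin.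
have distE n : (\int[lebesgue_txv d]_(z in Dv) `|f_ n z - f z|%:E =
    \int[(tx \x lam)]_z `|(F_ n z - F z)%:E|)%E.
  exact/esym/(representative_L1_dist (F_out n) Fout (F_E n) FE).
apply/cvge0P => [k|e e0]; first exact: dist0.
have F0n n : (0 <= \int[(tx \x lam)]_z `|(F_ n z - F z)%:E|)%E.
  exact: integral_ge0.
have [n0 _ Hn0] := (cvge0P F0n).1 Fcvg e e0.
(* The whole sequence converges in L^1, and [k <= s k] hands the rank [n0] down to the
   subsequence. *)
exists n0 => // k /= nk; rewrite distE; apply: Hn0.
exact: leq_trans nk (homo_ltn_ge hs k).
Qed.
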